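(* For every $n\ge1$, the least constant $\beta_n$ such that $$\mu(a_n\cos nt+b_n\sin nt)\le\beta_n\,\mu(f)$$ holds for all $f(t)=\frac{a_0}2+\sum_{k=1}^n(a_k\cos kt+b_k\sin kt)\in\mathcal{F}_n$ equals $\beta_n=\sqrt{2n}$.
   Context: $\mathcal{F}_n$ is the set of real trigonometric polynomials of order at most $n$ with real coefficients. $\mathbb{T}=[0,2\pi)$ with endpoints identified, with Lebesgue measure $\mathrm{mes}$, and for a real function $f$ on $\mathbb{T}$, $\mu(f)=\mathrm{mes}\{t\in\mathbb{T}:|f(t)|\ge1\}$. *)

(* Defs.v *)
From Stdlib Require Import Reals Lra.
Open Scope R_scope.

Definition trigpoly (n : nat) (a b : nat -> R) (t : R) : R :=
  a 0%nat / 2 +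
  sum_f_R0 (fun k => a (S k) * cos (INR (S k) * t) + b (S k) * sin (INR (S k) * t))
           (Nat.pred n).

Definition top_harmonic (n : nat) (a b : nat -> R) (t : R) : R :=
  a n * cos (INR n * t) + b n * sin (INR n * t).

Definition ind_ge1 (f : R -> R) (t : R) : R :=
  if Rle_dec 1 (Rabs (f t)) then 1 else 0.

(* mu_is f m : the measure of {t in [0,2pi) : |f t| >= 1} equals m,
   computed as the (Riemann) integral of its indicator over [0, 2pi]. *)
Definition mu_is (f : R -> R) (m : R) : Prop :=
  exists pr : Riemann_integrable (ind_ge1 f) 0 (2 * PI), RiemannInt pr = m.

Definition admissible (n : nat) (beta : R) : Prop :=
  forall (a b : nat -> R) (m1 m2 : R),
    mu_is (top_harmonic n a b) m1 ->
    mu_is (trigpoly n a b) m2 ->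
    m1 <= beta * m2.

(* Main.v *)
Require Import Defs.
From Stdlib Require Import Reals Lra Lia Arith ZArith ClassicalEpsilon.
From mathcomp Require all_boot all_order all_algebra complex Rstruct ring.
From Coquelicot Require Import Coquelicot.
Open Scope R_scope.

(* Let A be the amplitude of the top harmonic of f and N = 2 n. Factoring f over the
   complex numbers and projecting the roots radially to the unit circle gives
   |f(t)| >= F(t) = (A / 2) prod_j 2 |sin ((t - tau_j) / 2)| with N real zeros tau_j, so it is
   enough to bound from below the total length g of the gaps {F > 1}, for A > 1:
   A cos^N (g / 4) <= 1.

   By compactness g has a minimum over all choices of the zeros. As ln F is jointly concave in
   t and the zeros as long as t stays between two given consecutive zeros, the length of each
   gap is a concave function of the zeros. A minimizer with two intervals between consecutive
   zeros on which max F <> 1, one of them containing a gap, could be moved along a line on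
   which the remaining maxima stay at most 1, and strict concavity would shorten the gaps in
   one of the two directions. Hence there is a single gap and F touches 1 between all
   other zeros: the signed product equioscillates on the complementary arc, so counting zeros
   shows that it coincides with the Chebyshev polynomial T_N(sin (t / 2) / cos (g / 4)) of that
   arc, whose top amplitude is cos^(-N) (g / 4).

   The top harmonic reaches modulus 1 on a set of measure 4 arccos (1 / A), and
   cos (sqrt N x) <= cos^N x turns the bound into the constant sqrt N. The Chebyshev polynomials
   of arcs tending to the full circle show that it cannot be improved. *)

(** Zeros may coincide, and gap lengths need not depend smoothly on them. Hence a configuration
    carries the ends of its gaps as data and only requires the modulus to be at most 1 outside them,
    a condition that survives limits. Concavity enters only through a tangent bound and a midpoint
    inequality in product form, where a vanishing modulus is harmless; no gap length is ever
    differentiated.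

    The direction in which a supposed minimizer is moved comes from a dimension count: [N] zeros
    face [N - 2] maxima to be controlled, and one zero is held fixed because a rotation would change
    nothing. This requires every cell to have an interior critical point, hence simple zeros.
    Multiple zeros are therefore excluded beforehand: pulling two of them apart lowers the modulus
    everywhere else and shortens every gap.

    The square root arises because [cos (c x)] and [cos x ^ N] agree to second order at 0 exactly
    when [c ^ 2 = N]; for the same reason Chebyshev polynomials with short gaps are asymptotically
    extremal. *)

Fixpoint bigsum (f : nat -> R) (n : nat) : R :=
  match n with 0%nat => 0 | S m => bigsum f m + f m end.

Fixpoint bigprod (f : nat -> R) (n : nat) : R :=
  match n with 0%nat => 1 | S m => bigprod f m * f m end.

(** * Complex factorization and radial projection of the roots *)

Lemma polar_coordinates (x y : R) : x * x + y * y <> 0 ->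
  exists tau, 0 <= tau <= 2 * PI /\
    x = sqrt (x * x + y * y) * cos tau /\ y = sqrt (x * x + y * y) * sin tau.
Proof.
intros Hxy.
assert (Hp : 0 < x * x + y * y) by (assert (H := Rle_0_sqr x); assert (H' := Rle_0_sqr y); unfold Rsqr in *; lra).
set (rho := sqrt (x * x + y * y)).
assert (Hr : 0 < rho) by (apply sqrt_lt_R0; lra).
assert (Hr2 : rho * rho = x * x + y * y) by (apply sqrt_sqrt; lra).
assert (Hb : -1 <= x / rho <= 1).
{ split; apply Rmult_le_reg_r with rho; try lra; unfold Rdiv; rewrite Rmult_assoc, Rinv_l by lra; nra. }
assert (Hc : rho * cos (acos (x / rho)) = x) by (rewrite cos_acos by lra; field; lra).
assert (Hs : rho * sin (acos (x / rho)) = Rabs y).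
{ assert (H0 := acos_bound (x / rho)).
  assert (H1 : 0 <= sin (acos (x / rho))) by (apply sin_ge_0; lra).
  apply Rsqr_inj; [nra | apply Rabs_pos |]. rewrite <- Rsqr_abs.
  assert (H2 := sin2_cos2 (acos (x / rho))). unfold Rsqr in *. nra. }
assert (H0 := acos_bound (x / rho)).
destruct (Rle_dec 0 y) as [Hy | Hy].
- exists (acos (x / rho)). rewrite (Rabs_pos_eq y) in Hs by lra. lra.
- exists (2 * PI - acos (x / rho)). rewrite (Rabs_left y) in Hs by lra.
  rewrite cos_minus, sin_minus, cos_2PI, sin_2PI. lra.
Qed.

(** With [rho] the modulus of [x + i y], the two sides differ by exactly [(1 - rho) ^ 2]. The factor
    [rho] does no harm: the moduli of all roots multiply to 1. *)
Lemma projection_closer (x y : R) : x * x + y * y <> 0 ->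
  exists tau, 0 <= tau <= 2 * PI /\ forall t,
    sqrt (x * x + y * y) * (2 * sin ((t - tau) / 2)) ^ 2
      <= (cos t - x) ^ 2 + (sin t - y) ^ 2.
Proof.
intros Hxy. destruct (polar_coordinates x y Hxy) as [tau [Htau [Hx Hy]]].
exists tau. split; [exact Htau |]. intros t.
assert (Hr : 0 <= sqrt (x * x + y * y)) by apply sqrt_pos.
set (rho := sqrt (x * x + y * y)) in *.
assert (Hd : (2 * sin ((t - tau) / 2)) ^ 2 = 2 - 2 * (cos t * cos tau + sin t * sin tau)).
{ rewrite <- cos_minus. replace (t - tau) with (2 * ((t - tau) / 2)) at 2 by field.
  rewrite cos_2a_sin. ring. }
rewrite Hd, Hx, Hy.
assert (H1 := sin2_cos2 t). assert (H2 := sin2_cos2 tau). unfold Rsqr in *.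
assert (H3 := Rle_0_sqr (1 - rho)). unfold Rsqr in H3.
replace ((cos t - rho * cos tau) ^ 2 + (sin t - rho * sin tau) ^ 2)
  with ((sin t * sin t + cos t * cos t) + rho * rho * (sin tau * sin tau + cos tau * cos tau)
        - 2 * rho * (cos t * cos tau + sin t * sin tau)) by ring.
rewrite H1, H2. nra.
Qed.

Module Factorization.
Import all_boot all_order all_algebra complex Rstruct ring.
Import Order.TTheory GRing.Theory Num.Theory.
Delimit Scope R_scope with coqR.
Local Open Scope ring_scope.
Set Implicit Arguments.
Unset Strict Implicit.

Lemma bigsumE (f : nat -> R) n : bigsum f n = \sum_(i < n) f i.
Proof. by elim: n => [|n IH] /=; rewrite ?big_ord0 // big_ord_recr /= IH. Qed.

Lemma bigprodE (f : nat -> R) n : bigprod f n = \prod_(i < n) f i.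
Proof. by elim: n => [|n IH] /=; rewrite ?big_ord0 // big_ord_recr /= IH. Qed.

(** The matrix is square with a zero column, so its determinant vanishes and its left kernel is
    nontrivial. The vector [v] becomes the direction in which the zeros of a supposed minimizer are
    moved. *)
Lemma null_vector (N p : nat) (a : nat -> nat -> R) :
  (p < N)%coq_nat -> (forall j, a p j = IZR 0) ->
  exists v : nat -> R, (exists j, (j < N)%coq_nat /\ v j <> IZR 0) /\
    forall i, (i < N)%coq_nat -> bigsum (fun j => Rmult (v j) (a i j)) N = IZR 0.
Proof.
case: N => [/ssrnat.ltP //|N] /ssrnat.ltP pN ap0; pose A : 'M[R]_N.+1 := \matrix_(j, i) a i j.
have /det0P [v v0 vA] : \det A == 0.
  rewrite (expand_det_col A (Ordinal pN)) big1 // => i _.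
  by rewrite /A mxE ap0 mul0r.
exists (fun j => v 0 (inord j)); split.
  have /rV0Pn [j vj] := v0.
  by exists j; split; [exact/ssrnat.ltP | rewrite inord_val; apply/eqP].
move=> i /ssrnat.ltP iN; have := congr1 (fun w : 'rV_N.+1 => w 0 (Ordinal iN)) vA.
rewrite /A !mxE => H; rewrite -[RHS]H bigsumE; apply: eq_bigr => j _.
by rewrite mxE inord_val.
Qed.

Definition nsq (z : R[i]) : R := complex.Re z ^+ 2 + complex.Im z ^+ 2.

Lemma nsqM z w : nsq (z * w) = nsq z * nsq w.
Proof. case: z w => [x y] [u v]; rewrite /nsq /=.
rewrite !RealsE; ring. Qed.

Lemma nsq1 : nsq 1 = 1.
Proof. by rewrite /nsq /= expr0n expr1n Rplus_0_r. Qed.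

Lemma nsq_prod (s : seq R[i]) (f : R[i] -> R[i]) :
  nsq (\prod_(z <- s) f z) = \prod_(z <- s) nsq (f z).
Proof. by elim: s => [|z s IH]; rewrite ?big_nil ?nsq1 // !big_cons nsqM IH. Qed.

Definition e (t : R) : R[i] := Complex (cos t) (sin t).

Lemma e_exp t k : e t ^+ k = e (Rmult (INR k) t).
Proof.
elim: k => [|k IH].
  by rewrite expr0 /e /= Rmult_0_l cos_0 sin_0.
rewrite exprS IH S_INR Rmult_plus_distr_r Rmult_1_l /e cos_plus sin_plus.
by apply/eqP; rewrite eq_complex /= !RealsE; apply/andP; split; apply/eqP; ring.
Qed.

Section Factor.
Variables a b : nat -> R.
Let c k : R[i] := Complex (Rdiv (a k) 2) (Ropp (Rdiv (b k) 2)).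
Let c' k : R[i] := Complex (Rdiv (a k) 2) (Rdiv (b k) 2).

(** On the unit circle [P n] is [z ^ n] times the trigonometric polynomial of order [n]. Raising the
    order multiplies by [z] and adds the two extreme coefficients, the conjugate numbers [c n] and
    [c' n]. *)
Fixpoint P (n : nat) : {poly R[i]} :=
  match n with
  | 0%nat => (Complex (Rdiv (a 0%nat) 2) 0)%:P
  | m.+1 => (c n)%:P * 'X^(m.*2.+2) + (c' n)%:P + P m * 'X
  end.

Let h (n : nat) (t : R) : R :=
  Rplus (Rdiv (a 0%nat) 2) (bigsum (fun k => Rplus (Rmult (a k.+1) (cos (Rmult (INR k.+1) t)))
    (Rmult (b k.+1) (sin (Rmult (INR k.+1) t)))) n).

Lemma PS m : P m.+1 = (c m.+1)%:P * 'X^(m.*2.+2) + (c' m.+1)%:P + P m * 'X.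
Proof. by []. Qed.

Lemma P_e n t : (P n).[e t] = e t ^+ n * Complex (h n t) 0.
Proof.
elim: n => [|n IH].
  by rewrite /= hornerC expr0 mul1r /h /= Rplus_0_r.
have -> : Complex (h n.+1 t) 0 = Complex (h n t) 0 + c n.+1 * e t ^+ n.+1
    + c' n.+1 * e (Ropp t) ^+ n.+1.
  rewrite !e_exp Ropp_mult_distr_r_reverse /e cos_neg sin_neg /h [bigsum _ n.+1]/=.
  apply/eqP; rewrite eq_complex /= -/(INR n.+1) !RealsE (_ : nat_of_pos 2 = 2%N) //.
  apply/andP; split; apply/eqP.
    by move: (bigsum _ n) => S; field.
  by field.
have e1 : e t * e (Ropp t) = 1.
  rewrite /e cos_neg sin_neg; apply/eqP; rewrite eq_complex /=.
  have := sin2_cos2 t; rewrite /Rsqr !RealsE => H.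
  apply/andP; split; apply/eqP; last by ring.
  by rewrite -[RHS]H; ring.
have en : e t ^+ n.+1 * e (Ropp t) ^+ n.+1 = 1 by rewrite -exprMn e1 expr1n.
rewrite PS !hornerD hornerMX hornerCM hornerXn hornerC IH !mulrDr [e t ^+ n.+1 * (c' _ * _)]mulrCA en mulr1.
rewrite [e t ^+ n.+1 * (c _ * _)]mulrCA -exprD addSn addnS addnn.
rewrite (exprS (e t) n). ring.
Qed.

Lemma size_P n : (size (P n) <= n.*2.+1)%N.
Proof.
elim: n => [|n IH]; first exact: size_polyC_leq1.
rewrite PS (leq_trans (size_polyD _ _)) // geq_max; apply/andP; split.
  rewrite (leq_trans (size_polyD _ _)) // geq_max; apply/andP; split.
    by rewrite mul_polyC (leq_trans (size_scale_leq _ _)) // size_polyXn.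
  by rewrite (leq_trans (size_polyC_leq1 _)).
rewrite (leq_trans (size_polyMleq _ _)) // size_polyX addn2 /=.
by rewrite doubleS !ltnS (leq_trans IH).
Qed.

Lemma lead_P n : (P n.+1)`_(n.*2.+2) = c n.+1.
Proof.
rewrite PS !coefD coefCM coefXn eqxx mulr1 coefC coefMX /=.
by rewrite nth_default ?addr0 // size_P.
Qed.

Lemma const_P n : (P n.+1)`_0 = c' n.+1.
Proof. by rewrite PS !coefD coefCM coefXn mulr0 add0r coefC coefMX addr0. Qed.

Lemma nsq_eq0 z : nsq z = 0 -> z = 0.
Proof.
case: z => x y; rewrite /nsq /= !RealsE => /eqP.
by rewrite paddr_eq0 ?sqr_ge0 // !sqrf_eq0 => /andP[/eqP-> /eqP->].
Qed.

(** Leading and constant coefficient of [P n] are conjugate, hence of equal modulus, so the moduli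
    of the roots have product 1. *)
Lemma trig_factor n : (0 < n)%N -> a n <> 0 \/ b n <> 0 ->
  exists s : seq R[i], [/\ size s = n.*2, \prod_(w <- s) nsq w = 1 &
  forall t, Rmult (h n t) (h n t) = Rmult (nsq (c n)) (\prod_(w <- s) nsq (e t - w))].
Proof.
case: n => // n _ ab0.
have cn0 : nsq (c n.+1) <> 0.
  move/nsq_eq0 => /eqP; rewrite eq_complex /= => /andP[/eqP H1 /eqP H2].
  have H1' : Rdiv (a n.+1) (IZR 2) = IZR 0 := H1.
  have H2' : Ropp (Rdiv (b n.+1) (IZR 2)) = IZR 0 := H2.
  case: ab0 => H; apply: H.
    by change (a n.+1 = IZR 0); lra.
  by change (b n.+1 = IZR 0); lra.
have [s Ps] := closed_field_poly_normal (P n.+1).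
have szP : size (P n.+1) = n.*2.+3.
  apply/eqP; rewrite eqn_leq size_P ltnNge; apply/negP => sz.
  by apply: cn0; rewrite -(lead_P n) nth_default // /nsq /= expr0n Rplus_0_r.
have lP : lead_coef (P n.+1) = c n.+1 by rewrite lead_coefE szP lead_P.
have c0 : c n.+1 != 0.
  by apply/eqP => c0; apply: cn0; rewrite c0 /nsq /= expr0n Rplus_0_r.
have sz : size s = n.*2.+2.
  by move: szP; rewrite Ps lP size_scale // size_prod_XsubC => -[].
exists s; split => //.
  have := congr1 (fun p => nsq p.[0]) Ps.
  rewrite horner_coef0 const_P lP hornerZ nsqM horner_prod nsq_prod.
  have -> : nsq (c' n.+1) = nsq (c n.+1) by rewrite /nsq /= !RealsE sqrrN.
  rewrite -[X in X = _ -> _]mulr1 => /(mulfI _) H.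
  rewrite [RHS]H; last exact/eqP.
  apply: eq_bigr => w _; rewrite hornerXsubC add0r.
  by case: w => x y; rewrite /nsq /= !RealsE !sqrrN.
move=> t.
have nset k : nsq (e t ^+ k) = 1.
  rewrite e_exp; transitivity (Rplus (Rsqr (sin (Rmult (INR k) t))) (Rsqr (cos (Rmult (INR k) t)))); last exact: sin2_cos2.
  by rewrite /nsq /Rsqr /= !RealsE; ring.
transitivity (nsq (P n.+1).[e t]).
  rewrite P_e nsqM nset mul1r /nsq /= !RealsE; ring.
rewrite Ps lP hornerZ nsqM; congr Rmult.
rewrite horner_prod nsq_prod; apply: eq_bigr => w _.
by rewrite hornerXsubC.
Qed.
End Factor.

(** The square root is carried along so that the induction can proceed root by root; it equals 1 for
    the roots of [trig_factor]. *)
Lemma project_roots (s : seq R[i]) : \prod_(w <- s) nsq w <> 0 ->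
  exists ts : seq R, [/\ size ts = size s,
    (forall x, x \in ts -> Rle (IZR 0) x /\ Rle x (2 * PI)) &
    forall t, Rle (Rmult (sqrt (\prod_(w <- s) nsq w)) (\prod_(x <- ts) ((2 * sin ((t - x) / 2)) ^ 2)%coqR))
      (\prod_(w <- s) nsq (e t - w))].
Proof.
elim: s => [|[x y] s IH].
  by exists [::]; split => // t; rewrite !big_nil sqrt_1; right; rewrite Rmult_1_l.
rewrite big_cons => H.
have Hnz : (nsq (Complex x y) != 0) && (\prod_(w <- s) nsq w != 0).
  by rewrite -negb_or -mulf_eq0; apply/eqP.
case/andP: Hnz => /eqP Hw /eqP /[dup] Hs /IH [ts [Hsz Hts Hle]].
have nsqE u v : nsq (Complex u v) = (u * u + v * v)%coqR by rewrite /nsq /= !RealsE; ring.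
move: Hw; rewrite nsqE => /projection_closer [tau [Htau Hcl]].
have prod0 (f : R[i] -> R[i]) : Rle (IZR 0) (\prod_(w <- s) nsq (f w)).
  by apply/RleP; apply: prodr_ge0 => w _; rewrite /nsq addr_ge0 // sqr_ge0.
exists (tau :: ts); split => /=; first by rewrite Hsz.
  by move=> z; rewrite inE => /predU1P [-> //|]; exact: Hts.
move=> t; rewrite !big_cons.
have -> : sqrt (((x * x + y * y)%coqR * \prod_(w <- s) nsq w)%R) =
    Rmult (sqrt (x * x + y * y)%coqR) (sqrt (\prod_(w <- s) nsq w)).
  by apply: sqrt_mult; [nra | exact: (prod0 id)].
have -> : nsq (e t - Complex x y) = ((cos t - x) ^ 2 + (sin t - y) ^ 2)%coqR.
  by rewrite /nsq /= !RealsE; ring.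
have ts0 : Rle (IZR 0) (\prod_(z <- ts) ((2 * sin ((t - z) / 2)) ^ 2)%coqR).
  by apply/RleP; apply: prodr_ge0 => w _; apply/RleP; exact: pow2_ge_0.
have := Rmult_le_compat _ _ _ _ _ _ (Hcl t) (Hle t).
have ACA p q r u : Rmult (Rmult p q) (Rmult r u) = Rmult (Rmult p r) (Rmult q u).
  by rewrite !RealsE; ring.
move=> H2; apply: Rle_trans (H2 _ _).
- by right; exact: ACA.
- by apply: Rmult_le_pos; [exact: sqrt_pos | exact: pow2_ge_0].
- by apply: Rmult_le_pos => //; exact: sqrt_pos.
Qed.

(** The constant is the squared modulus of the leading coefficient. The projected roots are sorted
    because their order on the circle determines the cells. *)
Lemma trigpoly_ge_prod n (a b : nat -> R) : (0 < n)%coq_nat ->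
  a n <> IZR 0 \/ b n <> IZR 0 ->
  exists tau : nat -> R,
    [/\ forall i, (i < 2 * n)%coq_nat -> Rle (IZR 0) (tau i) /\ Rle (tau i) (2 * PI)%coqR,
     forall i, (S i < 2 * n)%coq_nat -> Rle (tau i) (tau (S i)) &
     forall t, Rle ((a n ^ 2 + b n ^ 2) / 4 *
                   bigprod (fun j => (2 * sin ((t - tau j) / 2)) ^ 2) (2 * n)%coq_nat)%coqR
        (trigpoly n a b t ^ 2)%coqR].
Proof.
move=> /ssrnat.ltP n0 ab0; have [s [sz prod1 Hs]] := trig_factor n0 ab0.
have [|ts [Hsz Hts Hle]] := @project_roots s; first by rewrite prod1; exact: R1_neq_R0.
pose us := sort <=%R ts.
have Hus : size us = n.*2 by rewrite size_sort Hsz.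
exists (fun i => nth 0 us i); split.
- move=> i /ssrnat.ltP; rewrite mul2n => Hi; apply: Hts.
  by rewrite -(mem_sort <=%R) mem_nth // Hus.
- move=> i /ssrnat.ltP; rewrite mul2n => Hi; apply/RleP.
  by apply: (sorted_leq_nth le_trans le_refl 0 (sort_le_sorted ts)); rewrite ?inE ?Hus //; exact: ltnW.
move=> t; have Ht := Hs t.
have -> : (trigpoly n a b t ^ 2)%coqR = Rmult (trigpoly n a b t) (trigpoly n a b t) by rewrite /= Rmult_1_r.
have -> : trigpoly n a b t = (a 0%nat / 2 + bigsum (fun k => a k.+1 * cos (INR k.+1 * t) +
    b k.+1 * sin (INR k.+1 * t)) n)%coqR.
  by rewrite /trigpoly; congr Rplus; case: n n0 {ab0 s sz prod1 Hs Hsz Hts Hle us Hus Ht} => // n _; elim: n => [|n IH] /=; rewrite ?Rplus_0_l // IH.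
rewrite Ht; apply: Rmult_le_compat.
- by have := pow2_ge_0 (a n); have := pow2_ge_0 (b n); lra.
- by rewrite bigprodE; apply/RleP; apply: prodr_ge0 => i _; apply/RleP; exact: pow2_ge_0.
- by right; rewrite /nsq /= !RealsE (_ : nat_of_pos 2 = 2%N) // (_ : nat_of_pos 4 = 4%N) //; field.
have := Hle t; rewrite prod1 sqrt_1 Rmult_1_l.
suff -> : \prod_(x <- ts) ((2 * sin ((t - x) / 2)) ^ 2)%coqR =
  bigprod (fun j => (2 * sin ((t - nth 0 us j) / 2)) ^ 2)%coqR (2 * n)%coq_nat by [].
have pe : perm_eq ts us by rewrite perm_sym perm_sort.
rewrite bigprodE (perm_big _ pe) /=.
by rewrite (big_nth 0) Hus big_mkord -mul2n.
Qed.
End Factorization.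

(** * Finite sums and products *)

Lemma bigsum_ext f g n : (forall i, (i < n)%nat -> f i = g i) -> bigsum f n = bigsum g n.
Proof. induction n as [|n IH]; intros H; simpl; [easy |]. rewrite IH, H; auto. Qed.

Lemma bigprod_ext f g n : (forall i, (i < n)%nat -> f i = g i) -> bigprod f n = bigprod g n.
Proof. induction n as [|n IH]; intros H; simpl; [easy |]. rewrite IH, H; auto. Qed.

Lemma bigsum_le f g n : (forall i, (i < n)%nat -> f i <= g i) -> bigsum f n <= bigsum g n.
Proof. induction n as [|n IH]; intros H; simpl; [lra |]. apply Rplus_le_compat; auto. Qed.

Lemma bigsum_lt f g n p : (p < n)%nat -> (forall i, (i < n)%nat -> f i <= g i) ->
  f p < g p -> bigsum f n < bigsum g n.
Proof.
induction n as [|n IH]; intros Hp H Hlt; simpl; [lia |].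
destruct (Nat.eq_dec p n) as [-> | Hne].
- apply Rplus_le_lt_compat; [apply bigsum_le; auto | easy].
- apply Rplus_lt_le_compat; [apply IH; auto; lia | auto].
Qed.

Lemma bigsum_plus f g n : bigsum (fun i => f i + g i) n = bigsum f n + bigsum g n.
Proof. induction n as [|n IH]; simpl; [lra |]. rewrite IH; ring. Qed.

Lemma bigsum_scal k f n : bigsum (fun i => k * f i) n = k * bigsum f n.
Proof. induction n as [|n IH]; simpl; [lra |]. rewrite IH; ring. Qed.

Lemma bigsum_const k n : bigsum (fun _ => k) n = INR n * k.
Proof. induction n as [|n IH]; [simpl; lra |]. rewrite S_INR; simpl bigsum. rewrite IH; ring. Qed.

Lemma bigsum_recl f n : bigsum f (S n) = f 0%nat + bigsum (fun i => f (S i)) n.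
Proof. induction n as [|n IH]; simpl in *; [lra |]. rewrite IH; ring. Qed.

Lemma bigprod_recl f n : bigprod f (S n) = f 0%nat * bigprod (fun i => f (S i)) n.
Proof. induction n as [|n IH]; simpl in *; [lra |]. rewrite IH; ring. Qed.

Lemma bigsum_abs_le f n : Rabs (bigsum f n) <= bigsum (fun i => Rabs (f i)) n.
Proof.
induction n as [|n IH]; simpl; [rewrite Rabs_R0; lra |].
eapply Rle_trans; [apply Rabs_triang | lra].
Qed.

Lemma bigprod_pos f n : (forall i, (i < n)%nat -> 0 < f i) -> 0 < bigprod f n.
Proof. induction n as [|n IH]; intros H; simpl; [lra |]. apply Rmult_lt_0_compat; auto. Qed.

Lemma bigprod_nonneg f n : (forall i, (i < n)%nat -> 0 <= f i) -> 0 <= bigprod f n.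
Proof. induction n as [|n IH]; intros H; simpl; [lra |]. apply Rmult_le_pos; auto. Qed.

Lemma bigprod_le f g n : (forall i, (i < n)%nat -> 0 <= f i <= g i) ->
  bigprod f n <= bigprod g n.
Proof.
induction n as [|n IH]; intros H; simpl; [lra |].
apply Rmult_le_compat.
- apply bigprod_nonneg; intros i Hi; apply H; lia.
- apply H; lia.
- apply IH; auto.
- apply H; lia.
Qed.

Lemma bigprod_lt f g n p : (p < n)%nat -> (forall i, (i < n)%nat -> 0 < f i <= g i) ->
  f p < g p -> bigprod f n < bigprod g n.
Proof.
induction n as [|n IH]; intros Hp H Hlt; simpl; [lia |].
assert (H1 : 0 < bigprod f n) by (apply bigprod_pos; intros; apply H; lia).
assert (H2 : bigprod f n <= bigprod g n).
{ apply bigprod_le; intros i Hi; specialize (H i ltac:(lia)); lra. }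
assert (H3 := H n ltac:(lia)).
destruct (Nat.eq_dec p n) as [-> | Hne].
- apply Rle_lt_trans with (bigprod g n * f n); [nra |].
  apply Rmult_lt_compat_l; lra.
- assert (H4 : bigprod f n < bigprod g n) by (apply IH; auto; lia). nra.
Qed.

Lemma bigprod_mult f g n : bigprod (fun i => f i * g i) n = bigprod f n * bigprod g n.
Proof. induction n as [|n IH]; simpl; [lra |]. rewrite IH; ring. Qed.

Lemma bigprod_abs f n : Rabs (bigprod f n) = bigprod (fun i => Rabs (f i)) n.
Proof. induction n as [|n IH]; simpl; [apply Rabs_R1 |]. rewrite Rabs_mult, IH; ring. Qed.

Lemma bigprod_zero f n p : (p < n)%nat -> f p = 0 -> bigprod f n = 0.
Proof.
induction n as [|n IH]; intros Hp H0; simpl; [lia |].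
destruct (Nat.eq_dec p n) as [-> | Hne]; [rewrite H0; ring | rewrite IH; [ring | lia | easy]].
Qed.

Lemma bigprod_exp f n : bigprod (fun i => exp (f i)) n = exp (bigsum f n).
Proof. induction n as [|n IH]; simpl; [now rewrite exp_0 |]. now rewrite IH, exp_plus. Qed.

(** * The top harmonic *)

(* Frequencies are half-integers of the parity of [N], since the induction on the
   number of factors [2 * sin ((t - tau) / 2)] also meets odd [N]. *)
Inductive lower_harmonics (N : nat) : (R -> R) -> Prop :=
| lh_zero f : (forall t, f t = 0) -> lower_harmonics N f
| lh_add f g h : lower_harmonics N f -> lower_harmonics N g ->
    (forall t, h t = f t + g t) -> lower_harmonics N h
| lh_cos m k c f : (1 <= m < N)%nat ->
    (forall t, f t = k * cos ((INR N - 2 * INR m) / 2 * t + c)) -> lower_harmonics N f.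

Definition top_amplitude (N : nat) (alpha : R) (f : R -> R) : Prop :=
  exists psi g, lower_harmonics N g /\
    forall t, f t = alpha * cos (INR N / 2 * t + psi) + g t.

(** The sample points are half a period of the frequency [N / 2] apart, so the signs follow the top
    harmonic and the sum isolates it. *)
Definition alternating_sum (N : nat) (f : R -> R) (t : R) : R :=
  bigsum (fun k => (-1) ^ k * f (t + 2 * PI * INR k / INR N)) N.

Lemma cos_add_kPI x k : cos (x + INR k * PI) = (-1) ^ k * cos x.
Proof.
induction k as [|k IH]; [simpl; rewrite Rmult_0_l, Rplus_0_r; ring |].
rewrite S_INR. replace (x + (INR k + 1) * PI) with (x + INR k * PI + PI) by ring.
rewrite neg_cos, IH; simpl; ring.
Qed.

Lemma pow_m1_sqr k : (-1) ^ k * (-1) ^ k = 1.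
Proof. rewrite <- Rpow_mult_distr. replace (-1 * -1) with 1 by ring. apply pow1. Qed.

Lemma sum_cos_progression x y n :
  2 * sin (y / 2) * bigsum (fun k => cos (x + INR k * y)) n =
  sin (x + (INR n - 1 / 2) * y) - sin (x - y / 2).
Proof.
induction n as [|n IH].
- simpl. replace (x + (0 - 1 / 2) * y) with (x - y / 2) by field. ring.
- simpl bigsum. rewrite Rmult_plus_distr_l, IH, S_INR.
  replace (x + (INR n + 1 - 1 / 2) * y) with ((x + INR n * y) + y / 2) by field.
  replace (x + (INR n - 1 / 2) * y) with ((x + INR n * y) - y / 2) by field.
  rewrite sin_plus, (sin_minus (x + INR n * y)). ring.
Qed.

Lemma alternating_sum_lower N f t : lower_harmonics N f -> alternating_sum N f t = 0.
Proof.
unfold alternating_sum. intros Hf. revert t.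
induction Hf as [f H | f g h Hf IHf Hg IHg H | m k c f Hm H]; intros t.
- erewrite bigsum_ext with (g := fun _ => 0).
  + rewrite bigsum_const; ring.
  + intros i _; rewrite H; ring.
- erewrite bigsum_ext.
  2:{ intros i _. rewrite H, Rmult_plus_distr_l. reflexivity. }
  rewrite bigsum_plus, IHf, IHg; ring.
- assert (HN : 0 < INR N) by (apply lt_0_INR; lia).
  assert (Hm0 : 0 < INR m) by (apply lt_0_INR; lia).
  assert (HmN : INR m < INR N) by (apply lt_INR; lia).
  (* The part [i * PI] of the angle cancels the sign. What remains is a progression of angles with
     step [y], whose [N] steps make [m] full turns, so the cosines sum to 0. *)
  set (x := (INR N - 2 * INR m) / 2 * t + c). set (y := - (2 * PI * INR m / INR N)).
  rewrite bigsum_ext with (g := fun i => k * cos (x + INR i * y)).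
  2:{ intros i _. rewrite H.
      replace ((INR N - 2 * INR m) / 2 * (t + 2 * PI * INR i / INR N) + c)
        with ((x + INR i * y) + INR i * PI) by (unfold x, y; field; lra).
      rewrite cos_add_kPI. replace ((-1) ^ i * (k * ((-1) ^ i * cos (x + INR i * y))))
        with (((-1) ^ i * (-1) ^ i) * (k * cos (x + INR i * y))) by ring.
      rewrite pow_m1_sqr; ring. }
  rewrite bigsum_scal.
  assert (E := sum_cos_progression x y N).
  replace (x + (INR N - 1 / 2) * y) with ((x - y / 2) - 2 * INR m * PI) in E
    by (unfold y; field; lra).
  assert (P : sin (x - y / 2 - 2 * INR m * PI) = sin (x - y / 2)).
  { rewrite <- (sin_period (x - y / 2 - 2 * INR m * PI) m). f_equal; ring. }
  rewrite P, Rminus_diag in E.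
  assert (S0 : sin (y / 2) <> 0).
  { replace (y / 2) with (- (PI * (INR m / INR N))) by (unfold y; field; lra).
    rewrite sin_neg. apply Ropp_neq_0_compat, Rgt_not_eq.
    assert (HPI := PI_RGT_0).
    assert (0 < INR m / INR N < 1).
    { split; [apply Rdiv_lt_0_compat; lra |]. apply Rmult_lt_reg_r with (INR N); [lra |].
      unfold Rdiv; rewrite Rmult_assoc, Rinv_l; lra. }
    apply sin_gt_0; nra. }
  apply Rmult_integral in E. destruct E as [E | E]; [lra | rewrite E; ring].
Qed.

Lemma alternating_sum_top N alpha f : (0 < N)%nat -> top_amplitude N alpha f ->
  exists psi, forall t, alternating_sum N f t = INR N * (alpha * cos (INR N / 2 * t + psi)).
Proof.
intros HN [psi [g [Hg Hf]]]. exists psi. intros t.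
assert (HN0 : 0 < INR N) by (apply lt_0_INR; lia).
assert (E := alternating_sum_lower N g t Hg).
unfold alternating_sum in *.
erewrite bigsum_ext.
2:{ intros i _. rewrite Hf, Rmult_plus_distr_l. reflexivity. }
rewrite bigsum_plus, E, Rplus_0_r, <- bigsum_const. apply bigsum_ext. intros i _.
replace (INR N / 2 * (t + 2 * PI * INR i / INR N) + psi)
  with (INR N / 2 * t + psi + INR i * PI) by (field; lra).
rewrite cos_add_kPI.
replace ((-1) ^ i * (alpha * ((-1) ^ i * cos (INR N / 2 * t + psi))))
  with (((-1) ^ i * (-1) ^ i) * (alpha * cos (INR N / 2 * t + psi))) by ring.
rewrite pow_m1_sqr; ring.
Qed.

(** At a crest of the top harmonic the alternating sum equals [N * alpha], and it has [N] terms of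
    modulus at most [M]. *)
Lemma top_amplitude_le N alpha f M : (0 < N)%nat -> top_amplitude N alpha f ->
  (forall t, Rabs (f t) <= M) -> alpha <= M.
Proof.
intros HN Hf HM. destruct (alternating_sum_top N alpha f HN Hf) as [psi Hpsi].
assert (HN0 : 0 < INR N) by (apply lt_0_INR; lia).
specialize (Hpsi (- psi / (INR N / 2))).
replace (INR N / 2 * (- psi / (INR N / 2)) + psi) with 0 in Hpsi by (field; lra).
rewrite cos_0 in Hpsi.
apply Rmult_le_reg_l with (INR N); [easy |].
replace (INR N * alpha) with (alternating_sum N f (- psi / (INR N / 2))) by (rewrite Hpsi; ring).
eapply Rle_trans; [apply Rle_abs |]. unfold alternating_sum.
eapply Rle_trans; [apply bigsum_abs_le |].
rewrite <- bigsum_const. apply bigsum_le. intros i _.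
rewrite Rabs_mult, pow_1_abs, Rmult_1_l. apply HM.
Qed.

Lemma top_amplitude_unique N alpha beta f : (0 < N)%nat ->
  top_amplitude N alpha f -> top_amplitude N beta f -> 0 <= beta -> alpha <= beta.
Proof.
intros HN Ha Hb Hb0.
destruct (alternating_sum_top N alpha f HN Ha) as [psi Hpsi].
destruct (alternating_sum_top N beta f HN Hb) as [phi Hphi].
assert (HN0 : 0 < INR N) by (apply lt_0_INR; lia).
specialize (Hpsi (- psi / (INR N / 2))). rewrite Hphi in Hpsi.
replace (INR N / 2 * (- psi / (INR N / 2)) + psi) with 0 in Hpsi by (field; lra).
rewrite cos_0 in Hpsi. apply Rmult_eq_reg_l in Hpsi; [| lra].
assert (Hc := COS_bound (INR N / 2 * (- psi / (INR N / 2)) + phi)). nra.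
Qed.

Lemma lower_harmonics_scal N f k : lower_harmonics N f -> lower_harmonics N (fun t => k * f t).
Proof.
intros Hf. induction Hf as [f H | f g h Hf IHf Hg IHg H | m c d f Hm H].
- apply lh_zero. intros t; rewrite H; ring.
- eapply lh_add; [exact IHf | exact IHg |]. intros t; simpl; rewrite H; ring.
- apply (lh_cos N m (k * c) d); [easy |]. intros t; rewrite H; ring.
Qed.

(** The factor moves a frequency by [1 / 2] both ways: index [m] for [N] becomes the indices [m] and
    [m + 1] for [S N]. The phase [PI / 2] rewrites sines as cosines. *)
Lemma lower_harmonics_mult_sin N f tau : lower_harmonics N f ->
  lower_harmonics (S N) (fun t => 2 * sin ((t - tau) / 2) * f t).
Proof.
intros Hf. induction Hf as [f H | f g h Hf IHf Hg IHg H | m k c f Hm H].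
- apply lh_zero. intros t; rewrite H; ring.
- eapply lh_add; [exact IHf | exact IHg |]. intros t; simpl; rewrite H; ring.
- eapply lh_add.
  + apply (lh_cos (S N) m k (c - tau / 2 - PI / 2) _); [lia | reflexivity].
  + apply (lh_cos (S N) (S m) (- k) (c + tau / 2 - PI / 2) _); [lia | reflexivity].
  + intros t. cbv beta. rewrite H, !S_INR.
    replace ((INR N + 1 - 2 * INR m) / 2 * t + (c - tau / 2 - PI / 2))
      with (((INR N - 2 * INR m) / 2 * t + c + (t - tau) / 2) - PI / 2) by field.
    replace ((INR N + 1 - 2 * (INR m + 1)) / 2 * t + (c + tau / 2 - PI / 2))
      with (((INR N - 2 * INR m) / 2 * t + c - (t - tau) / 2) - PI / 2) by field.
    rewrite !(cos_minus _ (PI / 2)), cos_PI2, sin_PI2, sin_plus, sin_minus. ring.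
Qed.

Lemma lower_harmonics_SS N f : lower_harmonics N f -> lower_harmonics (S (S N)) f.
Proof.
intros Hf. induction Hf as [f H | f g h Hf IHf Hg IHg H | m k c f Hm H].
- now apply lh_zero.
- now apply (lh_add _ f g).
- apply (lh_cos (S (S N)) (S m) k c); [lia |]. intros t. rewrite H, !S_INR.
  do 3 f_equal. field.
Qed.

Lemma top_amplitude_mult_sin N alpha f tau : (0 < N)%nat -> top_amplitude N alpha f ->
  top_amplitude (S N) alpha (fun t => 2 * sin ((t - tau) / 2) * f t).
Proof.
intros HN [psi [g [Hg Hf]]].
exists (psi - tau / 2 - PI / 2),
  (fun t => - alpha * cos ((INR (S N) - 2 * INR 1) / 2 * t + (psi + tau / 2 - PI / 2))
            + 2 * sin ((t - tau) / 2) * g t).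
split.
- eapply lh_add; [| exact (lower_harmonics_mult_sin N g tau Hg) | reflexivity].
  apply (lh_cos (S N) 1 (- alpha) (psi + tau / 2 - PI / 2)); [lia | reflexivity].
- intros t. rewrite Hf, S_INR. simpl (INR 1).
  replace ((INR N + 1) / 2 * t + (psi - tau / 2 - PI / 2))
    with ((INR N / 2 * t + psi + (t - tau) / 2) - PI / 2) by field.
  replace ((INR N + 1 - 2 * 1) / 2 * t + (psi + tau / 2 - PI / 2))
    with ((INR N / 2 * t + psi - (t - tau) / 2) - PI / 2) by field.
  rewrite !(cos_minus _ (PI / 2)), cos_PI2, sin_PI2, sin_plus, sin_minus. ring.
Qed.

Lemma top_amplitude_scal N alpha f k : top_amplitude N alpha f ->
  top_amplitude N (k * alpha) (fun t => k * f t).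
Proof.
intros [psi [g [Hg Hf]]]. exists psi, (fun t => k * g t). split.
- now apply lower_harmonics_scal.
- intros t; rewrite Hf; ring.
Qed.

Lemma top_amplitude_plus_lower N alpha f g : top_amplitude N alpha f -> lower_harmonics N g ->
  top_amplitude N alpha (fun t => f t + g t).
Proof.
intros [psi [h [Hh Hf]]] Hg. exists psi, (fun t => h t + g t). split.
- now apply (lh_add _ h g).
- intros t; rewrite Hf; ring.
Qed.

Lemma top_amplitude_lower N alpha f : (0 < N)%nat -> top_amplitude N alpha f ->
  lower_harmonics (S (S N)) f.
Proof.
intros HN [psi [g [Hg Hf]]].
apply (lh_add _ (fun t => alpha * cos ((INR (S (S N)) - 2 * INR 1) / 2 * t + psi)) g).
- apply (lh_cos _ 1 alpha psi); [lia | reflexivity].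
- now apply lower_harmonics_SS.
- intros t. rewrite Hf, !S_INR. simpl (INR 0). do 3 f_equal. f_equal. field.
Qed.

Definition sin_prod (N : nat) (tau : nat -> R) (t : R) : R :=
  bigprod (fun j => 2 * sin ((t - tau j) / 2)) N.

(** One factor has amplitude 2, and each further factor keeps it, since [2 sin u cos v] is a sum of
    two waves of unit amplitude. *)
Lemma top_amplitude_sin_prod N tau : (0 < N)%nat -> top_amplitude N 2 (sin_prod N tau).
Proof.
induction N as [|[|N] IH]; intros HN; [lia | |].
- exists (- (tau 0%nat) / 2 - PI / 2), (fun _ => 0). split; [now apply lh_zero |].
  intros t. unfold sin_prod; simpl.
  replace (1 / 2 * t + (- tau 0%nat / 2 - PI / 2)) with ((t - tau 0%nat) / 2 - PI / 2) by field.
  rewrite cos_minus, cos_PI2, sin_PI2. ring.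
- assert (H := top_amplitude_mult_sin (S N) 2 _ (tau (S N)) ltac:(lia) (IH ltac:(lia))).
  destruct H as [psi [g [Hg H]]]. exists psi, g. split; [easy |].
  intros t. rewrite <- H. unfold sin_prod. simpl. ring.
Qed.

(** * Homogeneous polynomials in [cos (t / 2)] and [sin (t / 2)] *)

Fixpoint peval (a : nat -> R) (n : nat) (x : R) : R :=
  match n with
  | 0%nat => a 0%nat
  | S m => a 0%nat + x * peval (fun k => a (S k)) m x
  end.

(** This is the sum of the [a k * s ^ k * c ^ (n - k)], the homogeneous form of [peval]. Division by
    [c ^ n] leaves a polynomial in the tangent, whose real roots can be counted. *)
Fixpoint heval (a : nat -> R) (n : nat) (c s : R) : R :=
  match n with
  | 0%nat => a 0%nat
  | S m => a 0%nat * c ^ n + s * heval (fun k => a (S k)) m c s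
  end.

Lemma peval_continuous n a x : continuity_pt (peval a n) x.
Proof.
revert a. induction n as [|n IH]; intros a; simpl.
- apply continuity_pt_const. now intros u v.
- apply continuity_pt_plus; [apply continuity_pt_const; now intros u v |].
  apply continuity_pt_mult; [apply derivable_continuous_pt, derivable_pt_id | apply IH].
Qed.

Lemma peval_factor n a c : exists b, b n = a (S n) /\
  forall x, peval a (S n) x = peval a (S n) c + (x - c) * peval b n x.
Proof.
revert a. induction n as [|n IH]; intros a.
- exists (fun _ => a 1%nat). split; [easy |]. intros x; simpl; ring.
- destruct (IH (fun k => a (S k))) as [b [Hb H]].
  exists (fun k => match k with 0%nat => peval (fun k => a (S k)) (S n) c | S k => b k end).
  split; [easy |]. intros x.
  change (a 0%nat + x * peval (fun k => a (S k)) (S n) x =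
    a 0%nat + c * peval (fun k => a (S k)) (S n) c +
    (x - c) * (peval (fun k => a (S k)) (S n) c + x * peval b n x)).
  rewrite (H x). ring.
Qed.

(** The first sign change gives a root in [[x 0, x 1)]. Dividing by its linear factor, which is
    positive at all later points, preserves the alternation and lowers the degree and the number of
    points by one. *)
Lemma no_alternation n a sigma (x : nat -> R) :
  (forall k, (k <= n)%nat -> x k < x (S k)) ->
  ~ (forall k, (k <= S n)%nat -> 0 < sigma * (-1) ^ k * peval a n (x k)).
Proof.
revert a sigma x. induction n as [|n IH]; intros a sigma x Hx H.
- assert (H0 := H 0%nat ltac:(lia)). assert (H1 := H 1%nat ltac:(lia)). simpl in *. lra.
- assert (H0 := H 0%nat ltac:(lia)). assert (H1 := H 1%nat ltac:(lia)).
  simpl pow in H0, H1.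
  assert (Hc : exists c, x 0%nat <= c < x 1%nat /\ peval a (S n) c = 0).
  { destruct (IVT_cor (fun y => peval a (S n) y) (x 0%nat) (x 1%nat)) as [c [Hc1 Hc2]].
    - intros y; apply peval_continuous.
    - specialize (Hx 0%nat ltac:(lia)); lra.
    - assert (Hs : sigma <> 0) by (intros ->; lra).
      assert (0 < sigma * sigma) by nra.
      assert (sigma * sigma * (peval a (S n) (x 0%nat) * peval a (S n) (x 1%nat)) < 0) by nra.
      nra.
    - exists c. split; [| easy]. split; [easy |].
      destruct (Req_dec c (x 1%nat)) as [-> | Hne]; [rewrite Hc2 in H1; lra | lra]. }
  destruct Hc as [c [Hc1 Hc2]].
  destruct (peval_factor n a c) as [b [_ Hb]].
  apply (IH b (- sigma) (fun k => x (S k))).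
  + intros k Hk. apply Hx. lia.
  + assert (Hxc : forall k, (k <= S n)%nat -> c < x (S k)).
    { induction k as [|k IHk]; intros Hk; [lra |].
      specialize (Hx (S k) ltac:(lia)). specialize (IHk ltac:(lia)). lra. }
    intros k Hk. specialize (H (S k) ltac:(lia)). specialize (Hxc k Hk).
    rewrite Hb, Hc2, Rplus_0_l in H. simpl pow in H.
    apply Rmult_lt_reg_l with (x (S k) - c); [lra |].
    rewrite Rmult_0_r. eapply Rlt_le_trans; [exact H |]. right; ring.
Qed.

Lemma peval_truncate n a x : a (S n) = 0 -> peval a (S n) x = peval a n x.
Proof.
revert a. induction n as [|n IH]; intros a Ha; [simpl; rewrite Ha; ring |].
change (a 0%nat + x * peval (fun k => a (S k)) (S n) x =
  a 0%nat + x * peval (fun k => a (S k)) n x). now rewrite IH.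
Qed.

(** Dividing out a root beyond [M] lowers the degree. A half-line is the form needed because the
    tangent of the half angle maps an arc ending at [PI] to one. *)
Lemma peval_zero_coef n a M : (forall x, M < x -> peval a n x = 0) ->
  forall k, (k <= n)%nat -> a k = 0.
Proof.
revert a M. induction n as [|n IH]; intros a M H k Hk.
- replace k with 0%nat by lia. apply (H (M + 1)). lra.
- assert (Hlead : a (S n) = 0).
  { destruct (peval_factor n a (M + 1)) as [b [Hb Hf]]. rewrite <- Hb.
    apply (IH b (M + 1)); [| lia]. intros x Hx.
    assert (E := Hf x). rewrite !H in E by lra.
    assert (E' : (x - (M + 1)) * peval b n x = 0) by lra.
    apply Rmult_integral in E'. destruct E'; [lra | easy]. }
  destruct (Nat.eq_dec k (S n)) as [-> | Hne]; [easy |].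
  apply (IH a M); [| lia]. intros x Hx. rewrite <- peval_truncate by easy. now apply H.
Qed.

Lemma heval_peval n a c s : c <> 0 -> heval a n c s = c ^ n * peval a n (s / c).
Proof.
intros Hc. revert a. induction n as [|n IH]; intros a; [simpl; ring |].
change (a 0%nat * c ^ S n + s * heval (fun k => a (S k)) n c s =
  c ^ S n * (a 0%nat + s / c * peval (fun k => a (S k)) n (s / c))).
rewrite IH. simpl pow. field. easy.
Qed.

Lemma heval_zero n a c s : (forall k, (k <= n)%nat -> a k = 0) -> heval a n c s = 0.
Proof.
revert a. induction n as [|n IH]; intros a H; [apply H; lia |].
change (a 0%nat * c ^ S n + s * heval (fun k => a (S k)) n c s = 0).
rewrite IH by (intros; apply H; lia). rewrite H by lia. ring.
Qed.

Definition half_angle (n : nat) (f : R -> R) : Prop :=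
  exists a, forall t, f t = heval a n (cos (t / 2)) (sin (t / 2)).

Lemma half_angle_ext n f g : half_angle n f -> (forall t, g t = f t) -> half_angle n g.
Proof. intros [a Ha] H. exists a. intros t; now rewrite H. Qed.

Lemma half_angle_plus n f g : half_angle n f -> half_angle n g ->
  half_angle n (fun t => f t + g t).
Proof.
intros [a Ha] [b Hb]. exists (fun k => a k + b k). intros t. rewrite Ha, Hb.
generalize (cos (t / 2)) (sin (t / 2)). intros c s. clear. revert a b.
induction n as [|n IH]; intros a b; simpl; [easy |]. rewrite <- IH; ring.
Qed.

Lemma half_angle_scal n f k : half_angle n f -> half_angle n (fun t => k * f t).
Proof.
intros [a Ha]. exists (fun j => k * a j). intros t. rewrite Ha.
generalize (cos (t / 2)) (sin (t / 2)). intros c s. clear. revert a.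
induction n as [|n IH]; intros a; simpl; [easy |]. rewrite <- IH; ring.
Qed.

Lemma half_angle_mult_sin n f : half_angle n f ->
  half_angle (S n) (fun t => sin (t / 2) * f t).
Proof.
intros [a Ha]. exists (fun j => match j with 0%nat => 0 | S j => a j end).
intros t. rewrite Ha.
change (sin (t / 2) * heval a n (cos (t / 2)) (sin (t / 2)) =
  0 * cos (t / 2) ^ S n + sin (t / 2) * heval a n (cos (t / 2)) (sin (t / 2))). ring.
Qed.

Lemma half_angle_mult_cos n f : half_angle n f ->
  half_angle (S n) (fun t => cos (t / 2) * f t).
Proof.
intros [a Ha].
assert (H : exists b, forall c s, c * heval a n c s = heval b (S n) c s).
{ clear Ha. revert a. induction n as [|n IH]; intros a.
  - exists (fun j => match j with 0%nat => a 0%nat | S _ => 0 end). intros c s; simpl; ring.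
  - destruct (IH (fun k => a (S k))) as [b Hb].
    exists (fun j => match j with 0%nat => a 0%nat | S j => b j end). intros c s.
    change (c * (a 0%nat * c ^ S n + s * heval (fun k => a (S k)) n c s) =
      a 0%nat * c ^ S (S n) + s * heval b (S n) c s).
    rewrite <- Hb. simpl. ring. }
destruct H as [b Hb]. exists b. intros t. now rewrite Ha, Hb.
Qed.

(** Multiplication by [sin ^ 2 + cos ^ 2 = 1] raises the homogeneous degree, which gives the terms
    of the Chebyshev recurrence a common degree. *)
Lemma half_angle_SS n f : half_angle n f -> half_angle (S (S n)) f.
Proof.
intros Hf. eapply half_angle_ext.
- apply half_angle_plus.
  + apply half_angle_mult_cos, half_angle_mult_cos, Hf.
  + apply half_angle_mult_sin, half_angle_mult_sin, Hf.
- intros t. assert (H := sin2_cos2 (t / 2)). unfold Rsqr in H.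
  transitivity ((sin (t / 2) * sin (t / 2) + cos (t / 2) * cos (t / 2)) * f t);
    [rewrite H |]; ring.
Qed.

Lemma half_angle_sin_prod n tau : half_angle n (sin_prod n tau).
Proof.
induction n as [|n IH].
- exists (fun _ => 1). intros t; easy.
- eapply half_angle_ext.
  + apply half_angle_plus.
    * exact (half_angle_scal _ _ (2 * cos (tau n / 2)) (half_angle_mult_sin _ _ IH)).
    * exact (half_angle_scal _ _ (- 2 * sin (tau n / 2)) (half_angle_mult_cos _ _ IH)).
  + intros t. unfold sin_prod. simpl.
    replace ((t - tau n) / 2) with (t / 2 - tau n / 2) by field. rewrite sin_minus. ring.
Qed.

(* A strict violation at [t0] would make [f - (1 - eps) g] change sign [n + 1] times. *)
Lemma half_angle_comparison n f g (s : nat -> R) t0 :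
  half_angle n f -> half_angle n g ->
  (forall k, (k < n)%nat -> s k < s (S k)) -> - PI < s 0%nat -> s n < t0 < PI ->
  (forall k, (k <= n)%nat -> f (s k) = (-1) ^ (n + k)) ->
  (forall k, (k <= n)%nat -> Rabs (g (s k)) <= 1) ->
  g t0 <= f t0.
Proof.
intros Hf Hg Hs Hs0 Ht0 Hfs Hgs. apply Rnot_lt_le. intros Hlt.
(* Shrinking [g] by [1 - eps] makes it strictly smaller than 1 in modulus at the nodes, while [eps]
   is small enough that [(1 - eps) * g t0] still exceeds [f t0]. *)
set (eps := (g t0 - f t0) / (g t0 - f t0 + Rabs (g t0) + 1)).
assert (Habs := Rabs_pos (g t0)). assert (Habs' := Rle_abs (g t0)).
assert (Hden : 0 < g t0 - f t0 + Rabs (g t0) + 1) by lra.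
assert (He0 : 0 < eps) by (apply Rdiv_lt_0_compat; lra).
assert (Heps : eps * (g t0 - f t0 + Rabs (g t0) + 1) = g t0 - f t0)
  by (unfold eps; field; lra).
assert (He1 : eps < 1) by nra.
assert (Heg : eps * g t0 < g t0 - f t0) by nra.
assert (Hd : half_angle n (fun t => f t + (- (1 - eps)) * g t))
  by (apply half_angle_plus; [| apply half_angle_scal]; easy).
destruct Hd as [a Ha].
(* Appending [t0] to the [n + 1] nodes gives [n + 2] points of alternating sign, one more than a
   nonzero form of degree [n] admits. *)
set (u := fun k => if Nat.leb k n then s k else t0).
assert (Hu : forall k, (k <= n)%nat -> u k = s k).
{ intros k Hk. unfold u. apply Nat.leb_le in Hk. now rewrite Hk. }
assert (Hun : u (S n) = t0).
{ unfold u. replace (Nat.leb (S n) n) with false; [easy |]. symmetry; apply Nat.leb_gt; lia. }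
assert (Hmono : forall k, (k <= n)%nat -> u k < u (S k)).
{ intros k Hk. rewrite Hu by easy. destruct (Nat.eq_dec k n) as [-> | Hne].
  - rewrite Hun; lra.
  - rewrite Hu by lia. apply Hs; lia. }
assert (Hlow : forall k, (k <= S n)%nat -> - PI < u k).
{ induction k as [|k IHk]; intros Hk; [rewrite Hu by lia; lra |].
  specialize (IHk ltac:(lia)). specialize (Hmono k ltac:(lia)). lra. }
assert (Hup : forall k, (k <= S n)%nat -> u k < PI).
{ intros k Hk. assert (Hj : forall j, (j <= S n)%nat -> u (S n - j)%nat < PI).
  { induction j as [|j IHj]; intros Hj.
    - rewrite Nat.sub_0_r, Hun; lra.
    - specialize (IHj ltac:(lia)). specialize (Hmono (S n - S j)%nat ltac:(lia)).
      replace (S (S n - S j))%nat with (S n - j)%nat in Hmono by lia. lra. }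
  replace k with (S n - (S n - k))%nat by lia. apply Hj; lia. }
apply (no_alternation n a ((-1) ^ n) (fun k => tan (u k / 2))).
- intros k Hk. apply tan_increasing.
  + specialize (Hlow k ltac:(lia)); lra.
  + specialize (Hmono k Hk); lra.
  + specialize (Hup (S k) ltac:(lia)); lra.
- intros k Hk.
  assert (Hcos : 0 < cos (u k / 2)).
  { specialize (Hlow k Hk). specialize (Hup k Hk). apply cos_gt_0; lra. }
  apply Rmult_lt_reg_l with (cos (u k / 2) ^ n); [now apply pow_lt |].
  rewrite Rmult_0_r.
  assert (E := Ha (u k)). simpl in E. rewrite heval_peval in E by lra. fold (tan (u k / 2)) in E.
  replace (cos (u k / 2) ^ n * ((-1) ^ n * (-1) ^ k * peval a n (tan (u k / 2))))
    with ((-1) ^ (n + k) * (f (u k) + - (1 - eps) * g (u k))) by (rewrite E, pow_add; ring).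
  destruct (Nat.eq_dec k (S n)) as [-> | Hne].
  + rewrite Hun. replace (n + S n)%nat with (S (2 * n)) by lia. rewrite pow_1_odd. lra.
  + rewrite Hu by lia. rewrite Hfs by lia.
    assert (Hb := Hgs k ltac:(lia)). assert (Hsq := pow_m1_sqr (n + k)).
    assert (Hp : Rabs ((-1) ^ (n + k) * g (s k)) <= 1) by (rewrite Rabs_mult, pow_1_abs; lra).
    assert (Hp' := Rle_abs ((-1) ^ (n + k) * g (s k))).
    nra.
Qed.

(** * Chebyshev polynomials *)

Fixpoint cheb (n : nat) (y : R) : R :=
  match n with
  | 0%nat => 1
  | S m => match m with 0%nat => y | S q => 2 * y * cheb m y - cheb q y end
  end.

Lemma cheb_SS n y : cheb (S (S n)) y = 2 * y * cheb (S n) y - cheb n y.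
Proof. easy. Qed.

Lemma nat_ind2 (P : nat -> Prop) : P 0%nat -> P 1%nat ->
  (forall n, P n -> P (S n) -> P (S (S n))) -> forall n, P n.
Proof.
intros H0 H1 HS. assert (H : forall n, P n /\ P (S n)); [| intros n; apply H].
induction n as [|n [IH1 IH2]]; auto.
Qed.

Lemma cheb_cos n phi : cheb n (cos phi) = cos (INR n * phi).
Proof.
induction n as [| | n IH1 IH2] using nat_ind2.
- simpl. now rewrite Rmult_0_l, cos_0.
- simpl. now rewrite Rmult_1_l.
- rewrite cheb_SS, IH1, IH2, !S_INR.
  replace (INR n * phi) with ((INR n + 1) * phi - phi) by ring.
  replace ((INR n + 1 + 1) * phi) with ((INR n + 1) * phi + phi) by ring.
  rewrite cos_minus, cos_plus. ring.
Qed.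

Lemma cheb_abs_le n y : -1 <= y <= 1 -> Rabs (cheb n y) <= 1.
Proof.
intros Hy. rewrite <- (cos_acos y) by easy. rewrite cheb_cos.
apply Rabs_le, COS_bound.
Qed.

Lemma half_angle_cheb n k : half_angle n (fun t => cheb n (k * sin (t / 2))).
Proof.
induction n as [| | n IH1 IH2] using nat_ind2.
- exists (fun _ => 1). easy.
- exists (fun j => match j with 0%nat => 0 | S _ => k end). intros t; simpl; ring.
- eapply half_angle_ext.
  + apply half_angle_plus.
    * exact (half_angle_scal _ _ (2 * k) (half_angle_mult_sin _ _ IH2)).
    * exact (half_angle_scal _ _ (-1) (half_angle_SS _ _ IH1)).
  + intros t. rewrite cheb_SS. ring.
Qed.

(** In the recurrence the factor [2 * k * sin (t / 2)] multiplies the amplitude by [k], and the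
    polynomial two degrees below contributes lower harmonics only. *)
Lemma top_amplitude_cheb n k : (0 < n)%nat ->
  top_amplitude n (k ^ n) (fun t => cheb n (k * sin (t / 2))).
Proof.
intros Hn. destruct n as [|n]; [lia |]. clear Hn.
assert (Hstep : forall n, lower_harmonics (S (S n)) (fun t => cheb n (k * sin (t / 2))) ->
  top_amplitude (S n) (k ^ S n) (fun t => cheb (S n) (k * sin (t / 2))) ->
  top_amplitude (S (S n)) (k ^ S (S n)) (fun t => cheb (S (S n)) (k * sin (t / 2)))).
{ clear n. intros n Hl Ht.
  assert (H := top_amplitude_plus_lower _ _ _ _
    (top_amplitude_scal _ _ _ k (top_amplitude_mult_sin _ _ _ 0 (Nat.lt_0_succ n) Ht))
    (lower_harmonics_scal _ _ (-1) Hl)).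
  destruct H as [psi [g [Hg H]]]. exists psi, g. split; [easy |].
  intros t. rewrite cheb_SS. simpl pow in *. rewrite <- H, Rminus_0_r. ring. }
assert (H1 : top_amplitude 1 (k ^ 1) (fun t => cheb 1 (k * sin (t / 2)))).
{ exists (- PI / 2), (fun _ => 0). split; [now apply lh_zero |]. intros t. simpl.
  replace (1 / 2 * t + - PI / 2) with (t / 2 - PI / 2) by field.
  rewrite cos_minus, cos_PI2, sin_PI2. ring. }
induction n as [| | n IH1 IH2] using nat_ind2; [easy | |].
- apply Hstep; [| easy]. apply (lh_cos 2 1 1 0); [lia |]. intros t. simpl.
  replace ((1 + 1 - 2 * 1) / 2 * t + 0) with 0 by field. rewrite cos_0. ring.
- apply Hstep; [| easy]. apply top_amplitude_lower with (alpha := k ^ S n); [lia | easy].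
Qed.

(** * Extremal gap configurations *)

Definition modulus (N : nat) (B : R) (tau : nat -> R) (t : R) : R :=
  B * Rabs (sin_prod N tau t).

(* The zeros [tau 0 <= ... <= tau N = tau 0 + 2 PI] cut the circle into [N] cells, and the
   modulus exceeds [1] in the [i]-th cell at most on the gap between [l i] and [r i]. *)
Definition gaps (N : nat) (B : R) (tau l r : nat -> R) : Prop :=
  tau N = tau 0%nat + 2 * PI /\
  forall i, (i < N)%nat -> tau i <= l i <= r i /\ r i <= tau (S i) /\
    (forall t, tau i <= t <= l i -> modulus N B tau t <= 1) /\
    (forall t, r i <= t <= tau (S i) -> modulus N B tau t <= 1).

Definition total (N : nat) (l r : nat -> R) : R := bigsum (fun i => r i - l i) N.

Definition optimal (N : nat) (B : R) (tau l r : nat -> R) : Prop :=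
  gaps N B tau l r /\
  forall tau' l' r', gaps N B tau' l' r' -> total N l r <= total N l' r'.

Lemma monotone_le N (tau : nat -> R) : (forall i, (i < N)%nat -> tau i <= tau (S i)) ->
  forall i j, (i <= j <= N)%nat -> tau i <= tau j.
Proof.
intros H i j Hij. induction j as [|j IH]; [replace i with 0%nat by lia; lra |].
destruct (Nat.eq_dec i (S j)) as [-> | Hne]; [lra |].
apply Rle_trans with (tau j); [apply IH; lia | apply H; lia].
Qed.

Lemma gaps_sorted N B tau l r : gaps N B tau l r -> forall i, (i < N)%nat -> tau i <= tau (S i).
Proof. intros [_ H] i Hi. destruct (H i Hi) as [? [? _]]. lra. Qed.

Lemma gaps_range N B tau l r : gaps N B tau l r -> forall i, (i <= N)%nat ->
  tau 0%nat <= tau i <= tau 0%nat + 2 * PI.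
Proof.
intros H i Hi. assert (Hs := gaps_sorted _ _ _ _ _ H). destruct H as [HN _].
rewrite <- HN. split; apply (monotone_le N); auto; lia.
Qed.

Lemma sin_prod_translate N tau c t : sin_prod N (fun i => tau i + c) (t + c) = sin_prod N tau t.
Proof. apply bigprod_ext. intros i _. do 3 f_equal. ring. Qed.

Lemma gaps_translate N B tau l r c : gaps N B tau l r ->
  gaps N B (fun i => tau i + c) (fun i => l i + c) (fun i => r i + c).
Proof.
intros [HN H]. split; [lra |]. intros i Hi. destruct (H i Hi) as [H1 [H2 [H3 H4]]].
assert (E : forall t, modulus N B (fun i => tau i + c) t = modulus N B tau (t - c)).
{ intros t. unfold modulus. replace t with ((t - c) + c) at 1 by ring.
  now rewrite sin_prod_translate. }
repeat split; try lra; intros t Ht; rewrite E; [apply H3 | apply H4]; lra.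
Qed.

Lemma total_translate N l r c : total N (fun i => l i + c) (fun i => r i + c) = total N l r.
Proof. apply bigsum_ext. intros; ring. Qed.

Lemma total_nonneg N B tau l r : gaps N B tau l r -> 0 <= total N l r.
Proof.
intros [_ H]. rewrite <- (Rmult_0_r (INR N)), <- bigsum_const. apply bigsum_le.
intros i Hi. destruct (H i Hi). lra.
Qed.

(** * Existence of a minimizer by compactness *)

Lemma bounded_subsequence (u : nat -> R) M : (forall k, 0 <= u k <= M) ->
  exists phi, (forall k, (phi k < phi (S k))%nat) /\
    exists x, is_lim_seq (fun k => u (phi k)) (Finite x).
Proof.
intros Hu. destruct (Bolzano_Weierstrass u (fun x => 0 <= x <= M)) as [x Hx].
{ apply compact_P3. } { easy. }
assert (Hp : forall n : nat, exists p : nat -> nat, forall k, (n < p k)%nat /\ Rabs (u (p k) - x) < / INR (S k)).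
{ intros n.
  assert (H : forall k, exists p, (n < p)%nat /\ Rabs (u p - x) < / INR (S k)).
  { intros k. assert (Hk : 0 < / INR (S k)) by (apply Rinv_0_lt_compat, lt_0_INR; lia).
    destruct (Hx (disc x (mkposreal _ Hk)) (S n)) as [p [Hp1 Hp2]].
    - exists (mkposreal _ Hk). intros y; easy.
    - exists p. split; [lia | exact Hp2]. }
  exists (fun k => proj1_sig (constructive_indefinite_description _ (H k))).
  intros k. exact (proj2_sig (constructive_indefinite_description _ (H k))). }
set (pick := fun n => proj1_sig (constructive_indefinite_description _ (Hp n))).
assert (Hpick : forall n k, (n < pick n k)%nat /\ Rabs (u (pick n k) - x) < / INR (S k)).
{ intros n. exact (proj2_sig (constructive_indefinite_description _ (Hp n))). }
set (phi := fix phi k := match k with 0%nat => pick 0%nat 0%nat | S j => pick (phi j) (S j) end).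
exists phi. split; [intros k; apply Hpick |].
exists x. apply is_lim_seq_spec. intros eps.
destruct (archimed_cor1 eps (cond_pos eps)) as [K [HK1 HK2]].
exists K. intros k Hk. apply Rlt_trans with (/ INR (S k)).
- destruct k; apply Hpick.
- apply Rle_lt_trans with (/ INR K); [| easy].
  apply Rinv_le_contravar; [apply lt_0_INR; lia | apply le_INR; lia].
Qed.

Lemma bounded_subsequence_vector (u : nat -> nat -> R) d M :
  (forall k i, (i < d)%nat -> 0 <= u k i <= M) ->
  exists phi, (forall k, (phi k < phi (S k))%nat) /\
    exists x : nat -> R, forall i, (i < d)%nat -> is_lim_seq (fun k => u (phi k) i) (Finite (x i)).
Proof.
induction d as [|d IH]; intros Hu.
- exists (fun k => k). split; [intros; lia |]. exists (fun _ => 0). intros; lia.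
- destruct IH as [phi [Hphi [x Hx]]]; [intros; apply Hu; lia |].
  destruct (bounded_subsequence (fun k => u (phi k) d) M) as [psi [Hpsi [y Hy]]];
    [intros; apply Hu; lia |].
  exists (fun k => phi (psi k)). split.
  + intros k. assert (Hmono : forall a b, (a < b)%nat -> (phi a < phi b)%nat).
    { intros a b Hab. induction Hab; [apply Hphi |]. eapply Nat.lt_trans; [exact IHHab | apply Hphi]. }
    apply Hmono, Hpsi.
  + exists (fun i => if Nat.eq_dec i d then y else x i). intros i Hi.
    destruct (Nat.eq_dec i d) as [-> | Hne]; [exact Hy |].
    apply (is_lim_seq_subseq (fun k => u (phi k) i)); [now apply eventually_subseq |].
    apply Hx; lia.
Qed.

Lemma is_lim_seq_sin_prod N (T : nat -> nat -> R) tau x t :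
  (forall j, (j < N)%nat -> is_lim_seq (fun k => T k j) (Finite (tau j))) ->
  is_lim_seq x (Finite t) ->
  is_lim_seq (fun k => sin_prod N (T k) (x k)) (Finite (sin_prod N tau t)).
Proof.
intros HT Hx. induction N as [|N IH]; [apply is_lim_seq_const |].
unfold sin_prod; simpl. apply is_lim_seq_mult'; [apply IH; intros; apply HT; lia |].
apply is_lim_seq_mult'; [apply is_lim_seq_const |].
apply (is_lim_seq_continuous sin (fun k => (x k - T k N) / 2) ((t - tau N) / 2)).
- apply continuity_sin.
- apply is_lim_seq_mult'; [| apply is_lim_seq_const].
  apply is_lim_seq_minus'; [easy |]. apply HT; lia.
Qed.

Lemma is_lim_seq_modulus N B (T : nat -> nat -> R) tau x t :
  (forall j, (j < N)%nat -> is_lim_seq (fun k => T k j) (Finite (tau j))) ->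
  is_lim_seq x (Finite t) ->
  is_lim_seq (fun k => modulus N B (T k) (x k)) (Finite (modulus N B tau t)).
Proof.
intros HT Hx. apply is_lim_seq_mult'; [apply is_lim_seq_const |].
apply (is_lim_seq_abs _ (Finite (sin_prod N tau t))). now apply is_lim_seq_sin_prod.
Qed.

Lemma is_lim_seq_bigsum (u : nat -> nat -> R) x n :
  (forall i, (i < n)%nat -> is_lim_seq (fun k => u k i) (Finite (x i))) ->
  is_lim_seq (fun k => bigsum (u k) n) (Finite (bigsum x n)).
Proof.
intros H. induction n as [|n IH]; simpl; [apply is_lim_seq_const |].
apply is_lim_seq_plus'; [apply IH; intros; apply H; lia | apply H; lia].
Qed.

Lemma is_lim_seq_le_real (u v : nat -> R) x y : (forall k, u k <= v k) ->
  is_lim_seq u (Finite x) -> is_lim_seq v (Finite y) -> x <= y.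
Proof. intros H Hu Hv. exact (is_lim_seq_le u v (Finite x) (Finite y) H Hu Hv). Qed.

(** A point of the limit segment is approximated by the points dividing the approximating segments
    in the same ratio; the modulus is jointly continuous in the point and the zeros. *)
Lemma segment_limit N B (T U V : nat -> nat -> R) tau i u v :
  (forall j, (j < N)%nat -> is_lim_seq (fun k => T k j) (Finite (tau j))) ->
  is_lim_seq (fun k => U k i) (Finite u) -> is_lim_seq (fun k => V k i) (Finite v) ->
  (forall k, U k i <= V k i) ->
  (forall k t, U k i <= t <= V k i -> modulus N B (T k) t <= 1) ->
  forall t, u <= t <= v -> modulus N B tau t <= 1.
Proof.
intros HT HU HV HUV H t Ht.
assert (Hx : exists x, 0 <= x <= 1 /\ t = u + x * (v - u)).
{ destruct (Req_dec u v) as [E | E]; [exists 0; lra |].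
  exists ((t - u) / (v - u)). split; [| field; lra].
  split; [apply Rdiv_le_0_compat; lra |].
  apply Rmult_le_reg_r with (v - u); [lra |]. unfold Rdiv. rewrite Rmult_assoc, Rinv_l; lra. }
destruct Hx as [x [Hx ->]].
eapply (is_lim_seq_le_real (fun k => modulus N B (T k) (U k i + x * (V k i - U k i))) (fun _ => 1)).
- intros k. apply H. specialize (HUV k). nra.
- apply is_lim_seq_modulus; [easy |]. apply is_lim_seq_plus'; [easy |].
  apply is_lim_seq_mult'; [apply is_lim_seq_const | now apply is_lim_seq_minus'].
- apply is_lim_seq_const.
Qed.

(** All conditions in [gaps] are non-strict and the gap ends are part of the data, so limits of a
    minimizing sequence are again admissible and the total length passes to the limit. *)
Lemma optimal_exists N B tau0 l0 r0 : (0 < N)%nat -> gaps N B tau0 l0 r0 ->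
  exists tau l r, optimal N B tau l r.
Proof.
intros HN H0.
set (E := fun x => exists tau l r, gaps N B tau l r /\ x = - total N l r).
destruct (completeness E) as [m [Hub Hlub]].
{ exists 0. intros x [tau [l [r [H ->]]]]. assert (H1 := total_nonneg _ _ _ _ _ H). lra. }
{ exists (- total N l0 r0). now exists tau0, l0, r0. }
assert (Hc : forall k : nat, exists c : (nat -> R) * (nat -> R) * (nat -> R),
  gaps N B (fst (fst c)) (snd (fst c)) (snd c) /\ fst (fst c) 0%nat = 0 /\
  total N (snd (fst c)) (snd c) < - m + / INR (S k)).
{ intros k. assert (Hk : 0 < / INR (S k)) by (apply Rinv_0_lt_compat, lt_0_INR; lia).
  apply NNPP. intros Hno. apply (Rlt_irrefl m). apply Rle_lt_trans with (m - / INR (S k)); [| lra].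
  apply Hlub. intros x [tau [l [r [H ->]]]]. apply Rnot_lt_le. intros Hlt. apply Hno.
  (* Rotating the first zero to 0 confines all data to [[0, 2 PI]]. *)
  exists (fun i => tau i + - tau 0%nat, fun i => l i + - tau 0%nat, fun i => r i + - tau 0%nat).
  cbn [fst snd]. split; [now apply gaps_translate |]. split; [ring |]. rewrite total_translate. lra. }
set (c := fun k => proj1_sig (constructive_indefinite_description _ (Hc k))).
assert (Hcs : forall k, gaps N B (fst (fst (c k))) (snd (fst (c k))) (snd (c k)) /\
  fst (fst (c k)) 0%nat = 0 /\ total N (snd (fst (c k))) (snd (c k)) < - m + / INR (S k)).
{ intros k. exact (proj2_sig (constructive_indefinite_description _ (Hc k))). }
clearbody c.
set (T := fun k => fst (fst (c k))) in *. set (L := fun k => snd (fst (c k))) in *.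
set (U := fun k => snd (c k)) in *.
assert (HT : forall k i, (i < S N)%nat -> 0 <= T k i <= 2 * PI).
{ intros k i Hi. destruct (Hcs k) as [H1 [H2 _]].
  assert (H3 := gaps_range _ _ _ _ _ H1 i ltac:(lia)). unfold T. lra. }
assert (Hcell : forall k i, (i < N)%nat -> T k i <= L k i <= U k i /\ U k i <= T k (S i)).
{ intros k i Hi. destruct (Hcs k) as [[_ H1] _]. destruct (H1 i Hi) as [? [? _]]. easy. }
destruct (bounded_subsequence_vector T (S N) (2 * PI) HT) as [p1 [Hp1 [tau Htau]]].
destruct (bounded_subsequence_vector (fun k => L (p1 k)) N (2 * PI)) as [p2 [Hp2 [l Hl]]].
{ intros k i Hi. destruct (Hcell (p1 k) i Hi). specialize (HT (p1 k)).
  assert (H3 := HT i ltac:(lia)). assert (H4 := HT (S i) ltac:(lia)). lra. }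
destruct (bounded_subsequence_vector (fun k => U (p1 (p2 k))) N (2 * PI)) as [p3 [Hp3 [r Hr]]].
{ intros k i Hi. destruct (Hcell (p1 (p2 k)) i Hi). specialize (HT (p1 (p2 k))).
  assert (H3 := HT i ltac:(lia)). assert (H4 := HT (S i) ltac:(lia)). lra. }
set (q := fun k => p1 (p2 (p3 k))).
assert (Hq : forall k, (k <= q k)%nat).
{ assert (Hge : forall p : nat -> nat, (forall k, (p k < p (S k))%nat) -> forall k, (k <= p k)%nat).
  { intros p Hp k. induction k as [|k IH]; [lia |]. specialize (Hp k). lia. }
  intros k. unfold q. assert (A := Hge _ Hp3 k). assert (A' := Hge _ Hp2 (p3 k)).
  assert (A'' := Hge _ Hp1 (p2 (p3 k))). lia. }
assert (Lt : forall i, (i <= N)%nat -> is_lim_seq (fun k => T (q k) i) (Finite (tau i))).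
{ intros i Hi. apply (is_lim_seq_subseq (fun k => T (p1 (p2 k)) i)); [now apply eventually_subseq |].
  apply (is_lim_seq_subseq (fun k => T (p1 k) i)); [now apply eventually_subseq |]. apply Htau; lia. }
assert (Ll : forall i, (i < N)%nat -> is_lim_seq (fun k => L (q k) i) (Finite (l i))).
{ intros i Hi. apply (is_lim_seq_subseq (fun k => L (p1 (p2 k)) i)); [now apply eventually_subseq |].
  now apply Hl. }
assert (Lr : forall i, (i < N)%nat -> is_lim_seq (fun k => U (q k) i) (Finite (r i)))
  by (intros i Hi; now apply Hr).
assert (LtN : forall j, (j < N)%nat -> is_lim_seq (fun k => T (q k) j) (Finite (tau j)))
  by (intros; apply Lt; lia).
exists tau, l, r. split.
- split.
    assert (A := is_lim_seq_unique _ _ (Lt N ltac:(lia))).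
    assert (A' : is_lim_seq (fun k => T (q k) N) (Finite (tau 0%nat + 2 * PI))).
    { apply is_lim_seq_ext with (fun k => T (q k) 0%nat + 2 * PI).
      - intros k. destruct (Hcs (q k)) as [[H1 _] _]. symmetry. exact H1.
      - apply is_lim_seq_plus'; [apply Lt; lia | apply is_lim_seq_const]. }
    apply is_lim_seq_unique in A'. rewrite A in A'. now injection A'.
  + intros i Hi. assert (Hc' := fun k => Hcell (q k) i Hi). repeat split.
    * eapply is_lim_seq_le_real; [| apply Lt; lia | apply Ll; easy]. intros k; apply Hc'.
    * eapply is_lim_seq_le_real; [| apply Ll; easy | apply Lr; easy]. intros k; apply Hc'.
    * eapply is_lim_seq_le_real; [| apply Lr; easy | apply Lt; lia]. intros k; apply Hc'.
    * apply (segment_limit N B (fun k => T (q k)) (fun k => T (q k)) (fun k => L (q k)) tau i).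
      -- exact LtN.
      -- apply Lt; lia.
      -- now apply Ll.
      -- intros k; apply Hc'.
      -- intros k t Ht. destruct (Hcs (q k)) as [[_ H1] _]. destruct (H1 i Hi) as [_ [_ [H3 _]]]. exact (H3 t Ht).
    * apply (segment_limit N B (fun k => T (q k)) (fun k => U (q k)) (fun k i => T (q k) (S i)) tau i).
      -- exact LtN.
      -- now apply Lr.
      -- apply Lt; lia.
      -- intros k; apply Hc'.
      -- intros k t Ht. destruct (Hcs (q k)) as [[_ H1] _]. destruct (H1 i Hi) as [_ [_ [_ H4]]]. exact (H4 t Ht).
- intros tau' l' r' H'. apply Rle_trans with (- m).
  + eapply (is_lim_seq_le_real (fun k => total N (L (q k)) (U (q k))) (fun k => - m + / INR (S k))).
    * intros k. destruct (Hcs (q k)) as [_ [_ H1]]. apply Rlt_le.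
      eapply Rlt_le_trans; [exact H1 |]. apply Rplus_le_compat_l, Rinv_le_contravar.
      -- apply lt_0_INR; lia.
      -- apply le_INR. specialize (Hq k). lia.
    * apply is_lim_seq_bigsum with (u := fun k i => U (q k) i - L (q k) i) (x := fun i => r i - l i).
      intros i Hi. apply is_lim_seq_minus'; auto.
    * replace (Finite (- m)) with (Finite (- m + 0)) by (f_equal; ring).
      apply is_lim_seq_plus'; [apply is_lim_seq_const |].
      apply (is_lim_seq_incr_1 (fun n => / INR n)). replace (Finite 0) with (Rbar_inv p_infty) by easy.
      apply is_lim_seq_inv; [apply is_lim_seq_INR | easy].
  + assert (A : - total N l' r' <= m) by (apply Hub; now exists tau', l', r'). lra.
Qed.

(** * Logarithmic concavity of the modulus on a cell *)

Definition sorted_zeros (N : nat) (tau : nat -> R) : Prop :=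
  tau N = tau 0%nat + 2 * PI /\ forall i, (i < N)%nat -> tau i <= tau (S i).

(* In the [i]-th cell all these angles lie in [[0, PI]], where [ln sin] is concave. *)
Definition cell_angle (tau : nat -> R) (i j : nat) (t : R) : R :=
  (t - tau j) / 2 + (if Nat.leb j i then 0 else PI).

Lemma cell_angle_range N tau i j t : sorted_zeros N tau -> (i < N)%nat -> (j < N)%nat ->
  tau i <= t <= tau (S i) -> 0 <= cell_angle tau i j t <= PI.
Proof.
intros [HN Hs] Hi Hj Ht. unfold cell_angle.
assert (Hm := monotone_le N tau Hs).
assert (H0i := Hm 0%nat i ltac:(lia)). assert (HiN := Hm (S i) N ltac:(lia)).
assert (H0j := Hm 0%nat j ltac:(lia)). assert (HjN := Hm j N ltac:(lia)).
destruct (Nat.leb j i) eqn:E.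
- apply Nat.leb_le in E. assert (H := Hm j i ltac:(lia)). lra.
- apply Nat.leb_gt in E. assert (H := Hm (S i) j ltac:(lia)). lra.
Qed.

Lemma cell_angle_interior N tau i j t : sorted_zeros N tau -> (i < N)%nat -> (j < N)%nat ->
  tau i < t < tau (S i) -> 0 < cell_angle tau i j t < PI.
Proof.
intros [HN Hs] Hi Hj Ht. unfold cell_angle.
assert (Hm := monotone_le N tau Hs).
assert (H0i := Hm 0%nat i ltac:(lia)). assert (HiN := Hm (S i) N ltac:(lia)).
assert (H0j := Hm 0%nat j ltac:(lia)). assert (HjN := Hm j N ltac:(lia)).
destruct (Nat.leb j i) eqn:E.
- apply Nat.leb_le in E. assert (H := Hm j i ltac:(lia)). lra.
- apply Nat.leb_gt in E. assert (H := Hm (S i) j ltac:(lia)). lra.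
Qed.

Lemma sin_cell_angle tau i j t :
  sin (cell_angle tau i j t) = (if Nat.leb j i then 1 else -1) * sin ((t - tau j) / 2).
Proof.
unfold cell_angle. destruct (Nat.leb j i); [rewrite Rplus_0_r; ring |]. rewrite neg_sin. ring.
Qed.

Lemma cos_cell_angle tau i j t :
  cos (cell_angle tau i j t) = (if Nat.leb j i then 1 else -1) * cos ((t - tau j) / 2).
Proof.
unfold cell_angle. destruct (Nat.leb j i); [rewrite Rplus_0_r; ring |]. rewrite neg_cos. ring.
Qed.

Lemma modulus_cell N B tau i t : sorted_zeros N tau -> (i < N)%nat -> tau i <= t <= tau (S i) ->
  modulus N B tau t = B * bigprod (fun j => 2 * sin (cell_angle tau i j t)) N.
Proof.
intros Hs Hi Ht. unfold modulus, sin_prod. rewrite bigprod_abs. f_equal.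
apply bigprod_ext. intros j Hj.
assert (H := cell_angle_range N tau i j t Hs Hi Hj Ht).
assert (H' : 0 <= sin (cell_angle tau i j t)) by (apply sin_ge_0; lra).
rewrite <- (Rabs_pos_eq (2 * sin (cell_angle tau i j t))) by lra.
rewrite sin_cell_angle. destruct (Nat.leb j i).
- f_equal; ring.
- rewrite <- Rabs_Ropp. f_equal. ring.
Qed.

Lemma modulus_pos N B tau i t : 0 < B -> sorted_zeros N tau -> (i < N)%nat ->
  tau i < t < tau (S i) -> 0 < modulus N B tau t.
Proof.
intros HB Hs Hi Ht. rewrite (modulus_cell N B tau i) by (auto; lra).
apply Rmult_lt_0_compat; [easy |]. apply bigprod_pos. intros j Hj.
assert (H := cell_angle_interior N tau i j t Hs Hi Hj Ht).
assert (0 < sin (cell_angle tau i j t)) by (apply sin_gt_0; lra). lra.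
Qed.

Lemma modulus_zero N B tau j : (j < N)%nat -> modulus N B tau (tau j) = 0.
Proof.
intros Hj. unfold modulus, sin_prod. rewrite (bigprod_zero _ N j); auto.
- rewrite Rabs_R0; ring.
- replace ((tau j - tau j) / 2) with 0 by field. rewrite sin_0; ring.
Qed.

Lemma modulus_period N B tau t : modulus N B tau (t + 2 * PI) = modulus N B tau t.
Proof.
unfold modulus, sin_prod. rewrite !bigprod_abs. f_equal. apply bigprod_ext. intros j _.
replace ((t + 2 * PI - tau j) / 2) with ((t - tau j) / 2 + PI) by field.
rewrite neg_sin. rewrite <- Rabs_Ropp. f_equal. ring.
Qed.

Lemma modulus_cell_end N B tau i : sorted_zeros N tau -> (i < N)%nat ->
  modulus N B tau (tau (S i)) = 0.
Proof.
intros [HN Hs] Hi. destruct (Nat.eq_dec (S i) N) as [E | E].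
- rewrite E, HN, modulus_period. apply modulus_zero; lia.
- apply modulus_zero; lia.
Qed.

(** The tangent-line inequality of the concave function [ln sin], exponentiated so that it includes
    the ends where [sin u = 0]. The quotient [g] of the two sides has a derivative with the sign of
    [sin (v - x)], so it is largest at [v]. *)
Lemma sin_le_tangent u v : 0 < v < PI -> 0 <= u <= PI ->
  sin u <= sin v * exp (cos v / sin v * (u - v)).
Proof.
intros Hv Hu. assert (Hsv : 0 < sin v) by (apply sin_gt_0; lra).
set (k := cos v / sin v).
set (g := fun x => sin x * exp (- (k * (x - v)))).
assert (Hg : forall x, is_derive g x (exp (- (k * (x - v))) * (sin (v - x) / sin v))).
{ intros x. unfold g. auto_derive; [easy |].
  change (x + - v) with (x - v). rewrite sin_minus.
  generalize (exp (- (k * (x - v)))). intros w. unfold k. field. lra. }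
assert (Hle : g u <= g v).
{ destruct (Rtotal_order u v) as [Huv | [-> | Huv]]; [| lra |].
  - destruct (MVT_gen g u v (fun x => exp (- (k * (x - v))) * (sin (v - x) / sin v)))
      as [x [Hx1 Hx2]].
    + intros x _; apply Hg.
    + intros x _. apply derivable_continuous_pt. exists (exp (- (k * (x - v))) * (sin (v - x) / sin v)).
      apply is_derive_Reals, Hg.
    + rewrite Rmin_left, Rmax_right in Hx1 by lra.
      assert (0 <= sin (v - x)) by (apply sin_ge_0; lra).
      assert (0 <= exp (- (k * (x - v))) * (sin (v - x) / sin v)).
      { apply Rmult_le_pos; [apply Rlt_le, exp_pos |]. now apply Rdiv_le_0_compat. }
      nra.
  - destruct (MVT_gen g v u (fun x => exp (- (k * (x - v))) * (sin (v - x) / sin v)))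
      as [x [Hx1 Hx2]].
    + intros x _; apply Hg.
    + intros x _. apply derivable_continuous_pt. exists (exp (- (k * (x - v))) * (sin (v - x) / sin v)).
      apply is_derive_Reals, Hg.
    + rewrite Rmin_left, Rmax_right in Hx1 by lra.
      assert (0 <= sin (x - v)) by (apply sin_ge_0; lra).
      assert (0 <= exp (- (k * (x - v))) * (sin (x - v) / sin v)).
      { apply Rmult_le_pos; [apply Rlt_le, exp_pos |]. now apply Rdiv_le_0_compat. }
      replace (v - x) with (- (x - v)) in Hx2 by ring. rewrite sin_neg in Hx2.
      replace (exp (- (k * (x - v))) * (- sin (x - v) / sin v))
        with (- (exp (- (k * (x - v))) * (sin (x - v) / sin v))) in Hx2 by (field; lra).
      nra. }
unfold g in Hle. replace (- (k * (v - v))) with 0 in Hle by ring. rewrite exp_0, Rmult_1_r in Hle.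
apply Rmult_le_reg_r with (exp (- (k * (u - v)))); [apply exp_pos |].
rewrite Rmult_assoc, <- exp_plus. replace (k * (u - v) + - (k * (u - v))) with 0 by ring.
rewrite exp_0; lra.
Qed.

(** The logarithm of the modulus at [c] has the partial derivative [- cot_half tau c j / 2] in the
    zero [tau j], and half the sum over [j] as its derivative in [c]. *)
Definition cot_half (tau : nat -> R) (c : R) (j : nat) : R :=
  cos ((c - tau j) / 2) / sin ((c - tau j) / 2).

(** Multiplying [sin_le_tangent] over the factors yields the tangent-plane inequality for the
    logarithm of the modulus, concave jointly in the point and the zeros of a fixed cell. *)
Lemma tangent_bound N B tau tau' i c t : 0 <= B -> sorted_zeros N tau -> sorted_zeros N tau' ->
  (i < N)%nat -> tau i < c < tau (S i) -> tau' i <= t <= tau' (S i) ->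
  modulus N B tau' t <= modulus N B tau c *
    exp (((t - c) * bigsum (cot_half tau c) N
          - bigsum (fun j => (tau' j - tau j) * cot_half tau c j) N) / 2).
Proof.
intros HB Hs Hs' Hi Hc Ht.
rewrite (modulus_cell N B tau i), (modulus_cell N B tau' i) by (auto; lra).
rewrite Rmult_assoc. apply Rmult_le_compat_l; [easy |].
replace (((t - c) * bigsum (cot_half tau c) N
          - bigsum (fun j => (tau' j - tau j) * cot_half tau c j) N) / 2)
  with (bigsum (fun j => cot_half tau c j * (cell_angle tau' i j t - cell_angle tau i j c)) N).
- rewrite <- bigprod_exp, <- bigprod_mult. apply bigprod_le. intros j Hj.
  assert (H := cell_angle_range N tau' i j t Hs' Hi Hj Ht).
  assert (H' := cell_angle_interior N tau i j c Hs Hi Hj Hc).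
  assert (H0 : 0 <= sin (cell_angle tau' i j t)) by (apply sin_ge_0; lra).
  assert (H1 := sin_le_tangent (cell_angle tau' i j t) (cell_angle tau i j c) H' H).
  replace (cot_half tau c j) with (cos (cell_angle tau i j c) / sin (cell_angle tau i j c)); [lra |].
  assert (H2 : 0 < sin (cell_angle tau i j c)) by (apply sin_gt_0; lra).
  rewrite sin_cell_angle in *. rewrite cos_cell_angle. unfold cot_half.
  destruct (Nat.leb j i); field; lra.
- replace (((t - c) * bigsum (cot_half tau c) N
          - bigsum (fun j => (tau' j - tau j) * cot_half tau c j) N) / 2)
    with ((t - c) / 2 * bigsum (cot_half tau c) N
          + - (1 / 2) * bigsum (fun j => (tau' j - tau j) * cot_half tau c j) N) by field.
  rewrite <- !bigsum_scal, <- bigsum_plus. apply bigsum_ext. intros j _.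
  unfold cell_angle. destruct (Nat.leb j i); field.
Qed.

Lemma modulus_continuous N B tau t : continuity_pt (modulus N B tau) t.
Proof.
apply continuity_pt_mult; [apply continuity_pt_const; now intros x y |].
apply (continuity_pt_comp (sin_prod N tau) Rabs); [| apply Rcontinuity_abs].
induction N as [|N IH]; [apply continuity_pt_const; now intros x y |].
unfold sin_prod. simpl. apply continuity_pt_mult; [exact IH |].
apply derivable_continuous_pt. exists (cos ((t - tau N) / 2)).
apply is_derive_Reals. auto_derive; [easy |]. change (t + - tau N) with (t - tau N).
unfold Rdiv. field.
Qed.

Lemma continuity_pt_lt f t x : continuity_pt f t -> f t < x ->
  exists d, 0 < d /\ forall y, Rabs (y - t) < d -> f y < x.
Proof.
intros Hf Hlt. destruct (Hf (x - f t) ltac:(lra)) as [d [Hd H]].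
exists d. split; [easy |]. intros y Hy.
destruct (Req_dec t y) as [<- | Hne]; [easy |].
assert (A := H y (conj (conj I Hne) Hy)). simpl in A. unfold R_dist in A.
apply Rabs_def2 in A. lra.
Qed.

Lemma continuity_pt_gt f t x : continuity_pt f t -> x < f t ->
  exists d, 0 < d /\ forall y, Rabs (y - t) < d -> x < f y.
Proof.
intros Hf Hlt. destruct (continuity_pt_lt (fun y => - f y) t (- x)) as [d [Hd H]].
- now apply continuity_pt_opp.
- lra.
- exists d. split; [easy |]. intros y Hy. specialize (H y Hy). lra.
Qed.

Lemma is_derive_bigprod (f : nat -> R -> R) (k : nat -> R) x n :
  (forall j, (j < n)%nat -> is_derive (f j) x (f j x * k j)) ->
  is_derive (fun t => bigprod (fun j => f j t) n) x (bigprod (fun j => f j x) n * bigsum k n).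
Proof.
intros H. induction n as [|n IH]; simpl.
- rewrite Rmult_0_r. apply @is_derive_const.
- replace (bigprod (fun j => f j x) n * f n x * (bigsum k n + k n))
    with ((bigprod (fun j => f j x) n * bigsum k n) * f n x + bigprod (fun j => f j x) n * (f n x * k n))
    by ring.
  apply (is_derive_mult (fun t => bigprod (fun j => f j t) n) (f n)).
  + apply IH; intros; apply H; lia.
  + apply H; lia.
  + intros u v; apply Rmult_comm.
Qed.

(** The critical equation removes the point [t] from the exponent in [tangent_bound], which then
    bounds the modulus on a whole moved cell. *)
Lemma cell_maximum N B tau i : 0 < B -> sorted_zeros N tau -> (i < N)%nat -> tau i < tau (S i) ->
  exists c, tau i < c < tau (S i) /\
    (forall t, tau i <= t <= tau (S i) -> modulus N B tau t <= modulus N B tau c) /\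
    bigsum (cot_half tau c) N = 0.
Proof.
intros HB Hs Hi Hlt.
destruct (continuity_ab_maj (modulus N B tau) (tau i) (tau (S i))) as [c [Hmax Hc]];
  [lra | intros; apply modulus_continuous |].
assert (Hpos : 0 < modulus N B tau c).
{ apply Rlt_le_trans with (modulus N B tau ((tau i + tau (S i)) / 2)).
  - apply (modulus_pos N B tau i); auto; lra.
  - apply Hmax; lra. }
assert (Hc' : tau i < c < tau (S i)).
{ split.
  - destruct (Req_dec (tau i) c) as [E | E]; [| lra].
    rewrite <- E, modulus_zero in Hpos by easy. lra.
  - destruct (Req_dec c (tau (S i))) as [E | E]; [| lra].
    rewrite E, (modulus_cell_end N B tau i) in Hpos by easy. lra. }
exists c. split; [easy |]. split; [easy |].
set (g := fun t => bigprod (fun j => 2 * sin (cell_angle tau i j t)) N).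
assert (Hsin : forall j, (j < N)%nat -> 0 < sin (cell_angle tau i j c)).
{ intros j Hj. assert (H := cell_angle_interior N tau i j c Hs Hi Hj Hc'). apply sin_gt_0; lra. }
assert (Hgc : 0 < g c).
{ apply bigprod_pos. intros j Hj. specialize (Hsin j Hj). lra. }
assert (Hd : is_derive g c (g c * bigsum (fun j => / 2 * cot_half tau c j) N)).
{ apply (is_derive_bigprod (fun j t => 2 * sin (cell_angle tau i j t))). intros j Hj.
  specialize (Hsin j Hj).
  replace (2 * sin (cell_angle tau i j c) * (/ 2 * cot_half tau c j))
    with (cos (cell_angle tau i j c)).
  - unfold cell_angle. auto_derive; [easy |]. change (c + - tau j) with (c - tau j).
    unfold Rdiv. field.
  - rewrite cos_cell_angle, sin_cell_angle in *. unfold cot_half.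
    destruct (Nat.leb j i); field; lra. }
rewrite bigsum_scal in Hd.
apply is_derive_Reals in Hd.
assert (E := deriv_maximum g (tau i) (tau (S i)) c (exist _ _ Hd) (proj1 Hc') (proj2 Hc')).
unfold derive_pt in E. simpl in E.
assert (E' : g c * (/ 2 * bigsum (cot_half tau c) N) = 0).
{ apply E. intros x Hx1 Hx2. apply Rmult_le_reg_l with B; [easy |].
  unfold g. rewrite <- !(modulus_cell N B tau i) by (auto; lra). apply Hmax; lra. }
apply Rmult_integral in E'. destruct E' as [E' | E']; lra.
Qed.

(** Midpoint log-concavity of the sine as an identity; the explicit deficit settles the strict
    case. *)
Lemma sin_mult_sub a b :
  sin ((a + b) / 2) * sin ((a + b) / 2) - sin a * sin b = sin ((a - b) / 2) * sin ((a - b) / 2).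
Proof.
assert (E : forall m d, sin m * sin m - sin (m + d) * sin (m - d) = sin d * sin d).
{ intros m d. rewrite sin_plus, sin_minus.
  assert (H1 := sin2_cos2 m). assert (H2 := sin2_cos2 d). unfold Rsqr in *.
  replace (sin m * sin m - (sin m * cos d + cos m * sin d) * (sin m * cos d - cos m * sin d))
    with (sin m * sin m * (1 - cos d * cos d) + cos m * cos m * (sin d * sin d)) by ring.
  replace (1 - cos d * cos d) with (sin d * sin d) by lra.
  replace (cos m * cos m) with (1 - sin m * sin m) by lra. ring. }
rewrite <- (E ((a + b) / 2) ((a - b) / 2)). do 3 f_equal; field.
Qed.

Lemma sin_mult_le a b : sin a * sin b <= sin ((a + b) / 2) * sin ((a + b) / 2).
Proof.
assert (E := sin_mult_sub a b).
assert (H := Rle_0_sqr (sin ((a - b) / 2))). unfold Rsqr in H. lra.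
Qed.

Lemma sin_mult_lt a b : 0 <= a <= PI -> 0 <= b <= PI -> a <> b ->
  sin a * sin b < sin ((a + b) / 2) * sin ((a + b) / 2).
Proof.
intros Ha Hb Hab.
assert (E := sin_mult_sub a b).
assert (H : sin ((a - b) / 2) <> 0).
{ destruct (Rdichotomy a b Hab) as [H | H].
  - replace ((a - b) / 2) with (- ((b - a) / 2)) by field. rewrite sin_neg.
    assert (0 < sin ((b - a) / 2)) by (apply sin_gt_0; lra). lra.
  - assert (0 < sin ((a - b) / 2)) by (apply sin_gt_0; lra). lra. }
assert (H' := Rsqr_pos_lt _ H). unfold Rsqr in H'. lra.
Qed.

(* Strict log-concavity of the modulus as a function of the point and of all the zeros. *)
Lemma modulus_midpoint N B tau1 tau2 tau i j t1 t2 : 0 < B ->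
  sorted_zeros N tau1 -> sorted_zeros N tau2 -> sorted_zeros N tau ->
  (forall k, (k <= N)%nat -> tau k = (tau1 k + tau2 k) / 2) -> (i < N)%nat -> (j < N)%nat ->
  tau1 i <= t1 <= tau1 (S i) -> tau2 i <= t2 <= tau2 (S i) ->
  1 <= modulus N B tau1 t1 -> 1 <= modulus N B tau2 t2 ->
  t1 - tau1 j <> t2 - tau2 j ->
  1 < modulus N B tau ((t1 + t2) / 2).
Proof.
intros HB Hs1 Hs2 Hs Htau Hi Hj Ht1 Ht2 H1 H2 Hne.
assert (Ht : tau i <= (t1 + t2) / 2 <= tau (S i)) by (rewrite !Htau by lia; lra).
rewrite (modulus_cell N B tau1 i) in H1 by easy.
rewrite (modulus_cell N B tau2 i) in H2 by easy.
rewrite (modulus_cell N B tau i) by easy.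
set (p1 := bigprod (fun j => 2 * sin (cell_angle tau1 i j t1)) N) in *.
set (p2 := bigprod (fun j => 2 * sin (cell_angle tau2 i j t2)) N) in *.
set (p := bigprod (fun j => 2 * sin (cell_angle tau i j ((t1 + t2) / 2))) N).
assert (Hang : forall k, (k < N)%nat -> cell_angle tau i k ((t1 + t2) / 2)
  = (cell_angle tau1 i k t1 + cell_angle tau2 i k t2) / 2).
{ intros k Hk. unfold cell_angle. rewrite Htau by lia. destruct (Nat.leb k i); field. }
assert (Hnonzero : forall q, 1 <= B * bigprod q N -> forall k, (k < N)%nat -> q k <> 0).
{ intros q Hq k Hk E. rewrite (bigprod_zero q N k) in Hq by easy. lra. }
assert (Hp0 : 0 <= p).
{ apply bigprod_nonneg. intros k Hk.
  assert (H := cell_angle_range N tau i k _ Hs Hi Hk Ht).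
  assert (0 <= sin (cell_angle tau i k ((t1 + t2) / 2))) by (apply sin_ge_0; lra). lra. }
(* The comparison is made factor by factor; it is strict at [j], where the two points lie
   differently relative to the zero. *)
assert (Hlt : p1 * p2 < p * p).
{ unfold p1, p2, p. rewrite <- !bigprod_mult. apply (bigprod_lt _ _ N j); [easy | |].
  - intros k Hk.
    assert (A1 := cell_angle_range N tau1 i k t1 Hs1 Hi Hk Ht1).
    assert (A2 := cell_angle_range N tau2 i k t2 Hs2 Hi Hk Ht2).
    assert (S1 : 0 <= sin (cell_angle tau1 i k t1)) by (apply sin_ge_0; lra).
    assert (S2 : 0 <= sin (cell_angle tau2 i k t2)) by (apply sin_ge_0; lra).
    assert (N1 := Hnonzero _ H1 k Hk). assert (N2 := Hnonzero _ H2 k Hk). cbv beta in N1, N2.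
    assert (L := sin_mult_le (cell_angle tau1 i k t1) (cell_angle tau2 i k t2)).
    rewrite <- Hang in L by easy. split; [| lra].
    assert (0 < sin (cell_angle tau1 i k t1)) by (destruct S1; [easy | exfalso; apply N1; lra]).
    assert (0 < sin (cell_angle tau2 i k t2)) by (destruct S2; [easy | exfalso; apply N2; lra]).
    apply Rmult_lt_0_compat; lra.
  - assert (A1 := cell_angle_range N tau1 i j t1 Hs1 Hi Hj Ht1).
    assert (A2 := cell_angle_range N tau2 i j t2 Hs2 Hi Hj Ht2).
    assert (L := sin_mult_lt (cell_angle tau1 i j t1) (cell_angle tau2 i j t2) A1 A2).
    rewrite <- Hang in L by easy.
    assert (cell_angle tau1 i j t1 <> cell_angle tau2 i j t2)
      by (unfold cell_angle; destruct (Nat.leb j i); lra).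
    specialize (L H). lra. }
assert (0 <= B * p) by nra.
assert ((B * p1) * (B * p2) < (B * p) * (B * p)).
{ assert (HB2 : 0 < B * B) by nra. assert (A := Rmult_lt_compat_l _ _ _ HB2 Hlt). lra. }
assert (1 <= (B * p1) * (B * p2)) by nra. nra.
Qed.

Lemma cell_gap N B tau i : 0 < B -> sorted_zeros N tau -> (i < N)%nat ->
  exists l r, tau i <= l <= r /\ r <= tau (S i) /\
    (forall t, tau i <= t <= l -> modulus N B tau t <= 1) /\
    (forall t, r <= t <= tau (S i) -> modulus N B tau t <= 1) /\
    ((l = r /\ forall t, tau i <= t <= tau (S i) -> modulus N B tau t <= 1) \/
     ((exists t, tau i <= t <= tau (S i) /\ 1 < modulus N B tau t) /\
       forall t, l <= t <= r -> 1 <= modulus N B tau t)).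
Proof.
intros HB Hs Hi. set (F := modulus N B tau).
assert (Hlt := proj2 Hs i Hi).
destruct (classic (exists t, tau i <= t <= tau (S i) /\ 1 < F t)) as [[t0 [Ht0 HF0]] | Hno].
2:{ assert (H : forall t, tau i <= t <= tau (S i) -> F t <= 1).
    { intros t Ht. apply Rnot_lt_le. intros Hgt. apply Hno. exists t. lra. }
    exists (tau i), (tau i). repeat split; try lra; auto; intros t Ht; apply H; lra. }
set (E := fun t => tau i <= t <= tau (S i) /\ 1 <= F t).
destruct (completeness E) as [r [Hr1 Hr2]].
{ exists (tau (S i)). intros t [Ht _]; lra. } { exists t0; split; [easy | lra]. }
destruct (completeness (fun t => E (- t))) as [l' [Hl1 Hl2]].
{ exists (- tau i). intros t [Ht _]; lra. }
{ exists (- t0). red. rewrite Ropp_involutive. split; [easy | lra]. }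
set (l := - l').
assert (Hl : forall t, E t -> l <= t).
{ intros t Ht. assert (- t <= l') by (apply Hl1; now rewrite Ropp_involutive). unfold l; lra. }
assert (Hl3 : forall b, (forall t, E t -> b <= t) -> b <= l).
{ intros b Hb. assert (l' <= - b); [| unfold l; lra].
  apply Hl2. intros t Ht. specialize (Hb _ Ht). lra. }
assert (Hr : forall t, E t -> t <= r) by exact Hr1.
clear Hl1 Hl2 Hr1. clearbody l. clear l'.
assert (E0 : E t0) by (split; [easy | lra]).
assert (Rl : tau i <= l) by (apply Hl3; intros t [Ht _]; lra).
assert (Rr : r <= tau (S i)) by (apply Hr2; intros t [Ht _]; lra).
assert (Lt := Hl _ E0). assert (Rt := Hr _ E0).
assert (Fl : 1 <= F l).
{ apply Rnot_lt_le. intros H. destruct (continuity_pt_lt F l 1) as [d [Hd Hn]];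
    [apply modulus_continuous | easy |].
  assert (l + d <= l); [| lra]. apply Hl3. intros t Ht. apply Rnot_lt_le. intros Hlt'.
  assert (A := Hl t Ht). destruct Ht as [_ Ht].
  assert (F t < 1) by (apply Hn; apply Rabs_def1; lra). lra. }
assert (Fr : 1 <= F r).
{ apply Rnot_lt_le. intros H. destruct (continuity_pt_lt F r 1) as [d [Hd Hn]];
    [apply modulus_continuous | easy |].
  assert (r <= r - d); [| lra]. apply Hr2. intros t Ht. apply Rnot_lt_le. intros Hlt'.
  assert (A := Hr t Ht). destruct Ht as [_ Ht].
  assert (F t < 1) by (apply Hn; apply Rabs_def1; lra). lra. }
assert (Hil : tau i < l).
{ destruct (Req_dec (tau i) l) as [Eq | Eq]; [| lra].
  unfold F in Fl. rewrite <- Eq, modulus_zero in Fl by easy. lra. }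
assert (Hir : r < tau (S i)).
{ destruct (Req_dec r (tau (S i))) as [Eq | Eq]; [| lra].
  unfold F in Fr. rewrite Eq, (modulus_cell_end N B tau i) in Fr by easy. lra. }
exists l, r. split; [lra |]. split; [lra |]. split; [| split].
(* A value above 1 persists slightly to the left, which contradicts the minimality of [l] even when
   [t = l]. *)
- intros t Ht. apply Rnot_lt_le. intros H.
  destruct (continuity_pt_gt F t 1) as [d [Hd Hn]]; [apply modulus_continuous | easy |].
  destruct (Req_dec t (tau i)) as [Eq | Eq].
  + unfold F in H. rewrite Eq, modulus_zero in H by easy. lra.
  + set (y := Rmax (tau i) (t - d / 2)).
    assert (Hy : tau i <= y < t /\ t - d < y).
    { unfold y. assert (A := Rmax_l (tau i) (t - d / 2)). assert (A' := Rmax_r (tau i) (t - d / 2)).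
      split; [split; [easy | apply Rmax_lub_lt; lra] | lra]. }
    assert (1 < F y) by (apply Hn; apply Rabs_def1; lra).
    assert (l <= y) by (apply Hl; split; lra). lra.
- intros t Ht. apply Rnot_lt_le. intros H.
  destruct (continuity_pt_gt F t 1) as [d [Hd Hn]]; [apply modulus_continuous | easy |].
  destruct (Req_dec t (tau (S i))) as [Eq | Eq].
  + unfold F in H. rewrite Eq, (modulus_cell_end N B tau i) in H by easy. lra.
  + set (y := Rmin (tau (S i)) (t + d / 2)).
    assert (Hy : t < y <= tau (S i) /\ y < t + d).
    { unfold y. assert (A := Rmin_l (tau (S i)) (t + d / 2)). assert (A' := Rmin_r (tau (S i)) (t + d / 2)).
      split; [split; [apply Rmin_glb_lt; lra | easy] | lra]. }
    assert (1 < F y) by (apply Hn; apply Rabs_def1; lra).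
    assert (y <= r) by (apply Hr; split; lra). lra.
(* The tangent bound at [t] with unmoved zeros is evaluated at the end of the gap towards which the
   tangent does not rise; the value there is at least 1. *)
- right. split; [now exists t0 |]. intros t Ht. change (1 <= F t).
  assert (HFt : 0 < F t) by (apply (modulus_pos N B tau i); auto; lra).
  assert (Hz : bigsum (fun j => (tau j - tau j) * cot_half tau t j) N = 0).
  { rewrite <- (Rmult_0_r (INR N)), <- bigsum_const. apply bigsum_ext. intros; ring. }
  assert (Tl := tangent_bound N B tau tau i t l ltac:(lra) Hs Hs Hi ltac:(lra) ltac:(lra)).
  assert (Tr := tangent_bound N B tau tau i t r ltac:(lra) Hs Hs Hi ltac:(lra) ltac:(lra)).
  rewrite Hz in Tl, Tr. fold F in Tl, Tr.
  assert (Hexp : forall x, x <= 0 -> exp x <= 1).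
  { intros x Hx. rewrite <- exp_0. destruct (Req_dec x 0) as [-> | Hn]; [lra |].
    apply Rlt_le, exp_increasing; lra. }
  destruct (Rle_dec 0 (bigsum (cot_half tau t) N)) as [Hk | Hk].
  + assert (A := Hexp (((l - t) * bigsum (cot_half tau t) N - 0) / 2) ltac:(nra)). nra.
  + assert (A := Hexp (((r - t) * bigsum (cot_half tau t) N - 0) / 2) ltac:(nra)). nra.
Qed.

(** * Rotation of the numbering and first properties of minimizers *)

Definition shift (N : nat) (tau : nat -> R) (j : nat) : R :=
  if Nat.ltb j N then tau (S j) else tau 1%nat + 2 * PI.

(** Gap ends have the indices below [N] only, so they wrap around one index earlier than the zeros,
    whose index [N] closes the circle. *)
Definition shift_gap (N : nat) (l : nat -> R) (j : nat) : R :=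
  if Nat.ltb (S j) N then l (S j) else l 0%nat + 2 * PI.

Lemma gaps_is_sorted N B tau l r : gaps N B tau l r -> sorted_zeros N tau.
Proof. intros H. split; [apply H | exact (gaps_sorted _ _ _ _ _ H)]. Qed.

Lemma modulus_shift N B tau t : (0 < N)%nat -> tau N = tau 0%nat + 2 * PI ->
  modulus N B (shift N tau) t = modulus N B tau t.
Proof.
intros HN Htau. destruct N as [|M]; [lia |].
unfold modulus, sin_prod. rewrite !bigprod_abs. f_equal.
rewrite (bigprod_recl (fun i => Rabs (2 * sin ((t - tau i) / 2)))). simpl bigprod at 1.
rewrite Rmult_comm. f_equal.
- unfold shift. replace (Nat.ltb M (S M)) with true by (symmetry; apply Nat.ltb_lt; lia).
  rewrite Htau. replace ((t - (tau 0%nat + 2 * PI)) / 2) with ((t - tau 0%nat) / 2 - PI) by field.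
  rewrite <- Rabs_Ropp. f_equal. rewrite sin_minus, cos_PI, sin_PI. ring.
- apply bigprod_ext. intros i Hi. unfold shift.
  replace (Nat.ltb i (S M)) with true by (symmetry; apply Nat.ltb_lt; lia). easy.
Qed.

Lemma gaps_shift N B tau l r : (0 < N)%nat -> gaps N B tau l r ->
  gaps N B (shift N tau) (shift_gap N l) (shift_gap N r).
Proof.
intros HN [Htau H]. split.
- unfold shift. rewrite Nat.ltb_irrefl. replace (Nat.ltb 0 N) with true; [easy |].
  symmetry; apply Nat.ltb_lt; lia.
- intros i Hi.
  assert (Ei : shift N tau i = tau (S i)).
  { unfold shift. replace (Nat.ltb i N) with true; [easy |]. symmetry; apply Nat.ltb_lt; lia. }
  assert (EM : forall t, modulus N B (shift N tau) t = modulus N B tau t)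
    by (intros; now apply modulus_shift).
  rewrite Ei. unfold shift at 1, shift_gap.
  destruct (Nat.ltb (S i) N) eqn:E.
  + apply Nat.ltb_lt in E. destruct (H (S i) E) as [H1 [H2 [H3 H4]]].
    repeat split; try apply H1; try apply H2; intros t Ht; rewrite EM; auto.
    apply H4. unfold shift in Ht. apply Nat.ltb_lt in E. now rewrite E in Ht.
  + apply Nat.ltb_ge in E. assert (E' : S i = N) by lia.
    assert (E'' : shift N tau (S i) = tau 1%nat + 2 * PI).
    { unfold shift. now replace (Nat.ltb (S i) N) with false by (symmetry; apply Nat.ltb_ge; lia). }
    rewrite E''. rewrite E', Htau.
    destruct (H 0%nat HN) as [H1 [H2 [H3 H4]]].
    repeat split; try lra; intros t Ht; rewrite EM;
      replace t with ((t - 2 * PI) + 2 * PI) by ring; rewrite modulus_period;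
      [apply H3 | apply H4]; lra.
Qed.

Lemma total_shift N l r : (0 < N)%nat -> total N (shift_gap N l) (shift_gap N r) = total N l r.
Proof.
intros HN. destruct N as [|M]; [lia |]. unfold total.
rewrite (bigsum_recl (fun i => r i - l i)). simpl bigsum at 1. rewrite Rplus_comm. f_equal.
- unfold shift_gap. rewrite Nat.ltb_irrefl. ring.
- apply bigsum_ext. intros i Hi. unfold shift_gap.
  now replace (Nat.ltb (S i) (S M)) with true by (symmetry; apply Nat.ltb_lt; lia).
Qed.

(** After [p + 1] shifts the gap of cell [p] sits in the last cell. The other cells then have
    consecutive indices without wrap-around. *)
Lemma optimal_rotate N B tau l r p : optimal N B tau l r -> (p < N)%nat -> l p < r p ->
  exists tau' l' r', optimal N B tau' l' r' /\ total N l' r' = total N l r /\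
    l' (N - 1)%nat < r' (N - 1)%nat.
Proof.
revert tau l r. induction p as [|p IH]; intros tau l r [H Hopt] Hp Hlr.
- exists (shift N tau), (shift_gap N l), (shift_gap N r). split; [split |].
  + now apply gaps_shift.
  + intros. rewrite total_shift by lia. now apply (Hopt tau').
  + split; [apply total_shift; lia |]. unfold shift_gap.
    replace (Nat.ltb (S (N - 1)) N) with false by (symmetry; apply Nat.ltb_ge; lia). lra.
- destruct (IH (shift N tau) (shift_gap N l) (shift_gap N r)) as [tau' [l' [r' [H1 [H2 H3]]]]].
  + split; [apply gaps_shift; [lia | easy] |].
    intros. rewrite total_shift by lia. now apply (Hopt tau').
  + lia.
  + unfold shift_gap. now replace (Nat.ltb (S p) N) with true by (symmetry; apply Nat.ltb_lt; lia).
  + exists tau', l', r'. rewrite total_shift in H2 by lia. easy.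
Qed.

(** Exchanging a single gap while keeping the zeros is a legitimate competitor. *)
Lemma optimal_cell N B tau l r i l' r' : optimal N B tau l r -> (i < N)%nat ->
  tau i <= l' <= r' -> r' <= tau (S i) ->
  (forall t, tau i <= t <= l' -> modulus N B tau t <= 1) ->
  (forall t, r' <= t <= tau (S i) -> modulus N B tau t <= 1) ->
  r i - l i <= r' - l'.
Proof.
intros [[Htau H] Hopt] Hi H1 H2 H3 H4. apply Rnot_lt_le. intros Hlt.
set (l1 := fun j => if Nat.eqb j i then l' else l j).
set (r1 := fun j => if Nat.eqb j i then r' else r j).
assert (Hg : gaps N B tau l1 r1).
{ split; [easy |]. intros j Hj. unfold l1, r1. destruct (Nat.eqb j i) eqn:E; [| now apply H].
  apply Nat.eqb_eq in E. subst j. easy. }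
assert (Ht := Hopt _ _ _ Hg). apply (Rle_not_lt _ _ Ht).
apply bigsum_lt with (p := i); [easy | |].
- intros j Hj. unfold l1, r1. destruct (Nat.eqb j i) eqn:E; [| lra].
  apply Nat.eqb_eq in E. subst j. lra.
- unfold l1, r1. rewrite Nat.eqb_refl. lra.
Qed.

Lemma optimal_ends N B tau l r i : optimal N B tau l r -> (i < N)%nat -> l i < r i ->
  modulus N B tau (l i) = 1 /\ modulus N B tau (r i) = 1.
Proof.
intros Hopt Hi Hlr. assert (Hc := optimal_cell N B tau l r i).
destruct (proj2 (proj1 Hopt) i Hi) as [H1 [H2 [H3 H4]]].
split; apply Rle_antisym; [apply H3; lra | | apply H4; lra |]; apply Rnot_lt_le; intros Hlt.
- destruct (continuity_pt_lt _ _ _ (modulus_continuous N B tau (l i)) Hlt) as [d [Hd Hn]].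
  set (y := Rmin (r i) (l i + d / 2)).
  assert (A1 := Rmin_l (r i) (l i + d / 2)). assert (A2 := Rmin_r (r i) (l i + d / 2)).
  assert (A3 : l i < y) by (apply Rmin_glb_lt; lra). fold y in A1, A2.
  assert (r i - l i <= r i - y); [| lra].
  apply Hc; auto; try lra.
  intros t Ht. destruct (Rle_dec t (l i)); [apply H3; lra |].
  apply Rlt_le, Hn, Rabs_def1; lra.
- destruct (continuity_pt_lt _ _ _ (modulus_continuous N B tau (r i)) Hlt) as [d [Hd Hn]].
  set (y := Rmax (l i) (r i - d / 2)).
  assert (A1 := Rmax_l (l i) (r i - d / 2)). assert (A2 := Rmax_r (l i) (r i - d / 2)).
  assert (A3 : y < r i) by (apply Rmax_lub_lt; lra). fold y in A1, A2.
  assert (r i - l i <= y - l i); [| lra].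
  apply Hc; auto; try lra.
  intros t Ht. destruct (Rle_dec (r i) t); [apply H4; lra |].
  apply Rlt_le, Hn, Rabs_def1; lra.
Qed.

Lemma optimal_active N B tau l r i : optimal N B tau l r -> (i < N)%nat -> l i < r i ->
  exists t, tau i <= t <= tau (S i) /\ 1 < modulus N B tau t.
Proof.
intros Hopt Hi Hlr. apply NNPP. intros Hno.
assert (H : forall t, tau i <= t <= tau (S i) -> modulus N B tau t <= 1).
{ intros t Ht. apply Rnot_lt_le. intros Hlt. apply Hno. now exists t. }
destruct (proj2 (proj1 Hopt) i Hi) as [H1 [H2 _]].
assert (A := optimal_cell N B tau l r i (tau i) (tau i) Hopt Hi ltac:(lra) ltac:(lra)
  ltac:(intros; apply H; lra) ltac:(intros; apply H; lra)). lra.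
Qed.

Lemma finite_choice (P : nat -> R -> R -> Prop) N :
  (forall i, (i < N)%nat -> exists x y, P i x y) ->
  exists f g : nat -> R, forall i, (i < N)%nat -> P i (f i) (g i).
Proof.
intros H. induction N as [|N IH].
- exists (fun _ => 0), (fun _ => 0). intros; lia.
- destruct IH as [f [g Hfg]]; [intros; apply H; lia |].
  destruct (H N ltac:(lia)) as [x [y Hxy]].
  exists (fun i => if Nat.eqb i N then x else f i), (fun i => if Nat.eqb i N then y else g i).
  intros i Hi. destruct (Nat.eqb i N) eqn:E.
  + apply Nat.eqb_eq in E. now subst i.
  + apply Nat.eqb_neq in E. apply Hfg. lia.
Qed.

(** * Minimizers have simple zeros *)

Lemma bigprod_split f N a : (a < N)%nat ->
  bigprod f N = f a * bigprod (fun j => if Nat.eqb j a then 1 else f j) N.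
Proof.
induction N as [|N IH]; intros Ha; [lia |]. simpl.
destruct (Nat.eqb N a) eqn:E.
- apply Nat.eqb_eq in E. subst a. rewrite Rmult_1_r, Rmult_comm. f_equal.
  apply bigprod_ext. intros i Hi. now replace (Nat.eqb i N) with false
    by (symmetry; apply Nat.eqb_neq; lia).
- apply Nat.eqb_neq in E. rewrite IH by lia. ring.
Qed.

(* [sin (u + y) * sin (u - y) = sin u ^ 2 - sin y ^ 2], so that moving a double zero apart
   lowers the modulus away from it. *)
Lemma modulus_separate N B tau tau' a b x t : 0 < B -> (a < b < N)%nat -> tau a = tau b ->
  tau' a = tau a - x -> tau' b = tau b + x ->
  (forall j, (j < N)%nat -> j <> a -> j <> b -> tau' j = tau j) ->
  B * (2 ^ N * (sin (x / 2) * sin (x / 2))) < 1 ->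
  (modulus N B tau t <= 1 \/ Rabs (sin ((t - tau a) / 2)) <= Rabs (sin (x / 2))) ->
  0 < sin (x / 2) ->
  modulus N B tau' t < 1.
Proof.
intros HB Hab Eab Ha Hb Hj Hx Ht Hx0.
assert (Hsplit : forall f : nat -> R, bigprod f N = f a * f b *
  bigprod (fun j => if Nat.eqb j a then 1 else if Nat.eqb j b then 1 else f j) N).
{ intros f. rewrite (bigprod_split f N a) by lia.
  rewrite (bigprod_split _ N b) by lia.
  replace (Nat.eqb b a) with false by (symmetry; apply Nat.eqb_neq; lia).
  rewrite Rmult_assoc. do 2 f_equal. apply bigprod_ext. intros i _.
  destruct (Nat.eqb i b), (Nat.eqb i a); easy. }
unfold modulus, sin_prod in *. rewrite !bigprod_abs in *.
rewrite (Hsplit (fun i => Rabs (2 * sin ((t - tau' i) / 2)))).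
rewrite (Hsplit (fun i => Rabs (2 * sin ((t - tau i) / 2)))) in Ht.
set (W := bigprod (fun j => if Nat.eqb j a then 1 else if Nat.eqb j b then 1
  else Rabs (2 * sin ((t - tau j) / 2))) N) in *.
assert (E : bigprod (fun j => if Nat.eqb j a then 1 else if Nat.eqb j b then 1
  else Rabs (2 * sin ((t - tau' j) / 2))) N = W).
{ apply bigprod_ext. intros i Hi. destruct (Nat.eqb i a) eqn:E1; [easy |].
  destruct (Nat.eqb i b) eqn:E2; [easy |]. apply Nat.eqb_neq in E1, E2. now rewrite Hj. }
rewrite E.
assert (HW0 : 0 <= W).
{ apply bigprod_nonneg. intros i _. destruct (Nat.eqb i a); [lra |].
  destruct (Nat.eqb i b); [lra | apply Rabs_pos]. }
assert (HW : 4 * W <= 2 ^ N).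
{ assert (A : bigprod (fun _ => 2) N = 2 ^ N).
  { clear. induction N as [|N IH]; simpl; [easy | rewrite IH; ring]. }
  rewrite <- A, Hsplit. assert (W <= bigprod (fun j => if Nat.eqb j a then 1 else
    if Nat.eqb j b then 1 else 2) N); [| lra].
  apply bigprod_le. intros i _. destruct (Nat.eqb i a); [lra |]. destruct (Nat.eqb i b); [lra |].
  split; [apply Rabs_pos |]. rewrite Rabs_mult, (Rabs_pos_eq 2) by lra.
  assert (H : Rabs (sin ((t - tau i) / 2)) <= 1) by apply Rabs_le, SIN_bound. lra. }
rewrite Ha, Hb, <- Eab in *.
set (u := (t - tau a) / 2) in *. set (s := sin (x / 2)) in *.
replace ((t - (tau a - x)) / 2) with (u + x / 2) by (unfold u; field).
replace ((t - (tau a + x)) / 2) with (u - x / 2) by (unfold u; field).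
rewrite <- Rabs_mult.
replace (2 * sin (u + x / 2) * (2 * sin (u - x / 2))) with (4 * (sin u * sin u - s * s)).
2:{ assert (A := sin_mult_sub (u + x / 2) (u - x / 2)).
    replace ((u + x / 2 + (u - x / 2)) / 2) with u in A by field.
    replace ((u + x / 2 - (u - x / 2)) / 2) with (x / 2) in A by field. fold s in A. lra. }
rewrite Rabs_mult, (Rabs_pos_eq 4) by lra.
(* Close to the double zero the two moved factors contribute at most [4 * s ^ 2], absorbed by the
   smallness of [s]; farther away they contribute less than the original [4 * sin u ^ 2]. *)
destruct (Rle_dec (sin u * sin u) (s * s)) as [Hle | Hgt].
- rewrite Rabs_left1 by lra. apply Rle_lt_trans with (B * (2 ^ N * (s * s))); [| easy].
  apply Rmult_le_compat_l; [lra |].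
  assert (0 <= sin u * sin u) by apply Rle_0_sqr.
  assert (0 <= s * s) by apply Rle_0_sqr. nra.
- assert (Hss : 0 < s * s) by nra.
  destruct Ht as [Ht | Ht].
  + rewrite Rabs_pos_eq by lra. rewrite <- Rabs_mult in Ht.
    replace (2 * sin u * (2 * sin u)) with (4 * (sin u * sin u)) in Ht by ring.
    rewrite Rabs_pos_eq in Ht by (assert (0 <= sin u * sin u) by apply Rle_0_sqr; lra).
    destruct HW0 as [HW0 | <-]; [| lra].
    apply Rlt_le_trans with (B * (4 * (sin u * sin u) * W)); [| easy].
    apply Rmult_lt_compat_l; [easy |]. apply Rmult_lt_compat_r; [easy | lra].
  + exfalso. apply Hgt. apply Rsqr_le_abs_1 in Ht. exact Ht.
Qed.

Lemma first_equal (tau : nat -> R) i : (forall j, (j < i)%nat -> tau j <= tau (S j)) ->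
  exists a, (a <= i)%nat /\ tau a = tau i /\ forall c, a = S c -> tau c < tau a.
Proof.
induction i as [|i IH]; intros H; [exists 0%nat; repeat split; [lia | easy] |].
destruct (Req_dec (tau i) (tau (S i))) as [E | E].
- destruct IH as [a [H1 [H2 H3]]]; [intros; apply H; lia |].
  exists a. split; [lia |]. split; [now rewrite H2 | easy].
- exists (S i). split; [lia |]. split; [easy |]. intros c Hc. injection Hc as <-.
  specialize (H i ltac:(lia)). lra.
Qed.

Lemma last_equal (tau : nat -> R) M k b : (b + k = M)%nat ->
  (forall j, (j <= M)%nat -> tau j <= tau (S j)) -> tau M < tau (S M) ->
  exists c, (b <= c <= M)%nat /\ tau c = tau b /\ tau c < tau (S c).
Proof.
revert b. induction k as [|k IH]; intros b Hb H HM.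
- exists b. replace b with M by lia. split; [lia | easy].
- destruct (Req_dec (tau b) (tau (S b))) as [E | E].
  + destruct (IH (S b) ltac:(lia) H HM) as [c [H1 [H2 H3]]].
    exists c. split; [lia |]. split; [now rewrite H2 | easy].
  + exists b. split; [lia |]. split; [easy |]. specialize (H b ltac:(lia)). lra.
Qed.

Lemma abs_sin_le u v : - v <= u <= v -> v <= PI / 2 -> Rabs (sin u) <= sin v.
Proof.
intros Hu Hv. assert (HPI := PI_RGT_0). apply Rabs_le. split.
- rewrite <- sin_neg. apply sin_incr_1; lra.
- apply sin_incr_1; lra.
Qed.

(** In a block of coinciding zeros the first and the last one are pushed apart by [x] each. The
    modulus then drops strictly below 1 outside the old gaps, so all gaps shrink. The last cell has
    positive length, so the block does not cross index [N]. *)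
Lemma optimal_nondegenerate N B tau l r : 0 < B -> (0 < N)%nat -> optimal N B tau l r ->
  l (N - 1)%nat < r (N - 1)%nat -> forall i, (i < N)%nat -> tau i < tau (S i).
Proof.
intros HB HN Hopt Hlr i Hi.
assert (Hg := proj1 Hopt). assert (Hs := gaps_is_sorted _ _ _ _ _ Hg).
destruct Hs as [Htau Hs]. apply Rnot_le_lt. intros Hle.
assert (Hii : tau i = tau (S i)) by (specialize (Hs i Hi); lra).
assert (Hlast : tau (N - 1)%nat < tau N).
{ destruct (proj2 Hg (N - 1)%nat ltac:(lia)) as [H1 [H2 _]].
  replace (S (N - 1)) with N in H2 by lia. lra. }
assert (Hi' : (S i < N)%nat).
{ destruct (Nat.eq_dec (S i) N) as [E | E]; [| lia].
  exfalso. replace (N - 1)%nat with i in Hlast by lia. rewrite <- E in Hlast. lra. }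
destruct (first_equal tau i) as [a [Ha1 [Ha2 Ha3]]]; [intros; apply Hs; lia |].
destruct (last_equal tau (N - 1) (N - 1 - S i) (S i)) as [b [Hb1 [Hb2 Hb3]]];
  [lia | intros; apply Hs; lia | now replace (S (N - 1)) with N by lia |].
assert (Hab : tau a = tau b) by lra.
assert (Hblock : forall j, (a <= j <= b)%nat -> tau j = tau a).
{ intros j Hj. assert (A := monotone_le N tau Hs a j ltac:(lia)).
  assert (A' := monotone_le N tau Hs j b ltac:(lia)). lra. }
assert (Hd : exists d, 0 < d /\ d <= tau N - tau (N - 1)%nat /\ d <= tau (S b) - tau b /\
  forall c, a = S c -> d <= tau a - tau c).
{ assert (Hd0 : exists d, 0 < d /\ forall c, a = S c -> d <= tau a - tau c).
  { destruct a as [|c]; [exists 1; split; [lra | easy] |].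
    exists (tau (S c) - tau c). specialize (Ha3 c eq_refl). split; [lra |].
    intros c' E; injection E as <-; lra. }
  destruct Hd0 as [d0 [Hd0 Hd0']].
  set (d1 := Rmin (tau N - tau (N - 1)%nat) (tau (S b) - tau b)).
  assert (A1 := Rmin_l (tau N - tau (N - 1)%nat) (tau (S b) - tau b)).
  assert (A2 := Rmin_r (tau N - tau (N - 1)%nat) (tau (S b) - tau b)).
  assert (A3 : 0 < d1) by (apply Rmin_glb_lt; lra). fold d1 in A1, A2.
  exists (Rmin d0 d1). assert (B1 := Rmin_l d0 d1). assert (B2 := Rmin_r d0 d1).
  assert (B3 : 0 < Rmin d0 d1) by now apply Rmin_glb_lt.
  split; [easy |]. split; [lra |]. split; [lra |].
  intros c Hc. specialize (Hd0' c Hc). lra. }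
destruct Hd as [d [Hd0 [Hd1 [Hd2 Hd3]]]].
assert (HBN : 0 < B * 2 ^ N) by (apply Rmult_lt_0_compat; [easy | apply pow_lt; lra]).
(* The bound [d / 2] preserves the order of the zeros, also in the last cell when [tau N] moves
   along with [tau 0]; the other bound makes [B * 2 ^ N * sin (x / 2) ^ 2] less than 1. *)
set (x := Rmin (d / 2) (/ (1 + B * 2 ^ N))).
assert (Hx1 : x <= d / 2) by apply Rmin_l.
assert (Hx2 : x <= / (1 + B * 2 ^ N)) by apply Rmin_r.
assert (Hx0 : 0 < x) by (apply Rmin_glb_lt; [lra | apply Rinv_0_lt_compat; lra]).
clearbody x.
assert (Hx3 : x * (1 + B * 2 ^ N) <= 1).
{ apply Rmult_le_reg_r with (/ (1 + B * 2 ^ N)); [apply Rinv_0_lt_compat; lra |].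
  rewrite Rmult_assoc, Rinv_r by lra. lra. }
assert (HxBN : 0 < x * (B * 2 ^ N)) by now apply Rmult_lt_0_compat.
assert (Hx4 : x < 1) by lra.
assert (HPI := PI_RGT_0). assert (HPI2 := PI2_1).
assert (Hsx : 0 < sin (x / 2)) by (apply sin_gt_0; lra).
assert (Hsx' : sin (x / 2) < x / 2) by (apply sin_lt_x; lra).
assert (Hsmall : B * (2 ^ N * (sin (x / 2) * sin (x / 2))) < 1).
{ apply Rle_lt_trans with (x * (B * 2 ^ N)); [| lra].
  replace (B * (2 ^ N * (sin (x / 2) * sin (x / 2))))
    with ((sin (x / 2) * sin (x / 2)) * (B * 2 ^ N)) by ring.
  apply Rmult_le_compat_r; [lra | nra]. }
set (tau' := fun j => if Nat.eqb j a then tau a - x else if Nat.eqb j b then tau b + x else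
  if Nat.eqb j N then tau N + (if Nat.eqb a 0 then - x else 0) else tau j).
assert (Ea : tau' a = tau a - x) by (unfold tau'; now rewrite Nat.eqb_refl).
assert (Eb : tau' b = tau b + x).
{ unfold tau'. replace (Nat.eqb b a) with false by (symmetry; apply Nat.eqb_neq; lia).
  now rewrite Nat.eqb_refl. }
assert (EN : tau' N = tau N + (if Nat.eqb a 0 then - x else 0)).
{ unfold tau'. replace (Nat.eqb N a) with false by (symmetry; apply Nat.eqb_neq; lia).
  replace (Nat.eqb N b) with false by (symmetry; apply Nat.eqb_neq; lia).
  now rewrite Nat.eqb_refl. }
assert (Ej : forall j, (j < N)%nat -> j <> a -> j <> b -> tau' j = tau j).
{ intros j Hj Hja Hjb. unfold tau'.
  replace (Nat.eqb j a) with false by (symmetry; now apply Nat.eqb_neq).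
  replace (Nat.eqb j b) with false by (symmetry; now apply Nat.eqb_neq).
  now replace (Nat.eqb j N) with false by (symmetry; apply Nat.eqb_neq; lia). }
assert (HN' : tau' N = tau' 0%nat + 2 * PI).
{ rewrite EN. destruct (Nat.eqb a 0) eqn:E.
  - apply Nat.eqb_eq in E. subst a. rewrite Ea. lra.
  - apply Nat.eqb_neq in E. rewrite Ej by lia. lra. }
(* A new cell lies either inside the old one or within distance [x] of the block, where the second
   alternative of [Hsep] applies. *)
assert (Hcells : forall j, (j < N)%nat -> tau' j <= tau' (S j) /\
  ((tau j <= tau' j /\ tau' (S j) <= tau (S j)) \/ (tau a - x <= tau' j /\ tau' (S j) <= tau a + x))).
{ intros j Hj. assert (Sj := Hs j Hj).
  assert (Hend : (S j = N)%nat -> tau' (S j) <= tau (S j) /\ tau (S j) - x <= tau' (S j)).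
  { intros ->. rewrite EN. destruct (Nat.eqb a 0); lra. }
  destruct (lt_eq_lt_dec j a) as [[Hja | ->] | Hja].
  - rewrite (Ej j) by lia. destruct (Nat.eq_dec (S j) a) as [E | E].
    + rewrite E, Ea. specialize (Hd3 j (eq_sym E)). rewrite <- E in *. lra.
    + rewrite Ej by lia. lra.
  - rewrite Ea. destruct (Nat.eq_dec (S a) b) as [E | E].
    + rewrite E, Eb. lra.
    + rewrite Ej by lia. rewrite (Hblock (S a)) by lia. lra.
  - destruct (lt_eq_lt_dec j b) as [[Hjb | ->] | Hjb].
    + rewrite (Ej j) by lia. rewrite (Hblock j) by lia. destruct (Nat.eq_dec (S j) b) as [E | E].
      * rewrite E, Eb. lra.
      * rewrite Ej by lia. rewrite (Hblock (S j)) by lia. lra.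
    + rewrite Eb. destruct (Nat.eq_dec (S b) N) as [E | E].
      * specialize (Hend E). lra.
      * rewrite Ej by lia. lra.
    + rewrite (Ej j) by lia. destruct (Nat.eq_dec (S j) N) as [E | E].
      * specialize (Hend E). replace j with (N - 1)%nat in * by lia.
        rewrite E in *. lra.
      * rewrite Ej by lia. lra. }
assert (Hs' : sorted_zeros N tau') by (split; [easy | intros j Hj; now apply Hcells]).
assert (Hsep : forall t, modulus N B tau t <= 1 \/
  Rabs (sin ((t - tau a) / 2)) <= Rabs (sin (x / 2)) -> modulus N B tau' t < 1).
{ intros t Ht. apply (modulus_separate N B tau tau' a b x); auto. lia. }
destruct (finite_choice (fun j l' r' => tau' j <= l' <= r' /\ r' <= tau' (S j) /\
    (forall t, tau' j <= t <= l' -> modulus N B tau' t <= 1) /\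
    (forall t, r' <= t <= tau' (S j) -> modulus N B tau' t <= 1) /\
    (r' - l' <= r j - l j /\ (l j < r j -> r' - l' < r j - l j))) N) as [l' [r' H']].
{ intros j Hj. destruct (cell_gap N B tau' j HB Hs' Hj) as [l' [r' [A1 [A2 [A3 [A4 A5]]]]]].
  exists l', r'. repeat split; try easy.
  all: destruct (proj2 Hg j Hj) as [C1 [C2 [C3 C4]]].
  (* At both ends of a nontrivial new gap the modulus is at least 1, whereas [Hsep] makes it less
     than 1 outside the old gap; the new gap therefore lies strictly inside the old one. *)
  all: destruct A5 as [[A5 _] | [_ A5]]; [lra |].
  all: assert (F1 := A5 l' ltac:(lra)); assert (F2 := A5 r' ltac:(lra)).
  all: destruct (Hcells j Hj) as [_ [D | D]].
  1, 3: assert (l j < l') by (apply Rnot_le_lt; intros G;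
    assert (G' := Hsep l' (or_introl (C3 l' ltac:(lra)))); lra);
    assert (r' < r j) by (apply Rnot_le_lt; intros G;
    assert (G' := Hsep r' (or_introl (C4 r' ltac:(lra)))); lra); lra.
  all: exfalso; assert (G' : modulus N B tau' l' < 1); [| lra]; apply Hsep; right.
  all: rewrite (Rabs_pos_eq (sin (x / 2))) by lra; apply abs_sin_le; lra. }
assert (Hlt : total N l' r' < total N l r).
{ apply bigsum_lt with (p := (N - 1)%nat); [lia | |].
  - intros j Hj. now apply H'.
  - apply H'; [lia | easy]. }
apply (Rlt_not_le _ _ Hlt), (proj2 Hopt tau'). split; [easy |]. intros j Hj.
destruct (H' j Hj) as [A1 [A2 [A3 [A4 _]]]]. easy.
Qed.

(** * Moving the zeros of a minimizer along a line *)

Definition near0 (P : R -> Prop) : Prop :=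
  exists d, 0 < d /\ forall s, Rabs s < d -> P s.

Lemma near0_and P Q : near0 P -> near0 Q -> near0 (fun s => P s /\ Q s).
Proof.
intros [d [Hd H]] [e [He H']]. exists (Rmin d e). split; [now apply Rmin_glb_lt |].
intros s Hs. assert (A := Rmin_l d e). assert (A' := Rmin_r d e).
split; [apply H | apply H']; lra.
Qed.

Lemma near0_impl (P Q : R -> Prop) : near0 P -> (forall s, P s -> Q s) -> near0 Q.
Proof. intros [d [Hd H]] HPQ. exists d. auto. Qed.

Lemma near0_forall (P : nat -> R -> Prop) N : (forall i, (i < N)%nat -> near0 (P i)) ->
  near0 (fun s => forall i, (i < N)%nat -> P i s).
Proof.
induction N as [|N IH]; intros H; [exists 1; split; [lra | intros; lia] |].
apply near0_impl with (fun s => (forall i, (i < N)%nat -> P i s) /\ P N s).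
- apply near0_and; [apply IH; intros; apply H; lia | apply H; lia].
- intros s [H1 H2] i Hi. destruct (Nat.eq_dec i N) as [-> | E]; [easy | apply H1; lia].
Qed.

Lemma near0_lt f x : continuity_pt f 0 -> f 0 < x -> near0 (fun s => f s < x).
Proof.
intros Hf Hx. destruct (continuity_pt_lt f 0 x Hf Hx) as [d [Hd H]].
exists d. split; [easy |]. intros s Hs. apply H. now rewrite Rminus_0_r.
Qed.

Lemma near0_gt f x : continuity_pt f 0 -> x < f 0 -> near0 (fun s => x < f s).
Proof.
intros Hf Hx. destruct (continuity_pt_gt f 0 x Hf Hx) as [d [Hd H]].
exists d. split; [easy |]. intros s Hs. apply H. now rewrite Rminus_0_r.
Qed.

Lemma affine_continuous a b s : continuity_pt (fun s => a + s * b) s.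
Proof.
apply derivable_continuous_pt. exists b. apply is_derive_Reals. auto_derive; [easy | ring].
Qed.

Lemma modulus_move_continuous N B tau w t s :
  continuity_pt (fun s => modulus N B (fun j => tau j + s * w j) t) s.
Proof.
apply continuity_pt_mult; [apply continuity_pt_const; now intros x y |].
apply (continuity_pt_comp (fun s => sin_prod N (fun j => tau j + s * w j) t) Rabs);
  [| apply Rcontinuity_abs].
induction N as [|N IH]; [apply continuity_pt_const; now intros x y |].
unfold sin_prod. simpl. apply continuity_pt_mult; [exact IH |].
apply derivable_continuous_pt. exists (- w N * cos ((t - (tau N + s * w N)) / 2)).
apply is_derive_Reals. auto_derive; [easy |]. unfold Rminus, Rdiv. field.
Qed.

(* Otherwise the zeros could be moved along a line on which the lengths of all gaps are
   concave, the gap of the [p]-th cell strictly, so that one of the two directions would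
   shorten the gaps. *)
Lemma optimal_touch N B tau l r p q : 0 < B -> optimal N B tau l r ->
  (forall i, (i < N)%nat -> tau i < tau (S i)) -> (p < N)%nat -> l p < r p ->
  (q < N)%nat -> q <> p ->
  (forall t, tau q <= t <= tau (S q) -> modulus N B tau t <= 1) /\
  exists c, tau q < c < tau (S q) /\ modulus N B tau c = 1.
Proof.
intros HB Hopt Hinc Hp Hlr Hq Hqp.
assert (Hg := proj1 Hopt). assert (Hs := gaps_is_sorted _ _ _ _ _ Hg).
destruct (finite_choice (fun i c _ => tau i < c < tau (S i) /\
    (forall t, tau i <= t <= tau (S i) -> modulus N B tau t <= modulus N B tau c) /\
    bigsum (cot_half tau c) N = 0) N) as [c [_ Hc]].
{ intros i Hi. destruct (cell_maximum N B tau i HB Hs Hi (Hinc i Hi)) as [c Hc]. now exists c, 0. }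
destruct (Req_dec (modulus N B tau (c q)) 1) as [E | Hq1].
{ destruct (Hc q Hq) as [H1 [H2 _]]. split; [intros t Ht; rewrite <- E; now apply H2 |].
  now exists (c q). }
exfalso.
assert (Hcp : 1 < modulus N B tau (c p)).
{ destruct (optimal_active N B tau l r p Hopt Hp Hlr) as [t [Ht1 Ht2]].
  destruct (Hc p Hp) as [_ [H _]]. specialize (H t Ht1). lra. }
(* Row [p] is void, which guarantees a nonzero solution. Row [q] fixes the zero [tau 0] and so
   excludes rotations. Every other row demands that the maximum of its cell be stationary. *)
set (a := fun i j => if Nat.eqb i p then 0 else if Nat.eqb i q then (if Nat.eqb j 0 then 1 else 0)
  else cot_half tau (c i) j).
destruct (@Factorization.null_vector N p a Hp) as [v [[j0 [Hj0 Hv0]] Hv']].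
{ intros j. unfold a. now rewrite Nat.eqb_refl. }
assert (HN0 : (0 < N)%nat) by lia.
assert (Hv00 : v 0%nat = 0).
{ assert (H := Hv' q Hq). destruct N as [|M]; [lia |]. rewrite bigsum_recl in H.
  assert (Z : bigsum (fun i => v (S i) * a q (S i)) M = 0).
  { rewrite <- (Rmult_0_r (INR M)), <- bigsum_const. apply bigsum_ext. intros i _. unfold a.
    replace (Nat.eqb q p) with false by (symmetry; now apply Nat.eqb_neq).
    rewrite Nat.eqb_refl. simpl. ring. }
  rewrite Z in H. unfold a in H.
  replace (Nat.eqb q p) with false in H by (symmetry; now apply Nat.eqb_neq).
  rewrite Nat.eqb_refl in H. simpl in H. lra. }
assert (Hslope : forall i, (i < N)%nat -> i <> p -> i <> q ->
  bigsum (fun j => v j * cot_half tau (c i) j) N = 0).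
{ intros i Hi Hip Hiq. rewrite <- (Hv' i Hi). apply bigsum_ext. intros j _. unfold a.
  replace (Nat.eqb i p) with false by (symmetry; now apply Nat.eqb_neq).
  now replace (Nat.eqb i q) with false by (symmetry; now apply Nat.eqb_neq). }
(* Index [N] has to move like index 0, which stays fixed. *)
set (w := fun j => if Nat.eqb j N then 0 else v j).
assert (HwN : w N = 0) by (unfold w; now rewrite Nat.eqb_refl).
assert (Hw : forall j, (j < N)%nat -> w j = v j).
{ intros j Hj. unfold w. now replace (Nat.eqb j N) with false by (symmetry; apply Nat.eqb_neq; lia). }
set (T := fun s j => tau j + s * w j).
(* The logarithm of the maximum in cell [q] changes at the rate [- kq / 2]. If that maximum is below
   1 it stays so for small [s]; if it is above 1, the cell has a gap and is treated like [p]. *)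
set (kq := bigsum (fun j => v j * cot_half tau (c q) j) N).
assert (Hsmall : near0 (fun s => (forall i, (i < N)%nat -> T s i < T s (S i) /\
  (1 < modulus N B tau (c i) -> T s i < c i < T s (S i) /\ 1 < modulus N B (T s) (c i))) /\
  (modulus N B tau (c q) < 1 -> modulus N B tau (c q) * exp (- (s * kq) / 2) < 1))).
{ apply near0_and.
  - apply near0_forall. intros i Hi. destruct (Hc i Hi) as [H1 _]. apply near0_and.
    + apply near0_impl with (fun s => 0 < (tau (S i) - tau i) + s * (w (S i) - w i)).
      * apply (near0_gt (fun s => (tau (S i) - tau i) + s * (w (S i) - w i)));
          [apply affine_continuous |]. specialize (Hinc i Hi). lra.
      * intros s H. unfold T. lra.
    + destruct (Rlt_dec 1 (modulus N B tau (c i))) as [H2 | H2];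
        [| exists 1; split; [lra | intros; lra]].
      apply near0_impl with (fun s => (T s i < c i /\ c i < T s (S i)) /\ 1 < modulus N B (T s) (c i));
        [| easy].
      apply near0_and; [apply near0_and |].
      * apply (near0_lt (fun s => T s i)); [apply affine_continuous | unfold T; lra].
      * apply (near0_gt (fun s => T s (S i))); [apply affine_continuous | unfold T; lra].
      * apply (near0_gt (fun s => modulus N B (T s) (c i))); [apply modulus_move_continuous |].
        unfold T, modulus, sin_prod in *. erewrite bigprod_ext; [exact H2 |].
        intros j _. simpl. do 3 f_equal. ring.
  - destruct (Rlt_dec (modulus N B tau (c q)) 1) as [H2 | H2];
      [| exists 1; split; [lra | intros; lra]].
    apply near0_impl with (fun s => modulus N B tau (c q) * exp (- (s * kq) / 2) < 1); [| easy].
    apply (near0_lt (fun s => modulus N B tau (c q) * exp (- (s * kq) / 2))).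
    + apply derivable_continuous_pt.
      exists (modulus N B tau (c q) * (- kq / 2 * exp (- (0 * kq) / 2))).
      apply is_derive_Reals. auto_derive; [easy |]. unfold Rdiv. field.
    + replace (- (0 * kq) / 2) with 0 by field. rewrite exp_0. lra. }
destruct Hsmall as [d [Hd Hsmall]].
assert (HTs : forall s, Rabs s < d -> sorted_zeros N (T s)).
{ intros s Hsd. split.
  - unfold T. rewrite HwN, Hw, Hv00 by lia. rewrite (proj1 Hs). ring.
  - intros i Hi. apply Rlt_le. now apply (Hsmall s Hsd). }
(* At a critical point the tangent bound is independent of [t]. Its exponent vanishes by the
   equations, except in cell [q], where [s] is small enough. *)
assert (Hflat : forall s i, Rabs s < d -> (i < N)%nat -> modulus N B tau (c i) <= 1 ->
  forall t, T s i <= t <= T s (S i) -> modulus N B (T s) t <= 1).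
{ intros s i Hsd Hi Hle t Ht. destruct (Hc i Hi) as [C1 [_ C2]].
  assert (A := tangent_bound N B tau (T s) i (c i) t ltac:(lra) Hs (HTs s Hsd) Hi C1 Ht).
  rewrite C2 in A.
  assert (E : bigsum (fun j => (T s j - tau j) * cot_half tau (c i) j) N
    = s * bigsum (fun j => v j * cot_half tau (c i) j) N).
  { rewrite <- bigsum_scal. apply bigsum_ext. intros j Hj. unfold T. rewrite Hw by easy. ring. }
  rewrite E in A. eapply Rle_trans; [exact A |].
  destruct (Nat.eq_dec i q) as [-> | Hiq].
  - fold kq. replace (((t - c q) * 0 - s * kq) / 2) with (- (s * kq) / 2) by field.
    apply Rlt_le, (Hsmall s Hsd). lra.
  - rewrite Hslope; [| easy | intros ->; lra | easy].
    replace (((t - c i) * 0 - s * 0) / 2) with 0 by field. rewrite exp_0. lra. }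
assert (Hgaps : forall s, Rabs s < d -> exists l' r', gaps N B (T s) l' r' /\
  forall i, (i < N)%nat -> (l' i = r' i /\ modulus N B tau (c i) <= 1) \/
    (1 < modulus N B tau (c i) /\ forall t, l' i <= t <= r' i -> 1 <= modulus N B (T s) t)).
{ intros s Hsd.
  destruct (finite_choice (fun i l' r' => T s i <= l' <= r' /\ r' <= T s (S i) /\
    (forall t, T s i <= t <= l' -> modulus N B (T s) t <= 1) /\
    (forall t, r' <= t <= T s (S i) -> modulus N B (T s) t <= 1) /\
    ((l' = r' /\ modulus N B tau (c i) <= 1) \/
    (1 < modulus N B tau (c i) /\ forall t, l' <= t <= r' -> 1 <= modulus N B (T s) t))) N)
    as [l' [r' H']].
  - intros i Hi.
    destruct (cell_gap N B (T s) i HB (HTs s Hsd) Hi) as [l' [r' [A1 [A2 [A3 [A4 A5]]]]]].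
    exists l', r'. repeat split; try easy.
    destruct A5 as [[A5 A6] | [[t [Ht1 Ht2]] A5]].
    + left. split; [easy |]. apply Rnot_lt_le. intros G.
      destruct (proj2 (proj1 (Hsmall s Hsd) i Hi) G) as [G1 G2].
      specialize (A6 (c i) ltac:(lra)). lra.
    + right. split; [| easy]. apply Rnot_le_lt. intros G.
      specialize (Hflat s i Hsd Hi G t Ht1). lra.
  - exists l', r'. split.
    + split; [apply HTs; easy |]. intros i Hi. destruct (H' i Hi) as [A1 [A2 [A3 [A4 A5]]]]. easy.
    + intros i Hi. now apply H'. }
assert (Hxi : Rabs (d / 2) < d) by (rewrite Rabs_pos_eq; lra).
assert (Hxi' : Rabs (- (d / 2)) < d) by (rewrite Rabs_Ropp, Rabs_pos_eq; lra).
destruct (Hgaps _ Hxi) as [l1 [r1 [G1 K1]]]. destruct (Hgaps _ Hxi') as [l2 [r2 [G2 K2]]].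
assert (HT1 := HTs _ Hxi). assert (HT2 := HTs _ Hxi').
set (tau1 := T (d / 2)) in *. set (tau2 := T (- (d / 2))) in *.
assert (Hmid : forall k, (k <= N)%nat -> tau k = (tau1 k + tau2 k) / 2)
  by (intros k _; unfold tau1, tau2, T; field).
(* Two equal points see the zero [j0] move; two distinct points differ relative to the fixed zero 0.
   This supplies strictness in the midpoint inequality. *)
assert (Hexists : forall t1 t2, exists j, (j < N)%nat /\ t1 - tau1 j <> t2 - tau2 j).
{ intros t1 t2. destruct (Req_dec t1 t2) as [-> | Hne].
  - exists j0. split; [easy |]. unfold tau1, tau2, T. rewrite Hw by easy.
    intros E. apply Hv0. assert (d * v j0 = 0) by lra.
    apply Rmult_integral in H. destruct H; lra.
  - exists 0%nat. split; [easy |]. unfold tau1, tau2, T. rewrite Hw, Hv00 by easy. lra. }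
(* The midpoints of corresponding gap ends have modulus above 1, so they lie strictly inside the old
   gap: on average the two moved gaps are shorter. *)
assert (Hstrict : forall i, (i < N)%nat -> 1 < modulus N B tau (c i) ->
  (r1 i - l1 i) + (r2 i - l2 i) < (r i - l i) + (r i - l i)).
{ intros i Hi Hci.
  destruct (K1 i Hi) as [[_ K] | [_ K1']]; [lra |]. destruct (K2 i Hi) as [[_ K] | [_ K2']]; [lra |].
  destruct (proj2 G1 i Hi) as [A1 [A2 _]]. destruct (proj2 G2 i Hi) as [B1 [B2 _]].
  destruct (proj2 Hg i Hi) as [C1 [C2 [C3 C4]]].
  assert (M0 := Hmid i ltac:(lia)). assert (M1 := Hmid (S i) ltac:(lia)).
  destruct (Hexists (l1 i) (l2 i)) as [j [Hj Hjne]].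
  assert (L := modulus_midpoint N B tau1 tau2 tau i j (l1 i) (l2 i) HB HT1 HT2 Hs Hmid Hi Hj
    ltac:(lra) ltac:(lra) (K1' (l1 i) ltac:(lra)) (K2' (l2 i) ltac:(lra)) Hjne).
  destruct (Hexists (r1 i) (r2 i)) as [k [Hk Hkne]].
  assert (U := modulus_midpoint N B tau1 tau2 tau i k (r1 i) (r2 i) HB HT1 HT2 Hs Hmid Hi Hk
    ltac:(lra) ltac:(lra) (K1' (r1 i) ltac:(lra)) (K2' (r2 i) ltac:(lra)) Hkne).
  assert (l i < (l1 i + l2 i) / 2).
  { apply Rnot_le_lt. intros G. specialize (C3 ((l1 i + l2 i) / 2) ltac:(lra)). lra. }
  assert ((r1 i + r2 i) / 2 < r i).
  { apply Rnot_le_lt. intros G. specialize (C4 ((r1 i + r2 i) / 2) ltac:(lra)). lra. }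
  lra. }
assert (Hsum : total N l1 r1 + total N l2 r2 < total N l r + total N l r).
{ unfold total. rewrite <- !bigsum_plus. apply bigsum_lt with (p := p); [easy | | now apply Hstrict].
  intros i Hi. destruct (Rlt_dec 1 (modulus N B tau (c i))) as [H | H]; [apply Rlt_le; auto |].
  destruct (K1 i Hi) as [[K1' _] | [K1' _]]; [| lra].
  destruct (K2 i Hi) as [[K2' _] | [K2' _]]; [| lra].
  destruct (proj2 Hg i Hi) as [C1 _]. lra. }
assert (O1 := proj2 Hopt _ _ _ G1). assert (O2 := proj2 Hopt _ _ _ G2). lra.
Qed.

(** * Equioscillation and the value of the minimum *)

Lemma bigprod_cell_sign N i : (i < N)%nat ->
  bigprod (fun j => if Nat.leb j i then 1 else -1) N = (-1) ^ (N + S i).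
Proof.
induction N as [|N IH]; intros Hi; [lia |].
destruct (Nat.eq_dec i N) as [-> | Hne].
- replace (S N + S N)%nat with (2 * S N)%nat by lia. rewrite pow_1_even.
  rewrite (bigprod_ext _ (fun _ => 1)).
  + clear. induction (S N) as [|n IH]; simpl; [easy | rewrite IH; ring].
  + intros j Hj. now replace (Nat.leb j N) with true by (symmetry; apply Nat.leb_le; lia).
- simpl bigprod. rewrite IH by lia.
  replace (Nat.leb N i) with false by (symmetry; apply Nat.leb_gt; lia). simpl pow. ring.
Qed.

(** The [N - 1 - i] zeros with index above [i] give nonpositive factors, and [N + S i] has the same
    parity. *)
Lemma sin_prod_cell_sign N B tau i t : sorted_zeros N tau -> (i < N)%nat ->
  tau i <= t <= tau (S i) -> B * sin_prod N tau t = (-1) ^ (N + S i) * modulus N B tau t.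
Proof.
intros Hs Hi Ht. rewrite (modulus_cell N B tau i) by easy.
rewrite <- (bigprod_cell_sign N i Hi).
replace (bigprod (fun j => if Nat.leb j i then 1 else -1) N *
   (B * bigprod (fun j => 2 * sin (cell_angle tau i j t)) N))
  with (B * (bigprod (fun j => if Nat.leb j i then 1 else -1) N *
   bigprod (fun j => 2 * sin (cell_angle tau i j t)) N)) by ring.
f_equal. rewrite <- bigprod_mult. apply bigprod_ext. intros j _.
rewrite sin_cell_angle. destruct (Nat.leb j i); ring.
Qed.

Lemma sin_prod_period N tau t : sin_prod N tau (t + 2 * PI) = (-1) ^ N * sin_prod N tau t.
Proof.
unfold sin_prod. induction N as [|N IH]; simpl; [ring |]. rewrite IH.
replace ((t + 2 * PI - tau N) / 2) with ((t - tau N) / 2 + PI) by field. rewrite neg_sin. ring.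
Qed.

Lemma cell_exists N (tau : nat -> R) t : tau 0%nat <= t <= tau N -> (0 < N)%nat ->
  exists i, (i < N)%nat /\ tau i <= t <= tau (S i).
Proof.
intros Ht HN. induction N as [|N IH]; [lia |].
destruct (Rle_dec (tau N) t) as [H | H]; [exists N; split; [lia | lra] |].
destruct N as [|N]; [exists 0%nat; split; [lia | lra] |].
destruct IH as [i [Hi1 Hi2]]; [lra | lia |]. exists i. split; [lia | easy].
Qed.

(** These are the points where the Chebyshev polynomial of [sin (t / 2) / s] equals 1 or -1. Since
    [cos] decreases, [N - k] makes them increase with [k]. *)
Definition cheb_node (N : nat) (s : R) (k : nat) : R :=
  2 * asin (s * cos (INR (N - k) * PI / INR N)).

Lemma cheb_node_sin N s k : 0 < s <= 1 -> sin (cheb_node N s k / 2) = s * cos (INR (N - k) * PI / INR N).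
Proof.
intros Hs. unfold cheb_node.
replace (2 * asin (s * cos (INR (N - k) * PI / INR N)) / 2)
  with (asin (s * cos (INR (N - k) * PI / INR N))) by field.
apply sin_asin. assert (H := COS_bound (INR (N - k) * PI / INR N)). nra.
Qed.

Lemma cheb_node_range N s k : - PI <= cheb_node N s k <= PI.
Proof. unfold cheb_node. assert (H := asin_bound (s * cos (INR (N - k) * PI / INR N))). lra. Qed.

Lemma cheb_node_increasing N s k : 0 < s <= 1 -> (k < N)%nat ->
  cheb_node N s k < cheb_node N s (S k).
Proof.
intros Hs Hk.
assert (H : sin (cheb_node N s k / 2) < sin (cheb_node N s (S k) / 2)).
{ rewrite !cheb_node_sin by easy. apply Rmult_lt_compat_l; [lra |].
  assert (HN : 0 < INR N) by (apply lt_0_INR; lia). assert (HPI := PI_RGT_0).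
  assert (Hr : forall j, (j <= N)%nat -> 0 <= INR j * PI / INR N <= PI).
  { intros j Hj. assert (A := pos_INR j). assert (A' := le_INR j N Hj). split.
    - apply Rdiv_le_0_compat; nra.
    - apply Rmult_le_reg_r with (INR N); [easy |]. unfold Rdiv.
      rewrite Rmult_assoc, Rinv_l by lra. nra. }
  assert (A := Hr (N - k)%nat ltac:(lia)). assert (A' := Hr (N - S k)%nat ltac:(lia)).
  apply cos_decreasing_1; try lra.
  unfold Rdiv. apply Rmult_lt_compat_r; [now apply Rinv_0_lt_compat |].
  apply Rmult_lt_compat_r; [easy |]. apply lt_INR; lia. }
assert (A := cheb_node_range N s k). assert (A' := cheb_node_range N s (S k)).
assert (cheb_node N s k / 2 < cheb_node N s (S k) / 2); [| lra].
apply sin_increasing_0; try lra; easy.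
Qed.

Lemma cheb_node_value N s k : 0 < s <= 1 -> (k <= N)%nat -> (0 < N)%nat ->
  cheb N (/ s * sin (cheb_node N s k / 2)) = (-1) ^ (N + k).
Proof.
intros Hs Hk HN. rewrite cheb_node_sin by easy.
rewrite <- Rmult_assoc, Rinv_l, Rmult_1_l, cheb_cos by lra.
assert (HN0 : 0 < INR N) by (apply lt_0_INR; lia).
replace (INR N * (INR (N - k) * PI / INR N)) with (0 + INR (N - k) * PI) by (field; lra).
rewrite cos_add_kPI, cos_0, Rmult_1_r.
replace (N + k)%nat with ((N - k) + 2 * k)%nat by lia. rewrite pow_add, pow_1_even. ring.
Qed.

Lemma optimal_value N B tau l r : 0 < B -> (0 < N)%nat -> optimal N B tau l r ->
  0 < total N l r -> 2 * B * cos (total N l r / 4) ^ N <= 1.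
Proof.
intros HB HN Hopt0 Htot0.
assert (Hact : exists p, (p < N)%nat /\ l p < r p).
{ apply NNPP. intros Hno. apply (Rlt_not_le _ _ Htot0).
  rewrite <- (Rmult_0_r (INR N)), <- bigsum_const. apply bigsum_le. intros i Hi.
  apply Rnot_lt_le. intros H. apply Hno. exists i. split; [easy | lra]. }
destruct Hact as [p [Hp Hlrp]].
destruct (optimal_rotate N B tau l r p Hopt0 Hp Hlrp) as [tau' [l' [r' [Hopt [Htot Hlr]]]]].
rewrite <- Htot in *. clear tau l r Hopt0 p Hp Hlrp Htot.
rename tau' into tau. rename l' into l. rename r' into r.
assert (Hinc := optimal_nondegenerate N B tau l r HB HN Hopt Hlr).
assert (Hg := proj1 Hopt). assert (Hs := gaps_is_sorted _ _ _ _ _ Hg).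
set (M := (N - 1)%nat) in *. assert (HM : N = S M) by lia. assert (HMN : (M < N)%nat) by lia.
clearbody M.
assert (Htouch : forall q, (q < M)%nat -> (forall t, tau q <= t <= tau (S q) -> modulus N B tau t <= 1) /\
  exists c, tau q < c < tau (S q) /\ modulus N B tau c = 1).
{ intros q Hq. apply (optimal_touch N B tau l r M q); auto; lia. }
destruct (finite_choice (fun q c _ => tau q < c < tau (S q) /\ modulus N B tau c = 1) M)
  as [c [_ Hc]].
{ intros q Hq. destruct (Htouch q Hq) as [_ [c Hc]]. now exists c, 0. }
assert (Hg_eq : total N l r = r M - l M).
{ unfold total. rewrite HM. simpl. replace (bigsum (fun i => r i - l i) M) with 0; [ring |].
  rewrite <- (Rmult_0_r (INR M)), <- bigsum_const. apply bigsum_ext. intros q Hq.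
  destruct (Htouch q Hq) as [Hle _]. destruct (proj2 Hg q ltac:(lia)) as [H1 [H2 _]].
  assert (A := optimal_cell N B tau l r q (tau q) (tau q) Hopt ltac:(lia) ltac:(lra) ltac:(lra)
    ltac:(intros; apply Hle; lra) ltac:(intros; apply Hle; lra)). lra. }
destruct (optimal_ends N B tau l r M Hopt HMN Hlr) as [Hl1 Hr1].
destruct (proj2 Hg M HMN) as [HC1 [HC2 [HC3 HC4]]].
assert (HtauN := proj1 Hs). rewrite <- HM in HC2, HC4.
assert (HlM : tau M < l M).
{ destruct (Req_dec (tau M) (l M)) as [E | E]; [| lra].
  rewrite <- E, modulus_zero in Hl1 by easy. lra. }
assert (H0M := monotone_le N tau (proj2 Hs) 0%nat M ltac:(lia)).
(* The complement of the single gap is the arc from [r M - 2 * PI] to [l M], with centre [c0] and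
   half-length [th]; translation by [c0] makes it symmetric about 0. *)
set (g := total N l r) in *. set (th := PI - g / 2). set (c0 := l M - th).
assert (Hth : 0 < th) by (unfold th; lra). assert (Hth' : th < PI) by (unfold th; lra).
assert (HrM : r M - 2 * PI = c0 - th) by (unfold c0, th; lra).
set (s := cos (g / 4)).
assert (Hs_th : sin (th / 2) = s).
{ unfold th, s. replace ((PI - g / 2) / 2) with (PI / 2 - g / 4) by field. apply sin_shift. }
assert (HPI := PI_RGT_0).
assert (Hs0 : 0 < s) by (rewrite <- Hs_th; apply sin_gt_0; lra).
assert (Hs1 : s <= 1) by apply COS_bound.
set (sigma := fun j => tau j + - c0).
set (G := fun t => B * sin_prod N sigma t).
assert (EG : forall t, G t = B * sin_prod N tau (t + c0)).
{ intros t. unfold G, sigma. replace t with ((t + c0) + - c0) at 1 by ring.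
  now rewrite sin_prod_translate. }
assert (EGabs : forall t, Rabs (G t) = modulus N B tau (t + c0)).
{ intros t. rewrite EG, Rabs_mult, (Rabs_pos_eq B) by lra. easy. }
assert (Garc : forall t, - th <= t <= th -> Rabs (G t) <= 1).
{ intros t Ht. rewrite EGabs. destruct (Rle_dec (tau 0%nat) (t + c0)) as [H | H].
  - destruct (cell_exists N tau (t + c0)) as [i [Hi1 Hi2]]; [unfold c0 in *; lra | easy |].
    destruct (Nat.eq_dec i M) as [-> | Hne].
    + apply HC3. unfold c0 in *; lra.
    + apply (Htouch i); [lia | easy].
  - rewrite <- modulus_period. apply HC4. lra. }
set (T := fun t => cheb N (/ s * sin (t / 2))).
assert (HG : half_angle N G) by (apply half_angle_scal, half_angle_sin_prod).
assert (HT : half_angle N T) by apply half_angle_cheb.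
assert (Tarc : forall t, - th <= t <= th -> Rabs (T t) <= 1).
{ intros t Ht. apply cheb_abs_le.
  assert (A := abs_sin_le (t / 2) (th / 2) ltac:(lra) ltac:(lra)). rewrite Hs_th in A.
  apply Rabs_le_between in A.
  split; apply Rmult_le_reg_l with s; try easy; rewrite <- Rmult_assoc, Rinv_r; lra. }
(* The ends of the arc and the [M] touching points give [N + 1] nodes at which [G] takes the values
   1 and -1 alternately. *)
set (nd := fun k => match k with 0%nat => - th | S j => if Nat.eqb j M then th else c j - c0 end).
assert (Hnd0 : nd 0%nat = - th) by easy.
assert (HndN : nd N = th) by (rewrite HM; unfold nd; rewrite Nat.eqb_refl; reflexivity).
assert (HndS : forall j, (j < M)%nat -> nd (S j) = c j - c0).
{ intros j Hj. unfold nd. now replace (Nat.eqb j M) with false by (symmetry; apply Nat.eqb_neq; lia). }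
assert (Hnd_inc : forall k, (k < N)%nat -> nd k < nd (S k)).
{ intros k Hk. destruct (Nat.eq_dec k M) as [-> | Hne].
  - rewrite <- HM, HndN. destruct M as [|M']; [rewrite Hnd0; lra |].
    rewrite HndS by lia. destruct (Hc M' ltac:(lia)) as [H _]. unfold c0. lra.
  - rewrite HndS by lia. destruct (Hc k ltac:(lia)) as [H _]. destruct k as [|k].
    + rewrite Hnd0. lra.
    + rewrite HndS by lia. destruct (Hc k ltac:(lia)) as [H' _]. lra. }
assert (Hnd_range : forall k, (k <= N)%nat -> - th <= nd k <= th).
{ intros k Hk. rewrite <- Hnd0 at 1. rewrite <- HndN.
  split; apply (monotone_le N nd); try lia; intros; apply Rlt_le, Hnd_inc; easy. }
assert (HGnd : forall k, (k <= N)%nat -> G (nd k) = (-1) ^ (N + k)).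
{ intros k Hk. rewrite EG. destruct k as [|j].
  (* The left end of the arc is [r M] minus a full turn, which costs the sign [(-1) ^ N]. *)
  - rewrite Hnd0. assert (A := sin_prod_period N tau (- th + c0)).
    replace (- th + c0 + 2 * PI) with (r M) in A by lra.
    assert (A' := sin_prod_cell_sign N B tau M (r M) Hs HMN ltac:(rewrite <- HM; lra)).
    rewrite Hr1, <- HM, A in A'. replace (N + N)%nat with (2 * N)%nat in A' by lia.
    rewrite pow_1_even in A'. rewrite Nat.add_0_r.
    assert (Hsq := pow_m1_sqr N).
    replace (B * sin_prod N tau (- th + c0))
      with (((-1) ^ N * (-1) ^ N) * (B * sin_prod N tau (- th + c0))) by (rewrite Hsq; ring).
    replace ((-1) ^ N * (-1) ^ N * (B * sin_prod N tau (- th + c0)))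
      with ((-1) ^ N * (B * ((-1) ^ N * sin_prod N tau (- th + c0)))) by ring.
    rewrite A'. ring.
  - destruct (Nat.eq_dec j M) as [-> | Hne].
    + rewrite <- HM, HndN. replace (th + c0) with (l M) by (unfold c0; ring).
      rewrite (sin_prod_cell_sign N B tau M) by (try easy; rewrite <- HM; lra).
      rewrite Hl1, <- HM. ring.
    + rewrite HndS by lia. destruct (Hc j ltac:(lia)) as [H1 H2].
      replace (c j - c0 + c0) with (c j) by ring.
      rewrite (sin_prod_cell_sign N B tau j) by (try easy; try lia; lra).
      rewrite H2. ring. }
assert (Hcn : forall k, - th <= cheb_node N s k <= th).
{ intros k. assert (A := cheb_node_range N s k). assert (E := cheb_node_sin N s k (conj Hs0 Hs1)).
  assert (B' := COS_bound (INR (N - k) * PI / INR N)).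
  assert (B1 : - s <= sin (cheb_node N s k / 2) <= s) by (rewrite E; nra).
  split; apply Rnot_lt_le; intros H.
  - assert (C := sin_increasing_1 (cheb_node N s k / 2) (- (th / 2)) ltac:(lra) ltac:(lra)
      ltac:(lra) ltac:(lra) ltac:(lra)). rewrite sin_neg, Hs_th in C. lra.
  - assert (C := sin_increasing_1 (th / 2) (cheb_node N s k / 2) ltac:(lra) ltac:(lra)
      ltac:(lra) ltac:(lra) ltac:(lra)). rewrite Hs_th in C. lra. }
(* Both functions alternate at [N + 1] nodes of the arc and are bounded by 1 on it, so the
   comparison applies in both directions. *)
assert (Heq : forall t, th < t < PI -> G t = T t).
{ intros t Ht. apply Rle_antisym.
  - apply (half_angle_comparison N T G (cheb_node N s)); auto.
    + intros k Hk. now apply cheb_node_increasing.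
    + specialize (Hcn 0%nat); lra.
    + specialize (Hcn N); lra.
    + intros k Hk. apply cheb_node_value; easy.
  - apply (half_angle_comparison N G T nd); auto.
    + rewrite Hnd0; lra.
    + now rewrite HndN. }
assert (HD : half_angle N (fun t => G t + -1 * T t))
  by (apply half_angle_plus; [easy | now apply half_angle_scal]).
destruct HD as [a Ha].
assert (Hcoef : forall k, (k <= N)%nat -> a k = 0).
{ apply (peval_zero_coef N a (tan (th / 2))). intros x Hx.
  assert (Hb := atan_bound x).
  assert (Hx' : th / 2 < atan x).
  { rewrite <- (atan_tan (th / 2)) by lra. now apply atan_increasing. }
  assert (A := Ha (2 * atan x)). cbv beta in A.
  replace (2 * atan x / 2) with (atan x) in A by field.
  assert (Hcos : 0 < cos (atan x)) by (apply cos_gt_0; lra).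
  rewrite Heq, heval_peval in A by lra. fold (tan (atan x)) in A. rewrite tan_atan in A.
  assert (A' : cos (atan x) ^ N * peval a N x = 0) by lra.
  apply Rmult_integral in A'. destruct A' as [A' | A']; [| easy].
  assert (0 < cos (atan x) ^ N) by now apply pow_lt. lra. }
assert (HGT : forall t, G t = T t).
{ intros t. assert (A := Ha t). cbv beta in A. rewrite heval_zero in A by easy. lra. }
assert (H2B : B * 2 <= (/ s) ^ N).
{ apply (top_amplitude_unique N (B * 2) ((/ s) ^ N) G HN).
  - apply top_amplitude_scal. now apply top_amplitude_sin_prod.
  - destruct (top_amplitude_cheb N (/ s) HN) as [psi [h [Hh H]]]. exists psi, h.
    split; [easy |]. intros t. rewrite HGT. exact (H t).
  - apply pow_le, Rlt_le, Rinv_0_lt_compat, Hs0. }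
assert (Hpow : 0 < s ^ N) by now apply pow_lt.
rewrite pow_inv in H2B. apply Rmult_le_compat_r with (r := s ^ N) in H2B; [| lra].
rewrite Rinv_l in H2B by lra. lra.
Qed.

(** The top amplitude [2 * B] cannot exceed the supremum. For [2 * B > 1] this rules out a
    configuration whose gaps are all empty. *)
Lemma modulus_bounded N B tau : 0 <= B -> (0 < N)%nat ->
  (forall t, modulus N B tau t <= 1) -> 2 * B <= 1.
Proof.
intros HB HN H. rewrite Rmult_comm.
apply (top_amplitude_le N (B * 2) (fun t => B * sin_prod N tau t)); [easy | |].
- apply top_amplitude_scal. now apply top_amplitude_sin_prod.
- intros t. rewrite Rabs_mult, (Rabs_pos_eq B) by easy. apply H.
Qed.

Lemma total_le N B tau l r : gaps N B tau l r -> total N l r <= 2 * PI.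
Proof.
intros [Htau H]. apply Rle_trans with (bigsum (fun i => tau (S i) - tau i) N).
- apply bigsum_le. intros i Hi. destruct (H i Hi). lra.
- right. replace (2 * PI) with (tau N - tau 0%nat) by lra. clear.
  induction N as [|N IH]; simpl; [ring | rewrite IH; ring].
Qed.

Lemma period_reduce (f : R -> R) c t : (forall u, f (u + 2 * PI) = f u) ->
  exists u, c <= u <= c + 2 * PI /\ f u = f t.
Proof.
intros Hf. assert (HPI := PI_RGT_0).
assert (Hnat : forall k u, f (u + 2 * PI * INR k) = f u).
{ induction k as [|k IH]; intros u; [f_equal; simpl; ring |].
  rewrite S_INR. replace (u + 2 * PI * (INR k + 1)) with ((u + 2 * PI * INR k) + 2 * PI) by ring.
  now rewrite Hf. }
assert (HZ : forall z u, f (u + 2 * PI * IZR z) = f u).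
{ intros [|p|p] u.
  - f_equal; ring.
  - rewrite <- (positive_nat_Z p), <- INR_IZR_INZ. apply Hnat.
  - rewrite <- (Hnat (Pos.to_nat p) (u + 2 * PI * IZR (Z.neg p))). f_equal.
    rewrite INR_IZR_INZ, positive_nat_Z, <- Pos2Z.opp_pos, opp_IZR. ring. }
destruct (archimed ((t - c) / (2 * PI))) as [H1 H2].
set (z := up ((t - c) / (2 * PI))) in *.
exists (t - 2 * PI * (IZR z - 1)). split.
- assert (E : t - c = (t - c) / (2 * PI) * (2 * PI)) by (field; lra).
  set (q := (t - c) / (2 * PI)) in *. nra.
- rewrite <- (HZ (1 - z)%Z t). f_equal. rewrite minus_IZR. ring.
Qed.

(** The minimal total is positive because [2 * B > 1], so [optimal_value] applies to a minimizer.
    The given total is at least as large, and [cos] decreases on [[0, PI / 2]]. *)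
Theorem gaps_bound N B tau l r : (0 < N)%nat -> 1 < 2 * B -> gaps N B tau l r ->
  2 * B * cos (total N l r / 4) ^ N <= 1.
Proof.
intros HN HB Hg.
destruct (optimal_exists N B tau l r HN Hg) as [tau' [l' [r' Hopt]]].
assert (Hle := proj2 Hopt _ _ _ Hg). assert (Hg' := proj1 Hopt).
assert (H0 := total_nonneg _ _ _ _ _ Hg'). assert (H2 := total_le _ _ _ _ _ Hg).
assert (HPI := PI_RGT_0).
assert (Hpos : 0 < total N l' r').
{ destruct H0 as [H0 | H0]; [easy | exfalso].
  assert (Hz : forall i, (i < N)%nat -> l' i = r' i).
  { intros i Hi. destruct (proj2 Hg' i Hi) as [H _]. apply Rle_antisym; [lra |].
    apply Rnot_lt_le. intros Hlt. apply (Rlt_irrefl (total N l' r')). rewrite <- H0 at 1.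
    rewrite <- (Rmult_0_r (INR N)), <- bigsum_const. apply bigsum_lt with (p := i); [easy | | lra].
    intros j Hj. destruct (proj2 Hg' j Hj). lra. }
  assert (2 * B <= 1); [| lra].
  apply (modulus_bounded N B tau'); [lra | easy |]. intros t.
  destruct (period_reduce (modulus N B tau') (tau' 0%nat) t) as [u [Hu <-]].
  { intros v. apply modulus_period. }
  destruct (cell_exists N tau' u) as [i [Hi1 Hi2]]; [rewrite (proj1 Hg'); easy | easy |].
  destruct (proj2 Hg' i Hi1) as [A1 [A2 [A3 A4]]]. assert (E := Hz i Hi1).
  destruct (Rle_dec u (l' i)); [apply A3 | apply A4]; lra. }
assert (Hv := optimal_value N B tau' l' r' ltac:(lra) HN Hopt Hpos).
eapply Rle_trans; [| exact Hv]. apply Rmult_le_compat_l; [lra |]. apply pow_incr. split.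
- apply cos_ge_0; lra.
- apply cos_decr_1; lra.
Qed.

(** * Measures of level sets *)

Lemma RInt_value (g : R -> R) (a b v : R) : is_RInt g a b v -> RInt g a b = v.
Proof. exact (is_RInt_unique (V := R_CompleteNormedModule) g a b v). Qed.

Lemma is_RInt_join (g : R -> R) (a b c v w : R) :
  is_RInt g a b v -> is_RInt g b c w -> is_RInt g a c (v + w).
Proof. exact (is_RInt_Chasles (V := R_NormedModule) g a b c v w). Qed.

Lemma is_RInt_constant (k a b : R) : is_RInt (fun _ => k) a b ((b - a) * k).
Proof. exact (is_RInt_const (V := R_NormedModule) a b k). Qed.

Lemma ex_RInt_sub (g : R -> R) (a b c d : R) : a <= b -> b <= c -> c <= d ->
  ex_RInt g a d -> ex_RInt g b c.
Proof.
intros H1 H2 H3 H. apply (ex_RInt_Chasles_1 (V := R_CompleteNormedModule) g b c d); [lra |].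
apply (ex_RInt_Chasles_2 (V := R_CompleteNormedModule) g a b d); [lra | easy].
Qed.

Lemma mu_is_RInt f m : mu_is f m -> is_RInt (ind_ge1 f) 0 (2 * PI) m.
Proof.
intros [pr <-]. rewrite <- RInt_Reals. apply (RInt_correct (V := R_CompleteNormedModule)).
now apply ex_RInt_Reals_1.
Qed.

Lemma RInt_mu_is f m : is_RInt (ind_ge1 f) 0 (2 * PI) m -> mu_is f m.
Proof.
intros H. assert (Hex : ex_RInt (ind_ge1 f) 0 (2 * PI)) by now exists m.
exists (ex_RInt_Reals_0 _ _ _ Hex). rewrite <- RInt_Reals. now apply RInt_value.
Qed.

Lemma ind_ge1_true f t : 1 <= Rabs (f t) -> ind_ge1 f t = 1.
Proof. intros H. unfold ind_ge1. now destruct (Rle_dec 1 (Rabs (f t))). Qed.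

Lemma ind_ge1_false f t : Rabs (f t) < 1 -> ind_ge1 f t = 0.
Proof. intros H. unfold ind_ge1. destruct (Rle_dec 1 (Rabs (f t))); lra. Qed.

Lemma ind_ge1_nonneg f t : 0 <= ind_ge1 f t.
Proof. unfold ind_ge1. destruct (Rle_dec 1 (Rabs (f t))); lra. Qed.

Lemma is_RInt_shift (g : R -> R) (p a b v : R) : (forall t, g (t + p) = g t) ->
  is_RInt g a b v -> is_RInt g (a + p) (b + p) v.
Proof.
intros Hp H. apply is_RInt_ext with (fun y => scal 1 (g (1 * y + - p))).
- intros x _. change (1 * g (1 * x + - p) = g x). rewrite <- Hp, Rmult_1_l. f_equal. ring.
- apply (is_RInt_comp_lin g 1 (- p)).
  replace (1 * (a + p) + - p) with a by ring. now replace (1 * (b + p) + - p) with b by ring.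
Qed.

Lemma is_RInt_period (g : R -> R) (p c v : R) : (forall t, g (t + p) = g t) -> 0 <= c <= p ->
  is_RInt g 0 p v -> is_RInt g c (c + p) v.
Proof.
intros Hp Hc H.
assert (Hex : ex_RInt g 0 p) by now exists v.
assert (E1 : ex_RInt g 0 c) by (apply ex_RInt_sub with 0 p; try easy; lra).
assert (E2 : ex_RInt g c p) by (apply ex_RInt_sub with 0 p; try easy; lra).
destruct E1 as [x Hx]. destruct E2 as [y Hy].
assert (Hv : v = x + y).
{ rewrite <- (RInt_value _ _ _ _ H). apply RInt_value. now apply is_RInt_join with c. }
rewrite Hv, (Rplus_comm x y). apply is_RInt_join with p; [easy |].
assert (A := is_RInt_shift g p 0 c x Hp Hx). now rewrite Rplus_0_l in A.
Qed.

Lemma is_RInt_periods (g : R -> R) (p c v : R) n : (forall t, g (t + p) = g t) ->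
  is_RInt g c (c + p) v -> is_RInt g c (c + INR n * p) (INR n * v).
Proof.
intros Hp H. induction n as [|n IH].
- simpl. rewrite Rmult_0_l, Rplus_0_r, Rmult_0_l. apply (is_RInt_point (V := R_NormedModule)).
- rewrite S_INR. replace ((INR n + 1) * v) with (INR n * v + v) by ring.
  apply is_RInt_join with (c + INR n * p); [easy |].
  replace (c + (INR n + 1) * p) with (c + p + INR n * p) by ring.
  apply is_RInt_shift; [| easy]. clear -Hp. induction n as [|n IH]; intros t.
  + simpl. f_equal; ring.
  + rewrite S_INR. replace (t + (INR n + 1) * p) with (t + INR n * p + p) by ring. now rewrite Hp.
Qed.

Lemma is_RInt_two_sided (g : R -> R) (a b c d : R) : a <= b <= c -> c <= d ->
  (forall t, a < t < b -> g t = 1) -> (forall t, b < t < c -> g t = 0) ->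
  (forall t, c < t < d -> g t = 1) -> is_RInt g a d ((b - a) + (d - c)).
Proof.
intros H1 H2 G1 G2 G3.
assert (I : forall x y k, x <= y -> (forall t, x < t < y -> g t = k) ->
  is_RInt g x y ((y - x) * k)).
{ intros x y k Hxy Hk. apply is_RInt_ext with (fun _ => k).
  - intros t Ht. rewrite Rmin_left, Rmax_right in Ht by easy. now rewrite Hk.
  - apply is_RInt_constant. }
replace (b - a + (d - c)) with ((b - a) * 1 + (c - b) * 0 + (d - c) * 1) by ring.
apply is_RInt_join with c; [apply is_RInt_join with b |]; apply I; auto; lra.
Qed.

Lemma RInt_ge_gaps (g : R -> R) N (tau l r : nat -> R) (v : R) : (forall t, 0 <= g t) ->
  (forall i, (i < N)%nat -> tau i <= l i <= r i /\ r i <= tau (S i) /\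
    forall t, l i < t < r i -> g t = 1) ->
  is_RInt g (tau 0%nat) (tau N) v -> total N l r <= v.
Proof.
intros Hg. revert v. induction N as [|N IH]; intros v H Hv.
- apply RInt_value in Hv. rewrite RInt_point in Hv. rewrite <- Hv. apply Rle_refl.
- assert (Hmono : tau 0%nat <= tau N).
  { apply (monotone_le N); [| lia]. intros i Hi. destruct (H i ltac:(lia)) as [? [? _]]. lra. }
  destruct (H N ltac:(lia)) as [H1 [H2 H3]].
  assert (Hex : ex_RInt g (tau 0%nat) (tau (S N))) by now exists v.
  assert (E1 : ex_RInt g (tau 0%nat) (tau N)) by (apply ex_RInt_sub with (tau 0%nat) (tau (S N)); try easy; lra).
  assert (E2 : ex_RInt g (tau N) (tau (S N))) by (apply ex_RInt_sub with (tau 0%nat) (tau (S N)); try easy; lra).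
  assert (E3 : ex_RInt g (tau N) (l N)) by (apply ex_RInt_sub with (tau 0%nat) (tau (S N)); try easy; lra).
  assert (E4 : ex_RInt g (l N) (tau (S N))) by (apply ex_RInt_sub with (tau 0%nat) (tau (S N)); try easy; lra).
  assert (E5 : ex_RInt g (l N) (r N)) by (apply ex_RInt_sub with (tau 0%nat) (tau (S N)); try easy; lra).
  assert (E6 : ex_RInt g (r N) (tau (S N))) by (apply ex_RInt_sub with (tau 0%nat) (tau (S N)); try easy; lra).
  assert (A := IH (RInt g (tau 0%nat) (tau N)) ltac:(intros; apply H; lia)
    (RInt_correct (V := R_CompleteNormedModule) _ _ _ E1)).
  assert (P3 : 0 <= RInt g (tau N) (l N)) by (apply RInt_ge_0; auto; lra).
  assert (P6 : 0 <= RInt g (r N) (tau (S N))) by (apply RInt_ge_0; auto; lra).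
  assert (P5 : RInt g (l N) (r N) = r N - l N).
  { rewrite (RInt_ext g (fun _ => 1)).
    - rewrite RInt_const. unfold scal; simpl. unfold mult; simpl. ring.
    - intros t Ht. rewrite Rmin_left, Rmax_right in Ht by lra. now apply H3. }
  apply RInt_value in Hv. rewrite <- Hv.
  rewrite <- (RInt_Chasles g _ (tau N) _ E1 E2), <- (RInt_Chasles g _ (l N) _ E3 E4),
    <- (RInt_Chasles g _ (r N) _ E5 E6). unfold plus; simpl. unfold total in *. simpl. lra.
Qed.

Lemma cos_level A : 1 <= A -> let k := acos (/ A) in
  0 <= k <= PI / 2 /\ cos k = / A.
Proof.
intros HA k. assert (Hi : 0 < / A <= 1).
{ split; [apply Rinv_0_lt_compat; lra |]. rewrite <- Rinv_1. apply Rinv_le_contravar; lra. }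
assert (Hc : cos k = / A) by (apply cos_acos; lra).
assert (Hb := acos_bound (/ A)). fold k in Hb. split; [| easy]. split; [easy |].
apply Rnot_lt_le. intros H. assert (HPI := PI_RGT_0).
assert (cos k < 0) by (apply cos_lt_0; lra). lra.
Qed.

Lemma is_RInt_cos_level A : 1 <= A ->
  is_RInt (ind_ge1 (fun u => A * cos u)) 0 (2 * PI) (4 * acos (/ A)).
Proof.
intros HA. destruct (cos_level A HA) as [Hk Hc]. set (k := acos (/ A)) in *.
assert (HPI := PI_RGT_0).
assert (HAk : A * cos k = 1) by (rewrite Hc; field; lra).
set (g := ind_ge1 (fun u => A * cos u)).
assert (Hp : forall t, g (t + PI) = g t).
{ intros t. unfold g, ind_ge1. rewrite neg_cos, <- Ropp_mult_distr_r, Rabs_Ropp. easy. }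
assert (H1 : is_RInt g 0 (0 + PI) (2 * k)).
{ rewrite Rplus_0_l. replace (2 * k) with ((k - 0) + (PI - (PI - k))) by ring.
  apply is_RInt_two_sided; try lra.
  - intros t Ht. apply ind_ge1_true.
    assert (cos k <= cos t) by (apply cos_decr_1; lra).
    eapply Rle_trans; [| apply Rle_abs]. nra.
  - intros t Ht. apply ind_ge1_false.
    assert (cos t < cos k) by (apply cos_decreasing_1; lra).
    assert (cos (PI - k) < cos t) by (apply cos_decreasing_1; lra).
    rewrite Rtrigo_facts.cos_pi_minus in H0. apply Rabs_def1; nra.
  - intros t Ht. apply ind_ge1_true.
    assert (cos t <= cos (PI - k)) by (apply cos_decr_1; lra).
    rewrite Rtrigo_facts.cos_pi_minus in H. rewrite <- Rabs_Ropp.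
    eapply Rle_trans; [| apply Rle_abs]. nra. }
assert (H2 := is_RInt_periods g PI 0 (2 * k) 2 Hp H1).
simpl in H2. replace (0 + (1 + 1) * PI) with (2 * PI) in H2 by ring.
now replace ((1 + 1) * (2 * k)) with (4 * k) in H2 by ring.
Qed.

Lemma mu_top_harmonic n a b : (0 < n)%nat -> 1 <= sqrt (a n * a n + b n * b n) ->
  mu_is (top_harmonic n a b) (4 * acos (/ sqrt (a n * a n + b n * b n))).
Proof.
intros Hn HA. set (A := sqrt (a n * a n + b n * b n)) in *.
assert (Hnz : a n * a n + b n * b n <> 0).
{ intros E. unfold A in HA. rewrite E, sqrt_0 in HA. lra. }
destruct (polar_coordinates _ _ Hnz) as [phi [Hphi [Ha Hb]]]. fold A in Ha, Hb.
assert (HPI := PI_RGT_0). assert (HN : 0 < INR n) by (apply lt_0_INR; lia).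
set (g := ind_ge1 (fun u => A * cos u)).
assert (Hp : forall t, g (t + 2 * PI) = g t).
{ intros t. unfold g, ind_ge1. now rewrite cos_plus, cos_2PI, sin_2PI, Rmult_1_r, Rmult_0_r, Rminus_0_r. }
assert (H := is_RInt_periods g _ _ _ n Hp
  (is_RInt_period g (2 * PI) (2 * PI - phi) _ Hp ltac:(lra) (is_RInt_cos_level A HA))).
apply RInt_mu_is.
apply is_RInt_ext with (fun y => scal (/ INR n) (scal (INR n) (g (INR n * y + (2 * PI - phi))))).
- intros t _.
  change (/ INR n * (INR n * g (INR n * t + (2 * PI - phi))) = ind_ge1 (top_harmonic n a b) t).
  rewrite <- Rmult_assoc, Rinv_l, Rmult_1_l by lra.
  unfold g, ind_ge1, top_harmonic.
  replace (INR n * t + (2 * PI - phi)) with ((INR n * t - phi) + 2 * PI) by ring.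
  rewrite cos_plus, cos_2PI, sin_2PI, Rmult_1_r, Rmult_0_r, Rminus_0_r, cos_minus.
  replace (a n * cos (INR n * t) + b n * sin (INR n * t))
    with (A * (cos (INR n * t) * cos phi + sin (INR n * t) * sin phi)); [easy |].
  rewrite Ha, Hb at 1. fold A. ring.
- replace (4 * acos (/ A)) with (scal (/ INR n) (INR n * (4 * acos (/ A))))
    by (unfold scal; simpl; unfold mult; simpl; field; lra).
  apply (is_RInt_scal (V := R_NormedModule)). apply (is_RInt_comp_lin g (INR n) (2 * PI - phi)).
  replace (INR n * 0 + (2 * PI - phi)) with (2 * PI - phi) by ring.
  now replace (INR n * (2 * PI) + (2 * PI - phi)) with (2 * PI - phi + INR n * (2 * PI)) by ring.
Qed.

Lemma mu_is_unique f m m' : mu_is f m -> mu_is f m' -> m = m'.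
Proof.
intros H H'. apply mu_is_RInt, RInt_value in H. apply mu_is_RInt, RInt_value in H'.
now rewrite <- H, <- H'.
Qed.

Lemma mu_is_nonneg f m : mu_is f m -> 0 <= m.
Proof.
intros H. apply mu_is_RInt in H. assert (HPI := PI_RGT_0).
assert (E := RInt_value _ _ _ _ H). rewrite <- E.
apply RInt_ge_0; [lra | now exists m | intros; apply ind_ge1_nonneg].
Qed.

Lemma mu_is_small f m : (forall t, Rabs (f t) < 1) -> mu_is f m -> m = 0.
Proof.
intros Hf H. apply mu_is_RInt in H. apply RInt_value in H. rewrite <- H.
rewrite (RInt_ext _ (fun _ => 0)).
- rewrite RInt_const. unfold scal; simpl. unfold mult; simpl. ring.
- intros t _. now apply ind_ge1_false.
Qed.

Lemma trigpoly_period n a b t : trigpoly n a b (t + 2 * PI) = trigpoly n a b t.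
Proof.
unfold trigpoly. f_equal. apply sum_eq. intros i _.
replace (INR (S i) * (t + 2 * PI)) with (INR (S i) * t + 2 * INR (S i) * PI) by ring.
now rewrite cos_period, sin_period.
Qed.

Lemma mu_trigpoly_bound n a b m : (0 < n)%nat -> 1 < sqrt (a n * a n + b n * b n) ->
  mu_is (trigpoly n a b) m -> exists g, 0 <= g <= m /\ g <= 2 * PI /\
    sqrt (a n * a n + b n * b n) * cos (g / 4) ^ (2 * n) <= 1.
Proof.
intros Hn HA Hm. set (A := sqrt (a n * a n + b n * b n)) in *.
assert (HA2 : A * A = a n ^ 2 + b n ^ 2).
{ unfold A. rewrite sqrt_sqrt; [ring |]. assert (H := Rle_0_sqr (a n)).
  assert (H' := Rle_0_sqr (b n)). unfold Rsqr in *. lra. }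
assert (Hab : a n <> 0 \/ b n <> 0).
{ destruct (Req_dec (a n) 0) as [Ea |]; [| now left].
  destruct (Req_dec (b n) 0) as [Eb |]; [| now right]. rewrite Ea, Eb in HA2. nra. }
destruct (@Factorization.trigpoly_ge_prod n a b Hn Hab)
  as [tau [Hrange Hmono Hge]].
set (N := (2 * n)%nat) in *.
set (sg := fun j => if Nat.eqb j N then tau 0%nat + 2 * PI else tau j).
assert (Hsg : forall j, (j < N)%nat -> sg j = tau j).
{ intros j Hj. unfold sg. now replace (Nat.eqb j N) with false by (symmetry; apply Nat.eqb_neq; lia). }
assert (HsgN : sg N = tau 0%nat + 2 * PI) by (unfold sg; now rewrite Nat.eqb_refl).
assert (HN : (0 < N)%nat) by (unfold N; lia).
assert (Hs : sorted_zeros N sg).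
{ split; [now rewrite HsgN, Hsg |]. intros i Hi. rewrite Hsg by easy.
  destruct (Nat.eq_dec (S i) N) as [E | E].
  - rewrite E, HsgN. destruct (Hrange i Hi). destruct (Hrange 0%nat HN). lra.
  - rewrite Hsg by lia. apply Hmono. lia. }
assert (Hmod : forall t, modulus N (A / 2) sg t <= Rabs (trigpoly n a b t)).
{ intros t. apply Rsqr_incr_0_var; [| apply Rabs_pos]. rewrite <- Rsqr_abs.
  unfold Rsqr. specialize (Hge t). rewrite <- HA2 in Hge.
  replace (trigpoly n a b t * trigpoly n a b t) with (trigpoly n a b t ^ 2) by ring.
  eapply Rle_trans; [| exact Hge]. right. unfold modulus, sin_prod.
  replace (A / 2 * Rabs (bigprod (fun j => 2 * sin ((t - sg j) / 2)) N) *
     (A / 2 * Rabs (bigprod (fun j => 2 * sin ((t - sg j) / 2)) N)))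
    with (A * A / 4 * (Rabs (bigprod (fun j => 2 * sin ((t - sg j) / 2)) N) *
      Rabs (bigprod (fun j => 2 * sin ((t - sg j) / 2)) N))) by field.
  f_equal. rewrite <- Rabs_mult, Rabs_pos_eq by apply Rle_0_sqr.
  rewrite <- bigprod_mult. apply bigprod_ext. intros j Hj. rewrite Hsg by easy. simpl. ring. }
destruct (finite_choice (fun i l r => sg i <= l <= r /\ r <= sg (S i) /\
   (forall t, sg i <= t <= l -> modulus N (A / 2) sg t <= 1) /\
   (forall t, r <= t <= sg (S i) -> modulus N (A / 2) sg t <= 1) /\
   forall t, l < t < r -> 1 <= modulus N (A / 2) sg t) N) as [l [r Hlr]].
{ intros i Hi. destruct (cell_gap N (A / 2) sg i ltac:(lra) Hs Hi) as [l [r [B1 [B2 [B3 [B4 B5]]]]]].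
  exists l, r. repeat split; try easy. intros t Ht.
  destruct B5 as [[B5 _] | [_ B5]]; [lra | apply B5; lra]. }
assert (Hg : gaps N (A / 2) sg l r).
{ split; [apply Hs |]. intros i Hi. destruct (Hlr i Hi) as [B1 [B2 [B3 [B4 _]]]]. easy. }
exists (total N l r). split; [split |].
- now apply total_nonneg with (A / 2) sg.
- apply RInt_ge_gaps with (ind_ge1 (trigpoly n a b)) sg.
  + intros; apply ind_ge1_nonneg.
  + intros i Hi. destruct (Hlr i Hi) as [B1 [B2 [_ [_ B5]]]]. split; [easy |]. split; [easy |].
    intros t Ht. apply ind_ge1_true. eapply Rle_trans; [now apply B5 | apply Hmod].
  + rewrite HsgN. rewrite (Hsg 0%nat) by easy. apply is_RInt_period.
    * intros t. unfold ind_ge1. now rewrite trigpoly_period.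
    * destruct (Hrange 0%nat HN). lra.
    * now apply mu_is_RInt.
- split; [now apply total_le with (A / 2) sg |].
  assert (B := gaps_bound N (A / 2) sg l r HN ltac:(lra) Hg). lra.
Qed.

Lemma tan_scale c x : 1 <= c -> 0 <= x -> c * x < PI / 2 -> c * tan x <= tan (c * x).
Proof.
intros Hc Hx Hcx. destruct Hx as [Hx | <-].
2:{ rewrite !Rmult_0_r, tan_0. lra. }
assert (Hcos : forall y, 0 <= y <= x -> 0 < cos y /\ 0 < cos (c * y)).
{ intros y Hy. split; apply cos_gt_0; nra. }
set (f := fun y => tan (c * y) - c * tan y).
destruct (MVT_gen f 0 x (fun y => c * (tan (c * y) ^ 2 + 1) - c * (tan y ^ 2 + 1))) as [y [Hy1 Hy2]].
- intros y Hy. rewrite Rmin_left, Rmax_right in Hy by lra.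
  destruct (Hcos y ltac:(lra)) as [C1 C2]. unfold f.
  apply (is_derive_minus (fun y => tan (c * y)) (fun y => c * tan y)).
  + apply (is_derive_comp tan (fun y => c * y)); [apply is_derive_tan; lra |].
    auto_derive; [easy | ring].
  + apply (is_derive_scal tan). apply is_derive_tan. lra.
- intros y Hy. rewrite Rmin_left, Rmax_right in Hy by lra.
  destruct (Hcos y ltac:(lra)) as [C1 C2]. unfold f.
  apply continuity_pt_minus.
  + apply (continuity_pt_comp (fun y => c * y) tan).
    * apply continuity_pt_mult; [apply continuity_pt_const; now intros u v |].
      apply derivable_continuous_pt, derivable_pt_id.
    * apply continuity_pt_filterlim, (continuous_tan (c * y)). lra.
  + apply continuity_pt_mult; [apply continuity_pt_const; now intros u v |].
    apply continuity_pt_filterlim, (continuous_tan y). lra.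
- rewrite Rmin_left, Rmax_right in Hy1 by lra. destruct (Hcos y ltac:(lra)) as [C1 C2].
  assert (T0 : 0 <= tan y).
  { apply Rdiv_le_0_compat; [apply sin_ge_0; nra | easy]. }
  assert (T1 : tan y <= tan (c * y)).
  { destruct (Req_dec y (c * y)) as [E | E]; [rewrite <- E; lra |].
    apply Rlt_le, tan_increasing; nra. }
  unfold f in Hy2. rewrite !Rmult_0_r, tan_0, !Rmult_0_r in Hy2.
  assert (0 <= c * (tan (c * y) ^ 2 + 1) - c * (tan y ^ 2 + 1)); [| nra].
  replace (c * (tan (c * y) ^ 2 + 1) - c * (tan y ^ 2 + 1))
    with (c * ((tan (c * y) - tan y) * (tan (c * y) + tan y))) by ring.
  apply Rmult_le_pos; [lra |]. apply Rmult_le_pos; lra.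
Qed.

Lemma cos_scale_le_pow k c x : (0 < k)%nat -> 0 <= c -> c * c = INR k -> 0 <= x -> c * x < PI / 2 ->
  cos (c * x) <= cos x ^ k.
Proof.
intros Hk Hc0 Hc Hx Hcx.
assert (Hk1 : 1 <= INR k) by (apply (le_INR 1); lia).
assert (Hc1 : 1 <= c) by nra.
assert (Hcos : forall y, 0 <= y <= x -> 0 < cos y /\ 0 < cos (c * y)).
{ intros y Hy. split; apply cos_gt_0; nra. }
set (f := fun y => INR k * ln (cos y) - ln (cos (c * y))).
set (df := fun y => c * tan (c * y) - INR k * tan y).
assert (Hd : forall y, 0 <= y <= x -> is_derive f y (df y)).
{ intros y Hy. destruct (Hcos y Hy). unfold f, df, tan. auto_derive; [easy |]. field. lra. }
destruct (MVT_gen f 0 x df) as [y [Hy1 Hy2]].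
- intros y Hy. rewrite Rmin_left, Rmax_right in Hy by lra. apply Hd; lra.
- intros y Hy. rewrite Rmin_left, Rmax_right in Hy by lra.
  apply derivable_continuous_pt. exists (df y). apply is_derive_Reals, Hd; lra.
- rewrite Rmin_left, Rmax_right in Hy1 by lra.
  assert (A := tan_scale c y Hc1 ltac:(lra) ltac:(nra)).
  assert (Hdf : 0 <= df y) by (unfold df; rewrite <- Hc; nra).
  assert (F0 : f 0 = 0) by (unfold f; rewrite Rmult_0_r, cos_0, ln_1; ring).
  assert (F1 : 0 <= f x) by nra. unfold f in F1.
  destruct (Hcos x ltac:(lra)) as [C1 C2].
  rewrite <- (exp_ln (cos (c * x))), <- (exp_ln (cos x ^ k)) by (try easy; now apply pow_lt).
  rewrite ln_pow by easy. destruct (Req_dec (ln (cos (c * x))) (INR k * ln (cos x))) as [-> | Hne]; [lra |].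
  apply Rlt_le, exp_increasing. lra.
Qed.

Lemma admissible_sqrt n : (0 < n)%nat -> admissible n (sqrt (2 * INR n)).
Proof.
intros Hn a b m1 m2 H1 H2.
assert (HN : 0 < INR n) by (apply lt_0_INR; lia).
set (A := sqrt (a n * a n + b n * b n)). set (c := sqrt (2 * INR n)).
assert (Hc : 0 <= c) by apply sqrt_pos.
assert (Hcc : c * c = INR (2 * n)) by (unfold c; rewrite sqrt_sqrt, mult_INR by lra; simpl; ring).
assert (Hm2 := mu_is_nonneg _ _ H2). assert (HPI := PI_RGT_0).
destruct (Rlt_le_dec A 1) as [HA | HA].
{ rewrite (mu_is_small (top_harmonic n a b) m1); [nra | | easy].
  intros t. apply Rle_lt_trans with A; [| easy]. unfold top_harmonic.
  rewrite <- (Rabs_pos_eq A) by apply sqrt_pos. apply Rsqr_le_abs_0. unfold A.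
  rewrite Rsqr_sqrt by (assert (P := Rle_0_sqr (a n)); assert (P' := Rle_0_sqr (b n)); unfold Rsqr in *; lra).
  assert (S2 := sin2_cos2 (INR n * t)). unfold Rsqr in *.
  assert (Q := Rle_0_sqr (a n * sin (INR n * t) - b n * cos (INR n * t))). unfold Rsqr in Q.
  replace (a n * a n + b n * b n) with ((a n * a n + b n * b n) *
    (sin (INR n * t) * sin (INR n * t) + cos (INR n * t) * cos (INR n * t))) by (rewrite S2; ring).
  lra. }
assert (E1 := mu_is_unique _ _ _ H1 (mu_top_harmonic n a b Hn HA)). fold A in E1.
destruct (cos_level A HA) as [Hk Hck]. set (k := acos (/ A)) in *.
destruct (Req_dec A 1) as [EA | EA].
{ replace k with 0 in E1 by (unfold k; rewrite EA, Rinv_1, acos_1; easy). nra. }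
destruct (mu_trigpoly_bound n a b m2 Hn ltac:(fold A; lra) H2) as [g [Hg1 [Hg2 Hg3]]].
fold A in Hg3.
assert (Hkg : k <= c * (g / 4)).
{ apply Rnot_lt_le. intros Hlt.
  assert (B := cos_scale_le_pow (2 * n) c (g / 4) ltac:(lia) Hc Hcc ltac:(lra) ltac:(lra)).
  assert (D : cos k < cos (c * (g / 4))) by (apply cos_decreasing_1; nra).
  rewrite Hck in D. assert (A * / A = 1) by (apply Rinv_r; lra). nra. }
nra.
Qed.

(** * Sharpness *)

Inductive cosine_span (n : nat) : (R -> R) -> Prop :=
| cs_zero f : (forall t, f t = 0) -> cosine_span n f
| cs_add f g h : cosine_span n f -> cosine_span n g -> (forall t, h t = f t + g t) -> cosine_span n h
| cs_cos m k f : (m <= n)%nat -> (forall t, f t = k * cos (INR m * t)) -> cosine_span n f.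

Lemma cosine_span_scal n f k : cosine_span n f -> cosine_span n (fun t => k * f t).
Proof.
intros Hf. induction Hf as [f H | f g h Hf IHf Hg IHg H | m c f Hm H].
- apply cs_zero. intros t; rewrite H; ring.
- eapply cs_add; [exact IHf | exact IHg |]. intros t; cbv beta; rewrite H; ring.
- apply (cs_cos n m (k * c)); [easy |]. intros t; rewrite H; ring.
Qed.

Lemma cosine_span_S n f : cosine_span n f -> cosine_span (S n) f.
Proof.
intros Hf. induction Hf as [f H | f g h Hf IHf Hg IHg H | m c f Hm H].
- now apply cs_zero.
- now apply (cs_add _ f g).
- apply (cs_cos _ m c); [lia | easy].
Qed.

Lemma two_cos_mult m t : (0 < m)%nat ->
  2 * cos t * cos (INR m * t) = cos (INR (S m) * t) + cos (INR (m - 1) * t).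
Proof.
intros Hm. rewrite minus_INR, S_INR by lia. simpl (INR 1).
replace ((INR m + 1) * t) with (INR m * t + t) by ring.
replace ((INR m - 1) * t) with (INR m * t - t) by ring.
rewrite cos_plus, cos_minus. ring.
Qed.

Lemma cosine_span_mult n f : cosine_span n f -> cosine_span (S n) (fun t => 2 * cos t * f t).
Proof.
intros Hf. induction Hf as [f H | f g h Hf IHf Hg IHg H | m c f Hm H].
- apply cs_zero. intros t; rewrite H; ring.
- eapply cs_add; [exact IHf | exact IHg |]. intros t; cbv beta; rewrite H; ring.
- destruct m as [|m].
  + apply (cs_cos _ 1 (2 * c)); [lia |]. intros t. rewrite H. simpl.
    rewrite Rmult_0_l, cos_0. replace (1 * t) with t by ring. ring.
  + eapply cs_add.
    * apply (cs_cos (S n) (S (S m)) c _); [lia | reflexivity].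
    * apply (cs_cos (S n) m c _); [lia | reflexivity].
    * intros t. cbv beta. rewrite H.
      replace (2 * cos t * (c * cos (INR (S m) * t))) with (c * (2 * cos t * cos (INR (S m) * t))) by ring.
      rewrite two_cos_mult by lia. replace (S m - 1)%nat with m by lia. ring.
Qed.

Lemma cosine_span_coef n f : cosine_span n f ->
  exists d, forall t, f t = bigsum (fun k => d k * cos (INR k * t)) (S n).
Proof.
intros Hf. induction Hf as [f H | f g h Hf IHf Hg IHg H | m c f Hm H].
- exists (fun _ => 0). intros t. rewrite H. symmetry.
  rewrite (bigsum_ext _ (fun _ => 0)), bigsum_const; [| intros]; ring.
- destruct IHf as [d Hd]. destruct IHg as [e He]. exists (fun k => d k + e k). intros t.
  rewrite H, Hd, He, <- bigsum_plus. apply bigsum_ext. intros; ring.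
- exists (fun k => if Nat.eqb k m then c else 0). intros t. rewrite H. clear H f.
  assert (A : forall N, bigsum (fun k => (if Nat.eqb k m then c else 0) * cos (INR k * t)) N
    = if Nat.ltb m N then c * cos (INR m * t) else 0).
  { induction N as [|N IH]; [easy |]. simpl bigsum. rewrite IH.
    destruct (lt_eq_lt_dec m N) as [[H | ->] | H].
    - replace (Nat.ltb m N) with true by (symmetry; apply Nat.ltb_lt; lia).
      replace (Nat.ltb m (S N)) with true by (symmetry; apply Nat.ltb_lt; lia).
      replace (Nat.eqb N m) with false by (symmetry; apply Nat.eqb_neq; lia). ring.
    - rewrite Nat.ltb_irrefl, Nat.eqb_refl.
      replace (Nat.ltb N (S N)) with true by (symmetry; apply Nat.ltb_lt; lia). ring.
    - replace (Nat.ltb m N) with false by (symmetry; apply Nat.ltb_ge; lia).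
      replace (Nat.ltb m (S N)) with false by (symmetry; apply Nat.ltb_ge; lia).
      replace (Nat.eqb N m) with false by (symmetry; apply Nat.eqb_neq; lia). ring. }
  rewrite A. now replace (Nat.ltb m (S n)) with true by (symmetry; apply Nat.ltb_lt; lia).
Qed.

Lemma cheb_cosine_span al n : cosine_span n (fun t => cheb n (al * cos t + (al - 1))).
Proof.
induction n as [| | n IH1 IH2] using nat_ind2.
- apply (cs_cos 0 0 1); [lia |]. intros t. simpl. rewrite Rmult_0_l, cos_0. ring.
- eapply cs_add.
  + apply (cs_cos 1 1 al _); [lia | reflexivity].
  + apply (cs_cos 1 0 (al - 1) _); [lia | reflexivity].
  + intros t. simpl. rewrite Rmult_0_l, cos_0. replace (1 * t) with t by ring. ring.
- eapply cs_add.
  + exact (cosine_span_scal _ _ al (cosine_span_mult _ _ IH2)).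
  + eapply cs_add.
    * exact (cosine_span_scal _ _ (2 * (al - 1)) (cosine_span_S _ _ IH2)).
    * exact (cosine_span_scal _ _ (-1) (cosine_span_S _ _ (cosine_span_S _ _ IH1))).
    * reflexivity.
  + intros t. cbv beta. rewrite cheb_SS. ring.
Qed.

Lemma cheb_cosine_top al n : exists g, cosine_span n g /\
  forall t, cheb (S n) (al * cos t + (al - 1)) = al ^ S n * cos (INR (S n) * t) + g t.
Proof.
induction n as [|n [g [Hg H]]].
- exists (fun _ => al - 1). split.
  + apply (cs_cos 0 0 (al - 1)); [lia |]. intros t. simpl. rewrite Rmult_0_l, cos_0. ring.
  + intros t. simpl. replace (1 * t) with t by ring. ring.
- exists (fun t => al ^ S (S n) * cos (INR n * t) + (al * (2 * cos t * g t) +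
    (2 * (al - 1) * cheb (S n) (al * cos t + (al - 1)) +
     -1 * cheb n (al * cos t + (al - 1))))). split.
  + eapply cs_add; [apply (cs_cos (S n) n (al ^ S (S n)) _); [lia | reflexivity] | | reflexivity].
    eapply cs_add; [exact (cosine_span_scal _ _ al (cosine_span_mult _ _ Hg)) | | reflexivity].
    eapply cs_add; [| | reflexivity].
    * exact (cosine_span_scal _ _ (2 * (al - 1)) (cheb_cosine_span al (S n))).
    * exact (cosine_span_scal _ _ (-1) (cosine_span_S _ _ (cheb_cosine_span al n))).
  + intros t. rewrite cheb_SS.
    replace (2 * (al * cos t + (al - 1)) * cheb (S n) (al * cos t + (al - 1)))
      with (al * (2 * cos t * cheb (S n) (al * cos t + (al - 1)))
        + 2 * (al - 1) * cheb (S n) (al * cos t + (al - 1))) by ring.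
    rewrite H at 1.
    replace (2 * cos t * (al ^ S n * cos (INR (S n) * t) + g t))
      with (al ^ S n * (2 * cos t * cos (INR (S n) * t)) + 2 * cos t * g t) by ring.
    rewrite two_cos_mult by lia. replace (S n - 1)%nat with n by lia.
    change (al ^ S (S n)) with (al * al ^ S n). ring.
Qed.

Lemma cosine_trigpoly n c g : cosine_span n g -> exists a, a (S n) = c /\
  forall t, trigpoly (S n) a (fun _ => 0) t = c * cos (INR (S n) * t) + g t.
Proof.
intros Hg. destruct (cosine_span_coef n g Hg) as [d Hd].
exists (fun k => if Nat.eqb k 0 then 2 * d 0%nat else if Nat.eqb k (S n) then c else d k).
split; [simpl; now rewrite Nat.eqb_refl |].
intros t. rewrite Hd, bigsum_recl. unfold trigpoly. simpl Nat.pred.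
assert (E : forall F m, sum_f_R0 F m = bigsum F (S m)).
{ intros F m. induction m as [|m IH]; simpl; [ring |]. now rewrite IH. }
rewrite E. set (F := fun k => _). change (bigsum F (S n)) with (bigsum F n + F n).
assert (Fn : F n = c * cos (INR (S n) * t)).
{ unfold F. replace (Nat.eqb (S n) 0) with false by easy. rewrite Nat.eqb_refl. ring. }
assert (Fi : bigsum F n = bigsum (fun k => d (S k) * cos (INR (S k) * t)) n).
{ apply bigsum_ext. intros i Hi. unfold F. replace (Nat.eqb (S i) 0) with false by easy.
  replace (Nat.eqb (S i) (S n)) with false by (symmetry; apply Nat.eqb_neq; lia). ring. }
rewrite Fn, Fi. replace (INR 0 * t) with 0 by (simpl; ring). rewrite cos_0, Nat.eqb_refl. field.
Qed.

Lemma cheb_ge1 n y : 1 <= y -> 1 <= cheb n y /\ cheb n y <= cheb (S n) y.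
Proof.
intros Hy. induction n as [|n [IH1 IH2]]; [simpl; lra |].
split; [lra |]. rewrite cheb_SS. nra.
Qed.

Lemma cheb_increasing n y z : 1 <= y < z -> cheb n y <= cheb n z /\
  cheb (S n) y - cheb n y < cheb (S n) z - cheb n z.
Proof.
intros Hyz. induction n as [|n [IH1 IH2]]; [simpl; lra |].
split; [lra |]. rewrite !cheb_SS.
destruct (cheb_ge1 (S n) y ltac:(lra)) as [A _]. destruct (cheb_ge1 (S n) z ltac:(lra)) as [A' _].
assert (cheb (S n) y <= cheb (S n) z) by lra. nra.
Qed.

Lemma cheb_lt n y z : 1 <= y < z -> cheb (S n) y < cheb (S n) z.
Proof. intros H. destruct (cheb_increasing n y z H). lra. Qed.

Lemma cheb_at_1 n : cheb n 1 = 1.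
Proof. rewrite <- cos_0. rewrite cheb_cos, Rmult_0_r. easy. Qed.

Lemma cheb_continuous n x : continuity_pt (cheb n) x.
Proof.
induction n as [| | n IH1 IH2] using nat_ind2.
- apply continuity_pt_const. now intros u v.
- apply derivable_continuous_pt, derivable_pt_id.
- apply (continuity_pt_minus (fun y => 2 * y * cheb (S n) y) (cheb n)); [| easy].
  apply (continuity_pt_mult (fun y => 2 * y) (cheb (S n))); [| easy].
  apply (continuity_pt_mult (fun _ => 2) (fun y => y)); [| apply derivable_continuous_pt, derivable_pt_id].
  apply continuity_pt_const. now intros u v.
Qed.

(* Dividing the Chebyshev polynomial by its value at [1 + eta] instead of [1] removes the
   isolated points where the modulus equals [1]. *)
Lemma mu_cheb n al eta q : 1 < al -> 0 < eta -> al * q = 2 + eta - al -> q <= 1 -> -1 <= q ->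
  is_RInt (ind_ge1 (fun t => cheb (S n) (al * cos t + (al - 1)) / cheb (S n) (1 + eta)))
    0 (2 * PI) (2 * acos q).
Proof.
intros Hal Heta Hq Hq1 Hq0.
assert (HPI := PI_RGT_0). assert (HY := acos_bound q).
assert (HcY : cos (acos q) = q) by (apply cos_acos; lra).
set (Y := acos q) in *.
destruct (cheb_ge1 (S n) (1 + eta) ltac:(lra)) as [HC _].
set (C := cheb (S n) (1 + eta)) in *.
assert (Hbig : forall t, q <= cos t -> ind_ge1 (fun t => cheb (S n) (al * cos t + (al - 1)) / C) t = 1).
{ intros t Ht. apply ind_ge1_true.
  assert (A : C <= cheb (S n) (al * cos t + (al - 1))).
  { unfold C. destruct (Req_dec (1 + eta) (al * cos t + (al - 1))) as [<- | Hne]; [lra |].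
    apply Rlt_le, cheb_lt. nra. }
  eapply Rle_trans; [| apply Rle_abs]. apply Rmult_le_reg_r with C; [lra |].
  unfold Rdiv. rewrite Rmult_assoc, Rinv_l; lra. }
assert (Hsmall : forall t, cos t < q -> ind_ge1 (fun t => cheb (S n) (al * cos t + (al - 1)) / C) t = 0).
{ intros t Ht. apply ind_ge1_false.
  assert (Hlow : -1 <= al * cos t + (al - 1)) by (assert (B := COS_bound t); nra).
  assert (A : Rabs (cheb (S n) (al * cos t + (al - 1))) < C).
  { destruct (Rle_dec (al * cos t + (al - 1)) 1) as [H | H].
    - apply Rle_lt_trans with 1; [apply cheb_abs_le; lra |].
      assert (K := cheb_lt n 1 (1 + eta) ltac:(lra)). rewrite cheb_at_1 in K. exact K.
    - rewrite Rabs_pos_eq.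
      + apply cheb_lt. nra.
      + destruct (cheb_ge1 (S n) (al * cos t + (al - 1)) ltac:(lra)). lra. }
  unfold Rdiv. rewrite Rabs_mult, (Rabs_pos_eq (/ C)) by (apply Rlt_le, Rinv_0_lt_compat; lra).
  apply Rmult_lt_reg_r with C; [lra |]. rewrite Rmult_assoc, Rinv_l; lra. }
replace (2 * Y) with ((Y - 0) + (2 * PI - (2 * PI - Y))) by ring.
apply is_RInt_two_sided; try lra.
- intros t Ht. apply Hbig. rewrite <- HcY. apply cos_decr_1; lra.
- intros t Ht. apply Hsmall. rewrite <- HcY.
  destruct (Rle_dec t PI) as [H | H]; [apply cos_decreasing_1; lra |].
  replace (cos t) with (cos (2 * PI - t)) by (rewrite cos_minus, cos_2PI, sin_2PI; ring).
  apply cos_decreasing_1; lra.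
- intros t Ht. apply Hbig. rewrite <- HcY.
  replace (cos t) with (cos (2 * PI - t)) by (rewrite cos_minus, cos_2PI, sin_2PI; ring).
  apply cos_decr_1; lra.
Qed.

Lemma admissible_acos n beta al eta q : admissible (S n) beta -> 1 < al -> 0 < eta ->
  al * q = 2 + eta - al -> q <= 1 -> -1 <= q -> cheb (S n) (1 + eta) <= al ^ S n ->
  2 * acos (cheb (S n) (1 + eta) / al ^ S n) <= beta * acos q.
Proof.
intros Hadm Hal Heta Hq Hq1 Hq0 Hle.
destruct (cheb_ge1 (S n) (1 + eta) ltac:(lra)) as [HC _]. set (C := cheb (S n) (1 + eta)) in *.
destruct (cheb_cosine_top al n) as [g [Hg Hcheb]].
destruct (cosine_trigpoly n (/ C * al ^ S n) (fun t => / C * g t) (cosine_span_scal _ _ (/ C) Hg))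
  as [a [Ha Htrig]].
assert (Hpow : 0 < al ^ S n) by (apply pow_lt; lra).
assert (HA : sqrt (a (S n) * a (S n) + 0 * 0) = / C * al ^ S n).
{ rewrite Ha, Rmult_0_l, Rplus_0_r. apply sqrt_square. apply Rmult_le_pos; [| lra].
  apply Rlt_le, Rinv_0_lt_compat; lra. }
assert (HA1 : 1 <= / C * al ^ S n).
{ apply Rmult_le_reg_l with C; [lra |]. rewrite <- Rmult_assoc, Rinv_r; lra. }
assert (M1 := mu_top_harmonic (S n) a (fun _ => 0) ltac:(lia) ltac:(cbv beta; rewrite HA; lra)).
cbv beta in M1. rewrite HA in M1.
assert (M2 : mu_is (trigpoly (S n) a (fun _ => 0)) (2 * acos q)).
{ apply RInt_mu_is. eapply is_RInt_ext; [| apply (mu_cheb n al eta q); easy].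
  intros t _. unfold ind_ge1. rewrite Htrig. fold C.
  replace (cheb (S n) (al * cos t + (al - 1)) / C)
    with (/ C * al ^ S n * cos (INR (S n) * t) + / C * g t); [easy |].
  rewrite Hcheb. unfold Rdiv. ring. }
assert (H := Hadm _ _ _ _ M1 M2).
replace (/ (/ C * al ^ S n)) with (C / al ^ S n) in H by (field; lra). lra.
Qed.

Lemma admissible_cos_le n beta x : admissible (S n) beta -> 0 < x < PI / 2 -> 0 <= beta * x <= PI ->
  cos (beta * x) <= cos x ^ (2 * S n).
Proof.
intros Hadm Hx Hbx. assert (HPI := PI_RGT_0).
assert (Hcx : 0 < cos x < 1).
{ split; [apply cos_gt_0; lra |]. rewrite <- cos_0. apply cos_decreasing_1; lra. }
set (al := / (cos x * cos x)).
assert (Hal : 1 < al).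
{ unfold al. rewrite <- Rinv_1. apply Rinv_lt_contravar; nra. }
assert (Hal2 : al * (cos x * cos x) = 1) by (unfold al; field; lra).
assert (Hpow : al ^ S n * cos x ^ (2 * S n) = 1).
{ rewrite pow_mult, <- Rpow_mult_distr. replace (al * cos x ^ 2) with 1 by (rewrite <- Hal2; ring).
  apply pow1. }
assert (Halp : 0 < al ^ S n) by (apply pow_lt; lra).
apply Rnot_lt_le. intros Hlt.
assert (Hlim : 1 < cos (beta * x) * al ^ S n) by (rewrite <- Hpow; nra).
destruct (continuity_pt_lt (cheb (S n)) 1 (cos (beta * x) * al ^ S n)) as [d [Hd Hn]];
  [apply cheb_continuous | now rewrite cheb_at_1 |].
set (eta := Rmin (d / 2) (al - 1)).
assert (E1 : eta <= d / 2) by apply Rmin_l. assert (E2 : eta <= al - 1) by apply Rmin_r.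
assert (E0 : 0 < eta) by (apply Rmin_glb_lt; lra).
assert (HC : cheb (S n) (1 + eta) < cos (beta * x) * al ^ S n).
{ apply Hn. replace (1 + eta - 1) with eta by ring. rewrite Rabs_pos_eq; lra. }
assert (Hcb := COS_bound (beta * x)).
set (q := (2 + eta - al) / al).
assert (Hq : al * q = 2 + eta - al) by (unfold q; field; lra).
assert (Hq1 : q <= 1) by nra.
assert (Hq2 : cos (2 * x) <= q).
{ rewrite cos_2a_cos. apply Rmult_le_reg_l with al; [lra |]. rewrite Hq. nra. }
assert (Hcb2 := COS_bound (2 * x)).
assert (HY : acos q <= 2 * x).
{ rewrite <- (acos_cos (2 * x)) by lra. apply Rnot_lt_le. intros H.
  assert (B1 := acos_bound q). assert (B2 := acos_bound (cos (2 * x))).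
  assert (A := cos_decreasing_1 (acos (cos (2 * x))) (acos q) ltac:(lra) ltac:(lra) ltac:(lra) ltac:(lra) H).
  rewrite !cos_acos in A by lra. lra. }
assert (Hmain := admissible_acos n beta al eta q Hadm Hal E0 Hq Hq1 ltac:(lra) ltac:(nra)).
assert (Hb : 0 <= beta) by nra.
assert (Hfin : acos (cheb (S n) (1 + eta) / al ^ S n) <= beta * x) by nra.
destruct (cheb_ge1 (S n) (1 + eta) ltac:(lra)) as [HC1 _].
assert (Hr : 0 < cheb (S n) (1 + eta) / al ^ S n < cos (beta * x)).
{ split; [apply Rdiv_lt_0_compat; lra |]. apply Rmult_lt_reg_r with (al ^ S n); [easy |].
  unfold Rdiv. rewrite Rmult_assoc, Rinv_l; lra. }
assert (B := acos_bound (cheb (S n) (1 + eta) / al ^ S n)).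
assert (A := cos_decr_1 _ _ (proj1 B) (proj2 B) (proj1 Hbx) (proj2 Hbx) Hfin).
rewrite cos_acos in A by lra. lra.
Qed.

Lemma one_minus_pow_ge n z : 0 <= z <= 1 -> INR n * z ^ n * (1 - z) <= 1 - z ^ n.
Proof.
intros Hz. induction n as [|n IH]; [simpl; lra |].
rewrite S_INR. simpl pow.
assert (H0 : 0 <= z ^ n <= 1) by (split; [apply pow_le; lra | rewrite <- (pow1 n); apply pow_incr; lra]).
assert (Hn := pos_INR n).
assert (A : INR n * z ^ n * (1 - z) * z <= (1 - z ^ n) * z) by (apply Rmult_le_compat_r; lra).
assert (B : 0 <= (1 - z) * (1 - z * z ^ n)) by (apply Rmult_le_pos; nra).
nra.
Qed.

Lemma admissible_nonneg n beta : admissible (S n) beta -> 0 <= beta.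
Proof.
intros Hadm. apply Rnot_lt_le. intros Hneg.
assert (Hf : forall t, trigpoly (S n) (fun k => if Nat.eqb k 0 then 2 else 0) (fun _ => 0) t = 1).
{ intros t. unfold trigpoly. rewrite (sum_eq _ (fun _ => 0)); [| intros; simpl; ring].
  rewrite sum_cte. simpl. field. }
assert (M1 : mu_is (top_harmonic (S n) (fun k => if Nat.eqb k 0 then 2 else 0) (fun _ => 0)) 0).
{ apply RInt_mu_is. apply is_RInt_ext with (fun _ => 0).
  - intros t _. symmetry. apply ind_ge1_false. unfold top_harmonic. simpl Nat.eqb. cbv iota.
    rewrite !Rmult_0_l, Rplus_0_l, Rabs_R0. lra.
  - assert (A := is_RInt_constant 0 0 (2 * PI)). now rewrite Rmult_0_r in A. }
assert (M2 : mu_is (trigpoly (S n) (fun k => if Nat.eqb k 0 then 2 else 0) (fun _ => 0)) (2 * PI)).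
{ apply RInt_mu_is. apply is_RInt_ext with (fun _ => 1).
  - intros t _. symmetry. apply ind_ge1_true. rewrite Hf, Rabs_R1. lra.
  - assert (A := is_RInt_constant 1 0 (2 * PI)). now rewrite Rmult_1_r, Rminus_0_r in A. }
assert (H := Hadm _ _ _ _ M1 M2). assert (HPI := PI_RGT_0). nra.
Qed.

Lemma admissible_ge n beta : admissible (S n) beta -> sqrt (2 * INR (S n)) <= beta.
Proof.
intros Hadm. assert (Hb := admissible_nonneg n beta Hadm). assert (HPI := PI_RGT_0).
assert (HN : 0 < INR (S n)) by (apply lt_0_INR; lia).
assert (H2 : 2 * INR (S n) <= beta * beta).
2:{ rewrite <- (sqrt_square beta) by easy. now apply sqrt_le_1_alt. }
apply Rnot_lt_le. intros Hlt.
set (f := fun x => INR (S n) * cos x ^ (2 * S n + 2)).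
assert (Hf : continuity_pt f 0).
{ apply derivable_continuous_pt. unfold f. exists 0. apply is_derive_Reals.
  auto_derive; [easy |]. rewrite sin_0. ring. }
destruct (continuity_pt_gt f 0 (beta * beta / 2) Hf) as [d [Hd Hn]].
{ unfold f. rewrite cos_0, pow1. lra. }
set (x := Rmin (d / 2) (/ (1 + beta))).
assert (X1 : x <= d / 2) by apply Rmin_l. assert (X2 : x <= / (1 + beta)) by apply Rmin_r.
assert (X0 : 0 < x) by (apply Rmin_glb_lt; [lra | apply Rinv_0_lt_compat; lra]).
assert (X3 : x * (1 + beta) <= 1).
{ apply Rmult_le_reg_r with (/ (1 + beta)); [apply Rinv_0_lt_compat; lra |].
  rewrite Rmult_assoc, Rinv_r by lra. lra. }
assert (HPI2 := PI2_1).
assert (Hx : 0 < x < PI / 2) by nra.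
assert (Hcos := admissible_cos_le n beta x Hadm Hx ltac:(nra)).
assert (Hfx : beta * beta / 2 < f x) by (apply Hn; rewrite Rminus_0_r, Rabs_pos_eq; lra).
unfold f in Hfx.
assert (Hc0 : 0 < cos x) by (apply cos_gt_0; lra).
assert (Hs0 : 0 < sin x) by (apply sin_gt_0; lra).
assert (Hsc : sin x * sin x + cos x * cos x = 1) by apply sin2_cos2.
assert (Hpow := one_minus_pow_ge (S n) (cos x ^ 2) ltac:(simpl; nra)).
rewrite <- pow_mult in Hpow.
replace (1 - cos x ^ 2) with (sin x * sin x) in Hpow by (simpl; lra).
assert (Hq : 1 - (beta * x) * (beta * x) / 2 <= cos (beta * x)).
{ replace (beta * x) with (2 * (beta * x / 2)) at 3 by field. rewrite cos_2a_sin.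
  destruct (Req_dec (beta * x) 0) as [E | E].
  - rewrite E. replace (0 / 2) with 0 by field. rewrite sin_0. lra.
  - assert (A : 0 < beta * x / 2) by nra.
    assert (B := sin_lt_x _ A). assert (C : 0 <= sin (beta * x / 2)) by (apply sin_ge_0; nra). nra. }
assert (Htan : x * cos x <= sin x).
{ destruct (MVT_gen (fun y => sin y - y * cos y) 0 x (fun y => y * sin y)) as [y [Hy1 Hy2]].
  - intros y _. auto_derive; [easy | ring].
  - intros y _. apply derivable_continuous_pt. exists (y * sin y). apply is_derive_Reals.
    auto_derive; [easy | ring].
  - rewrite Rmin_left, Rmax_right in Hy1 by lra. rewrite sin_0 in Hy2.
    assert (0 <= sin y) by (apply sin_ge_0; lra).
    assert (0 <= y * sin y * (x - 0)) by (apply Rmult_le_pos; [apply Rmult_le_pos |]; lra). lra. }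
assert (Hp0 : 0 < cos x ^ (2 * S n)) by now apply pow_lt.
rewrite pow_add in Hfx. simpl (cos x ^ 2) in Hfx. rewrite Rmult_1_r in Hfx.
assert (Hxx : (x * cos x) * (x * cos x) <= sin x * sin x) by (apply Rmult_le_compat; nra).
assert (K : INR (S n) * cos x ^ (2 * S n) * ((x * cos x) * (x * cos x))
  <= INR (S n) * cos x ^ (2 * S n) * (sin x * sin x)) by (apply Rmult_le_compat_l; [nra | easy]).
assert (L : beta * beta / 2 * (x * x) < INR (S n) * (cos x ^ (2 * S n) * (cos x * cos x)) * (x * x))
  by (apply Rmult_lt_compat_r; [nra | easy]).
lra.
Qed.

Theorem theorem9 (n : nat) (hn : (1 <= n)%nat) :
  admissible n (sqrt (2 * INR n)) /\
  (forall beta : R, admissible n beta -> sqrt (2 * INR n) <= beta).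
Proof.
split; [apply admissible_sqrt; lia |].
intros beta H. destruct n as [|n]; [lia |]. now apply admissible_ge.
Qed.
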